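(* Let $T$ be one of the affine Dynkin diagrams $\tilde A_n$, $\tilde D_n$, $\tilde E_6$, $\tilde E_7$, $\tilde E_8$ with vertices $0,1,\dots,n$ ($n=6,7,8$ in the $E$ cases; $0$ is the affine vertex), let $B$ be the corresponding Klein group, and let $z=q+q^{-1}$. Let $P_i(q)$, $Z_i(q)$, $H_{i0}(z)$, $-1\le i\le n$, be as defined in the context. 1) For $-1\le i,j\le n$ $$\frac{P_i(q)}{P_j(q)}=\frac{Z_i(q)}{Z_j(q)}=\frac{H_{i0}(z)}{H_{j0}(z)},\qquad\text{in particular, for } i\ge 0,\quad P_i(q)=\frac{H_{i0}(z)}{qH_{-10}(z)}.$$ The $H_{i0}(z)$ are expressed through Coxeter polynomials as follows (with $A_0=1$, $D_2(q)=A_1^2(q)$, $D_3=A_3$; argument $q$ omitted). - $\tilde A_n$ (vertices numbered along the cycle): $H_{00}=A_n$, $H_{j0}=A_{j-1}+A_{n-j}$ for $1\le j\le n$. - $\tilde D_n$ (chain $c_1,\dots,c_{n-3}$; leaves $0$ and $l$ attached to $c_1$; leaves $l',l''$ attached to $c_{n-3}$): $H_{00}=D_n$, $H_{l0}=D_{n-2}$, $H_{c_k0}=A_1D_{n-1-k}$ for $1\le k\le n-3$, $H_{l'0}=H_{l''0}=A_1^2$. - $\tilde E_6$ (central vertex with three arms of length 2): along the arm of the affine vertex, from vertex $0$ to the centre inclusive: $E_6, A_5, A_2^2$; along each other arm, going outward from the centre: $A_1A_2, A_2$. - $\tilde E_7$ (arms of lengths $3,3,1$): from vertex $0$ to the centre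 inclusive: $E_7,D_6,A_5,A_1A_3$; along the other arm of length 3, outward: $A_1A_2,A_1^2,A_1$; on the arm of length 1: $A_3$. - $\tilde E_8$ (arms of lengths $5,2,1$): from vertex $0$ to the centre inclusive: $E_8,E_7,E_6,D_5,A_4,A_1A_2$; along the arm of length 2, outward: $A_1^2, A_1$; on the arm of length 1: $A_2$. Moreover $H_{-10}(z)=T(q)$, the Coxeter polynomial, for $\tilde A_{2m-1},\tilde D_n,\tilde E_6,\tilde E_7,\tilde E_8$. The exception is formed by the polynomials $H_{-10}(z)$ for $\tilde A_{2m}$: they coincide with the characteristic polynomials of the graphs $\tilde A_{2m}$, and (with the convention $\tilde A_0(z)=z=A_1(z)$, i.e. the term $\tilde A_0^\#(z)$ below is $z$) $$q\tilde A_{2m}^\#(z)=q\Big(z^{2m+1}-\sum_{i=1}^m\binom{2m+1}{i}\tilde A_{2m-2i}^\#(z)-2\Big)=q^{-2m}(q^{2m+1}-1)^2 .$$ For every branch of $\tilde D_n,\tilde E_6,\tilde E_7,\tilde E_8$, i.e. every path $v_0,v_1,\dots,v_k$ ($k\ge2$) in the diagram extended by the vertex $-1$ whose interior vertices $v_1,\dots,v_{k-1}$ have valence two, the polynomials $C_i:=H_{v_i0}$, regarded as functions of $q$, satisfy for $1\le i\le k-1$ $$C_{i-1}-zC_i+C_{i+1}=0,\qquad \begin{pmatrix}C_{i-1}&C_i\\C_i&C_{i+1}\end{pmatrix}=\begin{pmatrix}0&1\\-1&z\end{pmatrix}^{i-1}\begin{pmatrix}C_0&C_1\\C_1&C_2\end{pmatrix},$$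 $$\frac{C_{i-1}}{C_i}=\begin{vmatrix}C_0&C_1\\C_1&C_2\end{vmatrix}\sum_{j=i+1}^k\frac1{C_{j-1}C_j}+\frac{C_{k-1}}{C_k},\qquad \frac{C_i}{C_{i-1}}=\cfrac{1}{z-\cfrac{1}{z-\dots-\cfrac{1}{z-\frac{C_k}{C_{k-1}}}}}\ \ (z \text{ occurring } k-i \text{ times}),$$ $$\mathrm{Bez}(C_{i-1},C_i)=(1-(xy)^{-1})\sum_{j=i}^{k-1}C_j(x)C_j(y)+\mathrm{Bez}(C_{k-1},C_k),\qquad \mathrm{Wr}(C_{i-1},C_i)=(1-x^{-2})\sum_{j=i}^{k-1}C_j^2(x)+\mathrm{Wr}(C_{k-1},C_k).$$ 2) For $1\le i\le n$ $$P_i^2(q)=\frac{1}{qH_{-10}(z)}\begin{vmatrix}P_0(q)&T_i(q)\\ q^{-1}&\tilde T_i(q)\end{vmatrix},$$ where $T_i(q)$ (resp. $\tilde T_i(q)$) is the Coxeter polynomial of the diagram obtained by deleting the vertex $i$ from the corresponding Euclidean (resp. affine) Dynkin diagram. 3) For $\tilde D_n,\tilde E_6,\tilde E_7,\tilde E_8$ and $0\le i\le n$ $$\mathrm{Bez}(P_{i_{\to}}(q),P_i(q))=(1-(xy)^{-1})\sum_{k\in Q_i}P_k(x)P_k(y),\qquad \mathrm{Wr}(P_{i_{\to}}(q),P_i(q))=(1-x^{-2})\sum_{k\in Q_i}P_k^2(x),$$ in particular, $$\mathrm{Bez}(q^{-1},P_0(q))=(1-(xy)^{-1})\sum_{k\ge0}P_k(x)P_k(y),\qquad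 \mathrm{Wr}(q^{-1},P_0(q))=(1-x^{-2})\sum_{k\ge0}P_k^2(x).$$ The last two formulas also hold for $\tilde A_n$. The analogues of the remaining formulas for $\tilde A_n$ are the following equalities, valid for $1\le i\le j\le n$ (with $P_{n+1}(q)=P_0(q)$): $$\mathrm{Bez}(P_{i-1}(q),P_i(q))+\mathrm{Bez}(P_j(q),P_{j+1}(q))=(1-(xy)^{-1})\sum_{k=i}^jP_k(x)P_k(y),$$ $$\mathrm{Wr}(P_{i-1}(q),P_i(q))+\mathrm{Wr}(P_j(q),P_{j+1}(q))=(1-x^{-2})\sum_{k=i}^jP_k^2(x).$$ The same formulas hold if all $P_i(q)$ are replaced by $Z_i(q)$ and $q^{-1}$ by $q^{-1}(1-q^a)(1-q^b)$. There are matrix versions of all these identities, which follow from the two general matrix identities (the matrix factorization of Bezoutians and its Cauchy–Binet consequence) recalled at the end of the context. 4) For $0\le i\le n$ $$qP_i(q)=\sum_{k\ge0}d_{i0}^k\,z^{-k-1}.$$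
   Context: Klein groups: a Klein group (binary polyhedral group) is a finite subgroup $B\subset SU(2)$. By the McKay correspondence it has an affine Dynkin diagram $T$ (one of $\tilde A_n$ (the cycle with $n+1$ vertices, $n\ge2$), $\tilde D_n$ ($n\ge4$), $\tilde E_6$, $\tilde E_7$, $\tilde E_8$), whose vertices $0,\dots,n$ correspond to the irreducible representations $r_i$ of $B$; $r_0$ is trivial and the vertex $0$ (the affine vertex) is the one added in passing from the Euclidean (finite) diagram $A_n,D_n,E_6,E_7,E_8$ to the affine one. The vertices of $\tilde A_n$ are numbered $0,1,\dots,n$ along the cycle. All edges have weight $1$. The Poincaré series are $P_i(q)=\sum_{m\ge0}m_{m,i}q^m$, where $m_{m,i}$ is the multiplicity of $r_i$ in the restriction to $B$ of the $m$-th symmetric power of the standard two-dimensional representation of $SU(2)$; they are rational functions of $q$. By Kostant, $P_i(q)=Z_i(q)/((1-q^a)(1-q^b))$ with polynomials $Z_i(q)$, where $a+b=h+2$, $ab=2|B|$, $h$ the sum of the dimensions of the irreducible representations of $B$; explicitly $(a,b)=(2,n+1),(4,2n-4),(6,8),(8,12),(12,20)$ for $\tilde A_n,\tilde D_n,\tilde E_6,\tilde E_7,\tilde E_8$. Polynomials: for a graph $G$ with $N$ vertices and edge weights $a_{ij}=a_{ji}$ ($a_{ij}=0$ when there is no edge), $S$ is the upper triangular matrix with ones on the diagonal and $-a_{ij}$ above it, $C=S+S^t$; the Coxeter polynomial is $G(q)=\det(qS+q^{-1}S^t)$ and the characteristic polynomial is $G^\#(z)=\det((z-2)E+C)$, $E$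 the identity matrix; here $z=q+q^{-1}$. The Coxeter polynomial of a tree or forest does not depend on the vertex numbering; for the even cycle $\tilde A_{2m-1}$ it is taken with respect to a numbering in which all vertices of one part of the bipartition come before all vertices of the other part. $A_k(q)$, $D_k(q)$, $E_k(q)$ are the Coxeter polynomials of the Euclidean Dynkin diagrams. For $0\le i\le n$, $H_{i0}(z)$ is the algebraic complement (cofactor) of the entry in position $(i,0)$ of the matrix $(z-2)E+C$ of the affine diagram $T$. Extra vertex: one adds a further vertex $-1$ (not belonging to $T$), joined by an edge of weight $1$ with the vertex $0$, and puts $P_{-1}(q)=q^{-1}$, $Z_{-1}(q)=q^{-1}(1-q^a)(1-q^b)$, $H_{-10}(z)=T^\#(z)$. For a vertex $i\ge 0$ of a tree $T$, $i_{\to}$ is the vertex joined with $i$ by an edge and lying closer to $-1$ than $i$ (so $0_{\to}=-1$); $Q_i$ is the set of vertices whose shortest paths to the vertex $-1$ contain the vertex $i$ (so $i\in Q_i$). $d_{i0}^k$ is the sum of the weights of all paths of length $k$ (walks, vertex repetitions allowed) in $T$ from vertex $i$ to vertex $0$, the weight of a path being the product of the weights of its edges. The series in part 4 is understood as a formal power series in $q$ via $z^{-1}=q/(1+q^2)$. For functions $f,g$ of one variable, $\mathrm{Bez}(f,g)=\dfrac{f(x)g(y)-f(y)g(x)}{x-y}$ and $\mathrm{Wr}(f,g)=\lim_{y\to x}\mathrm{Bez}(f,g)=f'(x)g(x)-f(x)g'(x)$; in the statement all functions are regarded as functions of $q$. General matrix identities referred to in part 3: for a graph $G_{\bar n}$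 on vertices $\bar n=\{1,\dots,n\}$ let $H_{ij}(z)$ be the cofactors of the matrix $(z-2)E+C$, and regard Bezoutians as taken in the variable $z$. For variables $x_1,\dots,x_m$ and $y_1,\dots,y_r$ one has the matrix equality ($1\le l\le m$, $1\le s\le r$, $k\in\bar n$) $$\big(\mathrm{Bez}(G_{\bar n}^\#(z),H_{ij}(z))(x_l,y_s)\big)_{l,s}=(H_{ik}(x_l))_{l,k}\,\big((H_{jk}(y_s))_{s,k}\big)^t,$$ and, if $m=r\le n$, by Cauchy–Binet $$\det\big(\mathrm{Bez}(G_{\bar n}^\#(z),H_{ij}(z))(x_l,y_s)\big)=\sum_{1\le k_1<\dots<k_m\le n}\det(H_{ik_t}(x_l))\,\det(H_{jk_t}(y_s)).$$
   Formalization: Two formulas false as printed are corrected: in part 3 for Ã_n the sign before Bez(P_j,P_{j+1}) and Wr(P_j,P_{j+1}) (also for Z) is minus, not plus; in part 1 for Ã_{2m} each summand Ã_{2m-2i}^#(z) with i<m becomes Ã_{2m-2i}^#(z)+2. *)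

(* Defs.v *)
From mathcomp Require Import all_boot all_order all_algebra.
From mathcomp Require Import fingroup perm mxrepresentation character.
From mathcomp Require Import reals.
From mathcomp Require Import complex.

Set Implicit Arguments.
Unset Strict Implicit.
Unset Printing Implicit Defensive.

Import Order.TTheory GRing.Theory Num.Theory.
Local Open Scope ring_scope.

(* A graph on the ordered vertex set 'I_N is given by its symmetric matrix [a]
   of edge weights, [a i j = 0] meaning that there is no edge. *)

Definition weighted_graph (R : comNzRingType) N (a : 'M[R]_N) : Prop :=
  a^T = a /\ forall i, a i i = 0.

Definition triang_mx (R : comNzRingType) N (a : 'M[R]_N) : 'M[R]_N :=
  \matrix_(i, j) (if i == j then 1 else if (i < j)%N then - a i j else 0).

Definition cartan_mx (R : comNzRingType) N (a : 'M[R]_N) : 'M[R]_N :=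
  triang_mx a + (triang_mx a)^T.

Definition graph_mx (R : comNzRingType) N (a : 'M[R]_N) (z : R) : 'M[R]_N :=
  (z - 2)%:M + cartan_mx a.

(* G^#(z) *)
Definition graph_poly (R : comNzRingType) N (a : 'M[R]_N) (z : R) : R :=
  \det (graph_mx a z).

(* H_ij(z) *)
Definition graph_cof (R : comNzRingType) N (a : 'M[R]_N) (i j : 'I_N) (z : R) : R :=
  cofactor (graph_mx a z) i j.

(* G(q) *)
Definition coxeter (F : fieldType) N (a : 'M[F]_N) (q : F) : F :=
  \det (q *: triang_mx a + q^-1 *: (triang_mx a)^T).

Definition del_vertex (R : nmodType) N (i : 'I_N) (a : 'M[R]_N) : 'M[R]_N.-1 :=
  row' i (col' i a).

Definition edge (es : seq (nat * nat)) (i j : nat) : bool :=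
  ((i, j) \in es) || ((j, i) \in es).

(* The graph on 'I_N with edge list [es], all weights being 1. *)
Definition simple_graph (R : comNzRingType) N (es : seq (nat * nat)) : 'M[R]_N :=
  \matrix_(i, j) (edge es i j)%:R.

Definition chain (k : nat) : seq (nat * nat) := [seq (i, i.+1) | i <- iota 0 k.-1].

(* D_k (k >= 4): the chain 0, ..., k-2 with k-1 attached to k-3.
   E_k (k = 6, 7, 8): the chain 0, ..., k-2 with k-1 attached to 2. *)
Definition edgesD (k : nat) := (k - 3, k.-1)%N :: chain k.-1.
Definition edgesE (k : nat) := (2, k.-1)%N :: chain k.-1.

Definition coxA (F : fieldType) (q : F) (k : nat) : F :=
  coxeter (simple_graph F k (chain k)) q.

Definition coxD (F : fieldType) (q : F) (k : nat) : F :=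
  match k with
  | 2 => coxA q 1 ^+ 2
  | 3 => coxA q 3
  | _ => coxeter (simple_graph F k (edgesD k)) q
  end.

Definition coxE (F : fieldType) (q : F) (k : nat) : F :=
  coxeter (simple_graph F k (edgesE k)) q.

Inductive affine_type := AffA of nat | AffD of nat | AffE6 | AffE7 | AffE8.

Definition admissible (T : affine_type) : bool :=
  match T with AffA n => (2 <= n)%N | AffD n => (4 <= n)%N | _ => true end.

Definition is_typeA (T : affine_type) : bool := if T is AffA _ then true else false.

(* The vertices of T are 0, ..., rk T. *)
Definition rk (T : affine_type) : nat :=
  match T with AffA n => n | AffD n => n | AffE6 => 6 | AffE7 => 7 | AffE8 => 8 end.

(* The affine vertex is 0.
   D~_n: 1 is the leaf l, the chain c_1, ..., c_(n-3) is 2, ..., n-2 (so that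
     c_k = k+1), and n-1, n are the leaves l', l''.
   E~_6: centre 2, arms 1-0, 3-4, 5-6.
   E~_7: centre 3, arms 2-1-0, 4-5-6, 7.
   E~_8: centre 5, arms 4-3-2-1-0, 6-7, 8. *)
Definition affine_edges (T : affine_type) : seq (nat * nat) :=
  match T with
  | AffA n => (n, 0)%N :: chain n.+1
  | AffD n => [:: (0, 2); (1, 2); (n - 2, n - 1); (n - 2, n)]%N ++
              [seq (i, i.+1) | i <- iota 2 (n - 4)]
  | AffE6 => [:: (0, 1); (1, 2); (2, 3); (3, 4); (2, 5); (5, 6)]%N
  | AffE7 => [:: (0, 1); (1, 2); (2, 3); (3, 4); (4, 5); (5, 6); (3, 7)]%N
  | AffE8 => [:: (0, 1); (1, 2); (2, 3); (3, 4); (4, 5); (5, 6); (6, 7); (5, 8)]%N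
  end.

Definition affine_adj (T : affine_type) : rel 'I_(rk T).+1 :=
  fun i j => edge (affine_edges T) i j.
Arguments affine_adj : clear implicits.

Definition affine_mx (R : comNzRingType) (T : affine_type) : 'M[R]_((rk T).+1) :=
  simple_graph R _ (affine_edges T).

Definition euclid_mx (R : comNzRingType) (T : affine_type) : 'M[R]_(rk T) :=
  del_vertex ord0 (affine_mx R T).

Definition kostant_ab (T : affine_type) : nat * nat :=
  match T with
  | AffA n => (2, n.+1)
  | AffD n => (4, 2 * n - 4)
  | AffE6 => (6, 8)
  | AffE7 => (8, 12)
  | AffE8 => (12, 20)
  end%N.

(* The numbering t |-> s t of the vertices lists all vertices of one part of a
   bipartition of the graph before all vertices of the other part. *)
Definition bipartite_numbering (R : comNzRingType) N (a : 'M[R]_N) (s : 'S_N) : Prop :=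
  exists c : nat, forall t u : 'I_N, a (s t) (s u) != 0 -> (t < c)%N != (u < c)%N.

Definition renumber (R : comNzRingType) N (a : 'M[R]_N) (s : 'S_N) : 'M[R]_N :=
  \matrix_(t, u) a (s t) (s u).

(* [sym_mx m g] is the matrix of the m-th symmetric power of g in the basis
   e_0^(m-k) e_1^k (0 <= k <= m), for g acting on row vectors by
   e_i |-> g_i0 e_0 + g_i1 e_1; the monomial e_0^(m-l) e_1^l is recorded as 'X^l. *)
Definition lin_form (F : fieldType) (g : 'M[F]_2) (i : 'I_2) : {poly F} :=
  (g i 0)%:P + g i 1 *: 'X.

Definition sym_mx (F : fieldType) (m : nat) (g : 'M[F]_2) : 'M[F]_m.+1 :=
  \matrix_(k, l) (lin_form g 0 ^+ (m - k) * lin_form g 1 ^+ k)`_l.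

Section SymmetricPower.

Variable F : fieldType.

Let homog m (u v p : {poly F}) : {poly F} :=
  \sum_(l < m.+1) p`_l *: (u ^+ (m - l) * v ^+ l).

Lemma homogS m u v (a b : F) (p : {poly F}) : (size p <= m.+1)%N ->
  homog m.+1 u v ((a%:P + b *: 'X) * p) = (a *: u + b *: v) * homog m u v p.
Proof.
move=> sp; rewrite /homog [RHS]mulrDl.
have cE l : ((a%:P + b *: 'X) * p)`_l = a * p`_l + b * (if l is l'.+1 then p`_l' else 0).
  rewrite mulrDl coefD mul_polyC coefZ -scalerAl coefZ coefXM.
  by case: l.
under eq_bigr => l _ do rewrite cE scalerDl.
rewrite big_split /=; congr (_ + _).
  rewrite big_ord_recr /= [p`_m.+1]nth_default // mulr0 scale0r addr0.
  rewrite mulr_sumr; apply: eq_bigr => l _.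
  by rewrite -!scalerAr -scalerAl (subSn (ltn_ord l : (l <= m)%N)) exprS mulrA !scalerA (mulrC a).
rewrite big_ord_recl /= mulr0 scale0r add0r mulr_sumr; apply: eq_bigr => l _.
by rewrite -!scalerAr -scalerAl /bump /= add1n subSS exprS mulrCA !scalerA (mulrC b).
Qed.

Lemma size_lin_prod (g : 'M[F]_2) j k :
  (size (lin_form g 0 ^+ j * lin_form g 1 ^+ k)%R <= (j + k).+1)%N.
Proof.
have sl i : (size (lin_form g i) <= 2)%N.
  rewrite /lin_form (leq_trans (size_polyD _ _)) // geq_max.
  rewrite (leq_trans (size_polyC_leq1 _)) //=.
  by rewrite (leq_trans (size_scale_leq _ _)) // size_polyX.
have se i t : (size (lin_form g i ^+ t)%R <= t.+1)%N.
  rewrite (leq_trans (size_poly_exp_leq _ _)) // ltnS.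
  by rewrite -{2}[t]mul1n leq_mul2r -subn1 leq_subLR sl orbT.
rewrite (leq_trans (size_polyMleq _ _)) //.
by rewrite -subn1 leq_subLR (leq_trans (leq_add (se _ _) (se _ _))) // addSn addnS.
Qed.

Lemma homog_lin (g : 'M[F]_2) u v j k :
  homog (j + k) u v (lin_form g 0 ^+ j * lin_form g 1 ^+ k) =
  (g 0 0 *: u + g 0 1 *: v) ^+ j * (g 1 0 *: u + g 1 1 *: v) ^+ k.
Proof.
elim: j k => [|j IHj] k.
  rewrite add0n !expr0 !mul1r; elim: k => [|k IHk].
    by rewrite /homog big_ord1 !expr0 mulr1 coef1 scale1r.
  rewrite !exprS -IHk homogS //.
  by have:= size_lin_prod g 0 k; rewrite expr0 mul1r.
by rewrite addSn !exprS -!mulrA -IHj homogS // size_lin_prod.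
Qed.

Lemma sym_mx1 m : sym_mx m (1%:M : 'M[F]_2) = 1%:M.
Proof.
apply/matrixP => k l; rewrite !mxE.
have -> : lin_form (1%:M : 'M[F]_2) 0 = 1 by rewrite /lin_form !mxE scale0r addr0.
have -> : lin_form (1%:M : 'M[F]_2) 1 = 'X by rewrite /lin_form !mxE scale1r add0r.
by rewrite expr1n mul1r coefXn eq_sym.
Qed.

Lemma sym_mxM m (g h : 'M[F]_2) : sym_mx m (g *m h) = sym_mx m g *m sym_mx m h.
Proof.
apply/matrixP => k l; rewrite !mxE.
have linM i : lin_form (g *m h) i = g i 0 *: lin_form h 0 + g i 1 *: lin_form h 1.
  rewrite /lin_form !mxE !big_ord_recl !big_ord0 !addr0 /=.
  rewrite !scalerDr -!mul_polyC !rmorphD !rmorphM /= !mulrDl.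
  have -> : lift ord0 ord0 = 1 :> 'I_2 by apply/val_inj.
  rewrite !mulrA addrACA; congr (_ + _).
have le_km : (k <= m)%N by rewrite -ltnS.
rewrite !linM -homog_lin subnK // coef_sum; apply: eq_bigr => j _.
by rewrite coefZ !mxE.
Qed.

Lemma sym_mx_repr (gT : finGroupType) (G : {group gT})
    (rho : mx_representation F G 2) m : mx_repr G (fun g => sym_mx m (rho g)).
Proof.
by split=> [|g h Gg Gh]; rewrite ?repr_mx1 ?sym_mx1 ?repr_mxM ?sym_mxM.
Qed.

Definition sym_repr (gT : finGroupType) (G : {group gT})
    (rho : mx_representation F G 2) m : mx_representation F G m.+1 :=
  MxRepresentation (sym_mx_repr rho m).

End SymmetricPower.

(* [rho] identifies the finite group [B] with a subgroup of SU(2). *)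
Definition klein_group (R : realType) (gT : finGroupType) (B : {group gT})
    (rho : mx_representation R[i] B 2) : Prop :=
  mx_faithful rho /\
  forall g, g \in B -> rho g \is unitarymx /\ \det (rho g) = 1.

(* [rho] is isomorphic to the direct sum of [c i] copies of the [r i]. *)
Definition decomposes (F : fieldType) (gT : finGroupType) (B : {group gT}) N
    (r : 'I_N -> representation F B) d (rho : mx_representation F B d)
    (c : 'I_N -> nat) : Prop :=
  mx_rsim rho (\big[dadd_grepr/grepr0]_(i < N) muln_grepr (r i) (c i)).

(* The [r i] are the irreducible representations of B up to isomorphism, each
   listed once, [r 0] is trivial, and T is the McKay graph of [rho]. *)
Definition mckay (F : fieldType) (T : affine_type) (gT : finGroupType)
    (B : {group gT}) (rho : mx_representation F B 2)
    (r : 'I_(rk T).+1 -> representation F B) : Prop :=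
  [/\ forall i, mx_irreducible (r i),
      forall i j, mx_rsim (r i) (r j) -> i = j,
      forall d (sigma : mx_representation F B d),
        mx_irreducible sigma -> exists i, mx_rsim sigma (r i),
      rdegree (r ord0) = 1%N /\ (forall g, g \in B -> r ord0 g = 1%:M)
    & forall i, decomposes r (prod_repr rho (r i)) (affine_adj T i)].

Notation Qq := {fraction {poly rat}}.
Local Notation "p %:F" := (@FracField.tofrac {poly rat} p).

Definition q : Qq := ('X : {poly rat})%:F.
Definition zq : Qq := q + q^-1.

Definition regular_at_0 (f : Qq) : Prop :=
  exists n d : {poly rat}, d.[0] != 0 /\ f = n%:F / d%:F.

(* [f] is the sum of the series of the [u k] in Q((q)) with its q-adic topology. *)
Definition qadic_sum (u : nat -> Qq) (f : Qq) : Prop :=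
  forall N, exists M0, forall M, (M0 <= M)%N ->
    exists2 g, regular_at_0 g & f - \sum_(k < M) u k = q ^+ N * g.

Definition fnum (f : Qq) : {poly rat} := \n_(generic_quotient.repr f).
Definition fden (f : Qq) : {poly rat} := \d_(generic_quotient.repr f).

Definition fderiv (f : Qq) : Qq :=
  ((fnum f)^`() * fden f - fnum f * (fden f)^`())%:F / (fden f ^+ 2)%:F.

Definition Wr (f g : Qq) : Qq := fderiv f * g - f * fderiv g.

Definition Bez (F : fieldType) (f g : F -> F) (x y : F) : F :=
  (f x * g y - f y * g x) / (x - y).

(* An identity in Q(x, y, ...) is stated by letting the variables be elements,
   transcendental over Q, of an arbitrary extension L of Q; pairwise distinct
   variables of a field of rational functions are a special case. The value
   [ev iota x f] does not depend on the fraction representing [f] because no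
   nonzero polynomial vanishes at such an x. *)
Definition transc (L : fieldType) (iota : {rmorphism rat -> L}) (x : L) : Prop :=
  ~ algebraicOver iota x.

Definition ev (L : fieldType) (iota : {rmorphism rat -> L}) (x : L) (f : Qq) : L :=
  (map_poly iota (fnum f)).[x] / (map_poly iota (fden f)).[x].

Definition kernel := forall L : fieldType, {rmorphism rat -> L} -> L -> L -> L.

Definition Bezq (f g : Qq) : kernel :=
  fun L iota x y => Bez (ev iota ^~ f) (ev iota ^~ g) x y.

Definition addk (b c : kernel) : kernel := fun L iota x y => b L iota x y + c L iota x y.

Definition increasing m N (f : {ffun 'I_m -> 'I_N}) : bool :=
  [forall s : 'I_m, forall t : 'I_m, (s < t)%N ==> (f s < f t)%N].

(* b(x, y) = (1 - (xy)^-1) \sum_(k in S) F_k(x) F_k(y), its matrix version, and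
   the determinant identity which follows from it by Cauchy-Binet. *)
Definition bez_formula N (b : kernel) (F : 'I_N -> Qq) (S : {set 'I_N}) : Prop :=
  forall (L : fieldType) (iota : {rmorphism rat -> L}),
  [/\ forall x y : L, transc iota x -> transc iota y -> x != y ->
        b L iota x y =
        (1 - (x * y)^-1) * \sum_(k in S) ev iota x (F k) * ev iota y (F k),
      forall m r (x : 'I_m -> L) (y : 'I_r -> L),
        (forall l, transc iota (x l)) -> (forall s, transc iota (y s)) ->
        (forall l s, x l != y s /\ x l * y s != 1) ->
        \matrix_(l, s) (b L iota (x l) (y s) / (1 - (x l * y s)^-1)) =
        (\matrix_(l < m, k < #|S|) ev iota (x l) (F (enum_val k))) *m
        (\matrix_(s < r, k < #|S|) ev iota (y s) (F (enum_val k)))^T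
    & forall m (x y : 'I_m -> L), (m <= #|S|)%N ->
        (forall l, transc iota (x l)) -> (forall s, transc iota (y s)) ->
        (forall l s, x l != y s /\ x l * y s != 1) ->
        \det (\matrix_(l, s) (b L iota (x l) (y s) / (1 - (x l * y s)^-1))) =
        \sum_(f : {ffun 'I_m -> 'I_#|S|} | increasing f)
          \det (\matrix_(l, t) ev iota (x l) (F (enum_val (f t)))) *
          \det (\matrix_(l, t) ev iota (y l) (F (enum_val (f t))))].

Definition wr_formula N (w : Qq) (F : 'I_N -> Qq) (S : {set 'I_N}) : Prop :=
  w = (1 - q ^- 2) * \sum_(k in S) F k ^+ 2.

(* The variable of the Bezoutian is z here; [x l] and [y s] may be any elements
   of the field of weights, hence in particular independent variables. *)
Definition matrix_bezout_identities : Prop :=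
  forall (F : fieldType) N (a : 'M[F]_N) (i j : 'I_N), weighted_graph a ->
  (forall m r (x : 'I_m -> F) (y : 'I_r -> F), (forall l s, x l != y s) ->
     \matrix_(l, s) Bez (graph_poly a) (graph_cof a i j) (x l) (y s) =
     (\matrix_(l < m, k < N) graph_cof a i k (x l)) *m
     (\matrix_(s < r, k < N) graph_cof a j k (y s))^T) /\
  (forall m (x y : 'I_m -> F), (m <= N)%N -> (forall l s, x l != y s) ->
     \det (\matrix_(l, s) Bez (graph_poly a) (graph_cof a i j) (x l) (y s)) =
     \sum_(f : {ffun 'I_m -> 'I_N} | increasing f)
       \det (\matrix_(l, t) graph_cof a i (f t) (x l)) *
       \det (\matrix_(l, t) graph_cof a j (f t) (y l))).

Definition mx2 (F : fieldType) (a b c d : F) : 'M[F]_2 :=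
  \matrix_(i, j) (if i == 0 then (if j == 0 then a else b)
                  else (if j == 0 then c else d)).

Definition is_poincare N (mult : nat -> 'I_N -> nat) (P : 'I_N -> Qq) : Prop :=
  forall i, qadic_sum (fun m => (mult m i)%:R * q ^+ m) (P i).

Definition kostant_den (T : affine_type) : Qq :=
  (1 - q ^+ (kostant_ab T).1) * (1 - q ^+ (kostant_ab T).2).

(* T extended by the vertex -1, represented by [None]. *)
Definition ext_adj (T : affine_type) : rel (option 'I_(rk T).+1) :=
  fun u v => match u, v with
  | Some i, Some j => affine_adj T i j
  | Some i, None | None, Some i => i == ord0
  | None, None => false
  end.
Arguments ext_adj : clear implicits.

Definition extend N (f : Qq) (F : 'I_N -> Qq) : option 'I_N -> Qq := oapp F f.

Definition Hz (T : affine_type) : option 'I_(rk T).+1 -> Qq :=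
  extend (graph_poly (affine_mx Qq T) zq)
         (fun i => graph_cof (affine_mx Qq T) i ord0 zq).

Definition Pext N (P : 'I_N -> Qq) : option 'I_N -> Qq := extend q^-1 P.

Definition Zext (T : affine_type) (P : 'I_(rk T).+1 -> Qq) : option 'I_(rk T).+1 -> Qq :=
  fun u => Pext P u * kostant_den T.

Definition cA (k : nat) : Qq := coxA q k.
Definition cD (k : nat) : Qq := coxD q k.
Definition cE (k : nat) : Qq := coxE q k.

(* The Coxeter polynomial products for H_i0, in the numbering of [affine_edges];
   for D~_n the vertex c_k is i = k+1, so that D_(n-1-k) is D_(n-i). *)
Definition H_table (T : affine_type) (i : nat) : Qq :=
  match T with
  | AffA n => if i == 0%N then cA n else cA (i - 1) + cA (n - i)
  | AffD n => if i == 0%N then cD n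
              else if i == 1%N then cD (n - 2)
              else if (i <= n - 2)%N then cA 1 * cD (n - i)
              else cA 1 ^+ 2
  | AffE6 => nth 0 [:: cE 6; cA 5; cA 2 ^+ 2; cA 1 * cA 2; cA 2; cA 1 * cA 2; cA 2] i
  | AffE7 => nth 0 [:: cE 7; cD 6; cA 5; cA 1 * cA 3; cA 1 * cA 2; cA 1 ^+ 2; cA 1; cA 3] i
  | AffE8 => nth 0 [:: cE 8; cE 7; cE 6; cD 5; cA 4; cA 1 * cA 2; cA 1 ^+ 2; cA 1; cA 2] i
  end.

(* A~_k^#(z), with the convention A~_0^#(z) = z. For even k > 0 it is
   q^(k+1) + q^-(k+1) - 2, so that the binomial expansion of (q + q^-1)^(2m+1)
   involves A~_(2m-2i)^#(z) + 2 for i < m, and z for i = m. *)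
Definition cycle_poly (k : nat) (z : Qq) : Qq :=
  if k == 0%N then z else graph_poly (affine_mx Qq (AffA k)) z.

Definition is_branch (T : affine_type) (k : nat) (v : nat -> option 'I_(rk T).+1) : Prop :=
  [/\ (2 <= k)%N,
      forall i, (i < k)%N -> ext_adj T (v i) (v i.+1),
      forall i j, (i <= k)%N -> (j <= k)%N -> v i = v j -> i = j
    & forall i, (0 < i < k)%N -> #|[pred w | ext_adj T (v i) w]| = 2%N].

(* The length of the shortest paths from u to v; #|V| if there is none. *)
Definition gdist (V : finType) (e : rel V) (u v : V) : nat :=
  find (fun d => [exists p : d.-tuple V, path e u p && (last u p == v)]) (iota 0 #|V|).

Definition dist_ext (T : affine_type) (u : option 'I_(rk T).+1) : nat :=
  gdist (ext_adj T) u None.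

(* u = i_-> *)
Definition next_to_root (T : affine_type) (i : 'I_(rk T).+1)
    (u : option 'I_(rk T).+1) : bool :=
  ext_adj T (Some i) u && (dist_ext u < dist_ext (Some i))%N.

(* Q_i *)
Definition descendants (T : affine_type) (i : 'I_(rk T).+1) : {set 'I_(rk T).+1} :=
  [set k | [forall p : (dist_ext (Some k)).-tuple (option 'I_(rk T).+1),
     (path (ext_adj T) (Some k) p && (last (Some k) p == None)) ==>
     (Some i \in Some k :: p)]].

Fixpoint walk_weight (R : comNzRingType) N (a : 'M[R]_N) (i : 'I_N) (p : seq 'I_N) : R :=
  if p is j :: p' then a i j * walk_weight a j p' else 1.

(* d_i0^k *)
Definition walks_to_0 (T : affine_type) (k : nat) (i : 'I_(rk T).+1) : Qq :=
  \sum_(p : k.-tuple 'I_(rk T).+1 | path (affine_adj T) i p && (last i p == ord0))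
    walk_weight (affine_mx Qq T) i p.

Definition branch_identities (k : nat) (C : nat -> Qq) : Prop :=
  forall i, (1 <= i <= k.-1)%N ->
  [/\ C i.-1 - zq * C i + C i.+1 = 0,
      mx2 (C i.-1) (C i) (C i) (C i.+1) =
        mx2 0 1 (-1) zq ^+ i.-1 *m mx2 (C 0) (C 1) (C 1) (C 2),
      C i.-1 / C i =
        \det (mx2 (C 0) (C 1) (C 1) (C 2)) *
        (\sum_(i.+1 <= j < k.+1) (C j.-1 * C j)^-1) + C k.-1 / C k
    & C i / C i.-1 = iter (k - i) (fun t => (zq - t)^-1) (C k / C k.-1)] /\
  (forall (L : fieldType) (iota : {rmorphism rat -> L}) (x y : L),
     transc iota x -> transc iota y -> x != y ->
     Bezq (C i.-1) (C i) iota x y =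
     (1 - (x * y)^-1) * (\sum_(i <= j < k) ev iota x (C j) * ev iota y (C j)) +
     Bezq (C k.-1) (C k) iota x y) /\
  Wr (C i.-1) (C i) =
    (1 - q ^- 2) * (\sum_(i <= j < k) C j ^+ 2) + Wr (C k.-1) (C k).

(* The identities for a family F_i with F_(-1) = [f]. In type A~_n the second
   Bezoutian (Wronskian) is that of F_(j+1), F_j in this order: by telescoping
   (x + x^-1 - y - y^-1) F_k(x) F_k(y) over k = i, ..., j,
   Bez(F_(i-1), F_i) - Bez(F_j, F_(j+1)) is the sum on the right. *)
Definition bezout_wronsky (T : affine_type) (f : Qq) (F : 'I_(rk T).+1 -> Qq) : Prop :=
  [/\ ~~ is_typeA T -> forall i u, next_to_root i u ->
        bez_formula (Bezq (extend f F u) (F i)) F (descendants i) /\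
        wr_formula (Wr (extend f F u) (F i)) F (descendants i),
      bez_formula (Bezq f (F ord0)) F setT /\ wr_formula (Wr f (F ord0)) F setT
    & is_typeA T -> forall i j : nat, (1 <= i)%N -> (i <= j)%N -> (j <= rk T)%N ->
        let Fc k := F (inord (k %% (rk T).+1)) in
        let S := [set k : 'I_(rk T).+1 | (i <= k <= j)%N] in
        bez_formula (addk (Bezq (Fc i.-1) (Fc i)) (Bezq (Fc j.+1) (Fc j))) F S /\
        wr_formula (Wr (Fc i.-1) (Fc i) + Wr (Fc j.+1) (Fc j)) F S].

(* Main.v *)
Require Import Defs.
From HB Require Import structures.
From mathcomp Require Import all_boot all_order all_algebra.
From mathcomp Require Import fingroup perm mxrepresentation character.
From mathcomp Require Import pgroup reals.
From mathcomp Require Import complex.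
From mathcomp Require Import ring zify.

Set Implicit Arguments.
Unset Strict Implicit.
Unset Printing Implicit Defensive.

Import GRing.Theory.
Local Open Scope ring_scope.

(** Everything rests on one linear system. Write [a] for the adjacency matrix of
    the affine diagram and [zq = q + 1/q]. By the Clebsch-Gordan rule
    [V (x) Sym^(m+1) V = Sym^(m+2) V + Sym^m V] and the McKay graph, the
    multiplicities satisfy [sum_j a_ij mult_(m+1),j = mult_(m+2),i + mult_(m),i]
    ([mult_rec]); the rule is read off from characters, which determine the
    multiplicities because the irreducible characters are linearly independent
    ([irr_characters_free]). Summed over [m] it says that the Poincare series solve
    [(zq - a) P = q^-1 e_0]. The matrix [q (zq - a)] is the identity at [q = 0],
    hence invertible over the local ring there ([graph_solve_regular]): the series
    converges to the solution given by Cramer's rule, [P_i = H_i0 / (q H_(-1)0)],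
    and to nothing else. The walk series is the Neumann series for [q P].

    Families solving such a system, with the right-hand side regarded as the value
    at the extra vertex -1, are called harmonic below: at every vertex the value
    times [zq] is the sum of the values at the neighbours. For an alternating form
    [B], summation by parts turns [sum_(k in S) B (zq F_k) F_k] into a sum over the
    edges leaving the set of vertices [S] ([form_green]). The numerator of the
    Bezoutian and the Wronskian are such forms, with [B (zq f) f] a fixed multiple
    of [f(x) f(y)] and of [f^2], and only one edge leaves a subtree of a rooted
    tree; this gives the summation formulas ([harmonic_bezout]), whose determinant
    versions follow by the Cauchy-Binet formula. Along a path of vertices of valence
    two harmonicity is a three-term recursion, the source of the identities for
    branches ([branch_identitiesP]).

    For a forest, conjugation by a diagonal matrix of powers of [q] turns
    [q S + q^-1 S^t] into [zq - a], so Coxeter polynomials are characteristic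
    polynomials at [zq] ([coxeter_potential]); expansion at leaves then evaluates
    them for A, D and E through those of A. The table of the [H_i0] is verified by
    checking that it is harmonic away from the affine vertex, where it has the
    right value ([H_table_cof]). The formula for [P_i^2] is Jacobi's identity for
    second-order minors of the adjugate ([graph_jacobi]). *)

(** * Multiplicities in the symmetric powers *)

Section Characters.

Variables (C : numClosedFieldType) (gT : finGroupType) (B : {group gT}).

Lemma tr_rsim m n (rG : mx_representation C B m) (rH : mx_representation C B n) :
  mx_rsim rG rH -> {in B, forall g, \tr (rG g) = \tr (rH g)}.
Proof.
case/mx_rsim_def=> f [f' fK def_rG] g Bg.
by rewrite def_rG // mxtrace_mulC mulmxA fK mul1mx.
Qed.

Lemma tr_decomposes N (r : 'I_N -> representation C B) d
    (rho : mx_representation C B d) (c : 'I_N -> nat) :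
  decomposes r rho c ->
  {in B, forall g, \tr (rho g) = \sum_i (c i)%:R * \tr (r i g)}.
Proof.
move=> /tr_rsim dec g Bg; rewrite dec //.
have dadd0 : \tr ((grepr0 : representation C B) g) = 0 by rewrite /= mxtrace1.
have daddD : {morph (fun rG : representation C B => \tr (rG g)) :
    rG rH / dadd_grepr rG rH >-> rG + rH} by move=> rG rH; rewrite mxtrace_block.
rewrite (big_morph _ daddD dadd0); apply: eq_bigr => i _.
rewrite /muln_grepr (big_morph _ daddD dadd0) sumr_const card_ord.
by rewrite mulr_natl.
Qed.

(** The coefficient of the character of [r i] is isolated by the central
    idempotent of the group algebra that acts as the identity on [r i] and
    kills every other [r j]. *)
Lemma irr_characters_free N (r : 'I_N -> representation C B) (c : 'I_N -> C) :
  (forall i, mx_irreducible (r i)) ->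
  (forall i j, mx_rsim (r i) (r j) -> i = j) ->
  {in B, forall g, \sum_i c i * \tr (r i g) = 0} -> forall i, c i = 0.
Proof.
move=> irr_r inj_r c0 i.
have sG : irrType C B by apply: DecSocleType.
have F'B : ([pchar C]^'.-group B)%g.
  by apply/pgroupP=> p pr_p _; rewrite inE /= Num.Theory.pchar_num.
pose e := Wedderburn_id (irr_comp sG (r i)).
have Re := Wedderburn_id_mem (irr_comp sG (r i)); rewrite -/e in Re.
have opD j : j != i -> gring_op (r j) e = 0.
  move=> ne_ji; apply: (irr_comp'_op0_pchar F'B (irr_r j)) Re.
  apply: contraNneq ne_ji => eq_ij; apply/eqP/inj_r.
  apply: mx_rsim_trans (rsim_irr_comp_pchar sG F'B (irr_r j)) _.
  by rewrite -eq_ij; apply/mx_rsim_sym/(rsim_irr_comp_pchar sG F'B (irr_r i)).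
have op1 : gring_op (r i) e = 1%:M.
  rewrite -[RHS](gring_op1 (r i)) -(Wedderburn_sum_id_pchar sG F'B) linear_sum.
  rewrite (bigD1 (irr_comp sG (r i))) //= [X in _ + X]big1 ?addr0 // => j ne_j.
  exact: (irr_comp'_op0_pchar F'B (irr_r i) ne_j (Wedderburn_id_mem j)).
have /envelop_mxP[a def_e] : (e \in group_ring C B)%MS.
  by rewrite -(Wedderburn_sum_pchar sG F'B) (sumsmx_sup (irr_comp sG (r i))).
have tr_op j : \tr (gring_op (r j) e) = \sum_(x in B) a x * \tr (r j x).
  rewrite def_e !linear_sum; apply: eq_bigr => x Bx.
  by rewrite !linearZ /= gring_opG.
have: \sum_j c j * \tr (gring_op (r j) e) = 0.
  under eq_bigr => j _ do rewrite tr_op mulr_sumr.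
  rewrite exchange_big big1 //= => x Bx.
  under eq_bigr => j _ do rewrite mulrCA.
  by rewrite -mulr_sumr c0 ?mulr0.
rewrite (bigD1 i) //= op1 mxtrace1 big1 ?addr0 => [/eqP|j ne_j].
  rewrite mulf_eq0 Num.Theory.pnatr_eq0 => /orP[/eqP // | /eqP deg0].
  by case/mx_irrP: (irr_r i) => deg_gt0 _; rewrite deg0 in deg_gt0.
by rewrite opD // mxtrace0 mulr0.
Qed.

End Characters.

Lemma sym_mx_diag (F : fieldType) m (d : 'rV[F]_2) :
  sym_mx m (diag_mx d) = diag_mx (\row_k (d 0 0 ^+ (m - k) * d 0 1 ^+ k)).
Proof.
apply/matrixP => k l; rewrite !mxE /lin_form !mxE /= !mulr1n !mulr0n.
rewrite scale0r addr0 add0r exprZn -rmorphXn /= mul_polyC !coefZ coefXn eq_sym.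
by rewrite mulrA mulr_natr.
Qed.

Lemma tr_sym_mx_conj (F : fieldType) m (P g : 'M[F]_2) : P \in unitmx ->
  \tr (sym_mx m (invmx P *m g *m P)) = \tr (sym_mx m g).
Proof.
move=> uP; rewrite !sym_mxM mxtrace_mulC mulmxA -sym_mxM mulmxV //.
by rewrite sym_mx1 mul1mx.
Qed.

Lemma tr_sym_diag (F : fieldType) m (d : 'rV[F]_2) :
  \tr (sym_mx m (diag_mx d)) = \sum_(k < m.+1) d 0 0 ^+ (m - k) * d 0 1 ^+ k.
Proof. by rewrite sym_mx_diag mxtrace_diag; apply: eq_bigr => k _; rewrite mxE. Qed.

(** The Clebsch-Gordan rule on the level of traces: a unitary [g] is
    diagonalizable, and for its eigenvalues [s], [t] the complete symmetric
    polynomials satisfy [(s + t) h_(m+1) = h_(m+2) + s t h_m], where [s t = 1]. *)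
Lemma tr_sym_mx_rec (C : numClosedFieldType) m (g : 'M[C]_2) :
  g \is unitarymx -> \det g = 1 ->
  \tr g * \tr (sym_mx m.+1 g) = \tr (sym_mx m.+2 g) + \tr (sym_mx m g).
Proof.
move=> ug detg.
have /orthomx_spectralP eg : g \is normalmx.
  have gg := elimT unitarymxP ug.
  by apply/normalmxP; rewrite gg (mulmx1C gg).
move: (spectral_unit g) detg eg; move: (spectralmx g) (spectral_diag g) => P d.
move=> uP detg eg.
have trE k : \tr (sym_mx k g) = \tr (sym_mx k (diag_mx d)).
  by rewrite eg tr_sym_mx_conj.
have {1}-> : \tr g = \tr (diag_mx d).
  by rewrite eg mxtrace_mulC mulmxA mulmxV // mul1mx.
rewrite !trE {trE}.
move: detg; rewrite eg !det_mulmx det_inv mulrAC mulVr -?unitmxE // mul1r det_diag.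
rewrite mxtrace_diag !tr_sym_diag.
have -> : \prod_i d 0 i = d 0 0 * d 0 1.
  by rewrite big_ord_recl big_ord1; congr (_ * d 0 _); apply/val_inj.
have -> : \sum_i d 0 i = d 0 0 + d 0 1.
  by rewrite big_ord_recl big_ord1; congr (_ + d 0 _); apply/val_inj.
move: (d 0 0) (d 0 1) => s t st1.
have hS k : \sum_(i < k.+2) s ^+ (k.+1 - i) * t ^+ i =
    s * (\sum_(i < k.+1) s ^+ (k - i) * t ^+ i) + t ^+ k.+1.
  rewrite big_ord_recr /= subnn mul1r; congr (_ + _); rewrite mulr_sumr.
  by apply: eq_bigr => i _; rewrite subSn ?exprS ?mulrA // -ltnS.
rewrite (hS m.+1) mulrDl -addrA; congr (_ + _).
by rewrite (hS m) mulrDr -exprS mulrCA mulrA st1 mul1r addrC.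
Qed.

Lemma tr_sym_mx0 (F : fieldType) (g : 'M[F]_2) : \tr (sym_mx 0 g) = 1.
Proof. by rewrite /mxtrace big_ord1 !mxE !expr0 mulr1 coef1. Qed.

Lemma tr_sym_mx1 (F : fieldType) (g : 'M[F]_2) : \tr (sym_mx 1 g) = \tr g.
Proof.
rewrite /mxtrace !big_ord_recl !big_ord0 !mxE /= !expr1 !expr0 mul1r mulr1.
rewrite /lin_form !coefD !coefZ !coefC !coefX /= !mulr0 !mulr1 !addr0 add0r.
by have -> : lift ord0 ord0 = 1 :> 'I_2 by apply/val_inj.
Qed.

Section McKayMultiplicities.

Variables (C : numClosedFieldType) (T : affine_type) (gT : finGroupType).
Variables (B : {group gT}) (rho : mx_representation C B 2).
Variables (r : 'I_(rk T).+1 -> representation C B).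
Variable mult : nat -> 'I_(rk T).+1 -> nat.
Hypothesis SU2 : forall g, g \in B -> rho g \is unitarymx /\ \det (rho g) = 1.
Hypothesis McKay : mckay rho r.
Hypothesis mult_dec : forall m, decomposes r (sym_repr rho m) (mult m).

Let tr_mult m g : g \in B ->
  \tr (sym_mx m (rho g)) = \sum_i (mult m i)%:R * \tr (r i g).
Proof. exact: (tr_decomposes (mult_dec m)). Qed.

Lemma char_inj (c d : 'I_(rk T).+1 -> nat) :
  {in B, forall g, \sum_i (c i)%:R * \tr (r i g) = \sum_i (d i)%:R * \tr (r i g)} ->
  c =1 d.
Proof.
case: McKay => irr_r inj_r _ _ _ eq_cd i; apply/eqP.
rewrite -(Num.Theory.eqr_nat C) -subr_eq0; apply/eqP; move: i.
apply: (irr_characters_free irr_r inj_r) => g Bg.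
by under eq_bigr do rewrite mulrBl; rewrite sumrB eq_cd ?subrr.
Qed.

Lemma mult0 i : mult 0 i = (i == ord0).
Proof.
move: i; apply: char_inj => g Bg; rewrite -tr_mult // tr_sym_mx0.
case: McKay => _ _ _ [deg0 triv0] _.
rewrite (bigD1 ord0) //= big1 => [|i /negPf->]; last by rewrite mul0r.
by rewrite triv0 // mxtrace1 deg0 addr0 mulr1.
Qed.

Let tr_adj m g : g \in B -> \tr (rho g) * \tr (sym_mx m (rho g)) =
  \sum_i (\sum_j affine_adj T j i * mult m j)%N%:R * \tr (r i g).
Proof.
move=> Bg; case: McKay => _ _ _ _ dec; rewrite tr_mult // mulr_sumr.
under eq_bigr => j _.
  rewrite mulrCA -mxtrace_prod -[tprod _ _]/(prod_repr rho (r j) g).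
  rewrite (tr_decomposes (dec j)) // mulr_sumr; over.
rewrite exchange_big; apply: eq_bigr => i _ /=.
rewrite natr_sum mulr_suml; apply: eq_bigr => j _.
by rewrite natrM mulrA (mulrC (mult m j)%:R).
Qed.

Lemma mult1 i : (\sum_j affine_adj T j i * mult 0 j)%N = mult 1 i.
Proof.
move: i; apply: char_inj => g Bg.
by rewrite -tr_adj // tr_sym_mx0 mulr1 -tr_mult // tr_sym_mx1.
Qed.

(** The Clebsch-Gordan rule restricted to [B], with the tensor product by [rho]
    decomposed along the McKay graph. *)
Lemma mult_rec m i :
  (\sum_j affine_adj T j i * mult m.+1 j = mult m.+2 i + mult m i)%N.
Proof.
move: i; apply: char_inj => g Bg; have [ug detg] := SU2 Bg.
rewrite -tr_adj // tr_sym_mx_rec // !tr_mult // -big_split /=.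
by apply: eq_bigr => i _; rewrite natrD mulrDl.
Qed.

End McKayMultiplicities.

(** * Rational functions: evaluation, derivation and the q-adic topology *)

Local Notation "p %:F" := (@FracField.tofrac {poly rat} p).

Lemma tofrac_neq0 (p : {poly rat}) : (p%:F != 0) = (p != 0).
Proof. by rewrite tofrac_eq0. Qed.

Lemma fden_neq0 f : fden f != 0.
Proof. exact: denom_ratioP. Qed.

Lemma fracE f : f = (fnum f)%:F / (fden f)%:F.
Proof.
apply: (canRL (mulfK _)); first by rewrite tofrac_neq0 fden_neq0.
rewrite /fnum /fden -{1}[f]generic_quotient.reprK.
move: (generic_quotient.repr f) => x; rewrite !generic_quotient.piE.
apply/eqP; rewrite generic_quotient.piE /= FracField.equivfE /FracField.mulf.
by rewrite !numden_Ratio ?mulf_neq0 ?denom_ratioP ?oner_eq0 // !mulr1 mulrC.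
Qed.

Lemma fracP (f : Qq) : exists n d, d != 0 /\ f = n%:F / d%:F.
Proof. by exists (fnum f), (fden f); rewrite fden_neq0 -fracE. Qed.

Lemma frac_cross (n d n' d' : {poly rat}) : d != 0 -> d' != 0 ->
  n%:F / d%:F = n'%:F / d'%:F -> n * d' = n' * d.
Proof.
move=> nd nd' /eqP; rewrite eqr_div ?tofrac_neq0 // -!tofracM.
by rewrite tofrac_eq => /eqP.
Qed.

Lemma frac_add (n d n' d' : {poly rat}) : d != 0 -> d' != 0 ->
  n%:F / d%:F + n'%:F / d'%:F = (n * d' + n' * d)%:F / (d * d')%:F.
Proof. by move=> nd nd'; rewrite addf_div ?tofrac_neq0 // tofracD !tofracM. Qed.

Lemma frac_mul (n d n' d' : {poly rat}) :
  n%:F / d%:F * (n'%:F / d'%:F) = (n * n')%:F / (d * d')%:F.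
Proof. by rewrite mulf_div !tofracM. Qed.

Lemma q_neq0 : q != 0.
Proof. by rewrite tofrac_neq0 polyX_eq0. Qed.

(** ** Evaluation at a transcendental point *)

Section Evaluation.

Variables (L : fieldType) (iota : {rmorphism rat -> L}) (x : L).
Hypothesis trx : transc iota x.
Let evp (p : {poly rat}) := (map_poly iota p).[x].

Let evp_neq0 p : p != 0 -> evp p != 0.
Proof. by move=> nzp; apply/negP => px0; apply: trx; exists p. Qed.

Let evpM p p' : evp (p * p') = evp p * evp p'.
Proof. by rewrite /evp rmorphM hornerM. Qed.

Let evpD p p' : evp (p + p') = evp p + evp p'.
Proof. by rewrite /evp rmorphD hornerD. Qed.

Lemma ev_frac n d : d != 0 -> ev iota x (n%:F / d%:F) = evp n / evp d.
Proof.
move=> nd; apply/eqP; rewrite /ev -!/(evp _) eqr_div ?evp_neq0 ?fden_neq0 //.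
by rewrite -!evpM (frac_cross nd (fden_neq0 _) (fracE _)).
Qed.

Lemma ev_poly p : ev iota x p%:F = evp p.
Proof.
by rewrite -[p%:F]divr1 -tofrac1 ev_frac ?oner_eq0 // /evp rmorph1 hornerC divr1.
Qed.

Lemma ev_zmod_morphism : zmod_morphism (ev iota x).
Proof.
move=> f g; have [n [d [nd ->]]] := fracP f; have [n' [d' [nd' ->]]] := fracP g.
rewrite -mulNr -tofracN frac_add ?ev_frac ?mulf_neq0 // evpD !evpM.
by rewrite -mulNr addf_div ?evp_neq0 // /evp rmorphN hornerN.
Qed.

Lemma ev_monoid_morphism : monoid_morphism (ev iota x).
Proof.
split; first by rewrite -tofrac1 ev_poly /evp rmorph1 hornerC.
move=> f g; have [n [d [nd ->]]] := fracP f; have [n' [d' [nd' ->]]] := fracP g.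
by rewrite frac_mul !ev_frac ?mulf_neq0 // !evpM mulf_div.
Qed.

Let ev_add := GRing.isZmodMorphism.Build Qq L (ev iota x) ev_zmod_morphism.
Let ev_mul := GRing.isMonoidMorphism.Build Qq L (ev iota x) ev_monoid_morphism.

(** Evaluation is a ring morphism only at transcendental points, hence the
    existential statement instead of a canonical instance. *)
Lemma ev_morph : exists e : {rmorphism Qq -> L}, e =1 ev iota x /\ e q = x.
Proof.
pose e : {rmorphism Qq -> L} := HB.pack (ev iota x) ev_add ev_mul.
by exists e; split=> //=; rewrite ev_poly /evp map_polyX hornerX.
Qed.

Lemma transc_neq0 : x != 0.
Proof.
have nzX : 'X != 0 :> {poly rat} by rewrite polyX_eq0.
by have := evp_neq0 nzX; rewrite /evp map_polyX hornerX.
Qed.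

End Evaluation.

(** ** The derivation d/dq *)

Lemma fderiv_frac n d : d != 0 ->
  fderiv (n%:F / d%:F) = (n^`() * d - n * d^`())%:F / (d ^+ 2)%:F.
Proof.
move=> nd; set f := n%:F / _.
have nD := fden_neq0 f; have := frac_cross nd nD (fracE f).
rewrite /fderiv; move: (fnum f) (fden f) nD => n' d' nd' eq_nd.
have eq_nd' : n^`() * d' + n * d'^`() = n'^`() * d + n' * d^`().
  by rewrite -!derivM eq_nd.
apply/eqP; rewrite eqr_div ?tofrac_neq0 ?expf_neq0 // -!tofracM tofrac_eq.
apply/eqP; apply: (mulfI nd); apply: (mulfI nd').
move: (n^`()) (d^`()) (n'^`()) (d'^`()) eq_nd' => n1 d1 n1' d1' eq_nd'.
have E1 : n' * d = n * d' by [].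
have E2 : n1' * d = n1 * d' + n * d1' - n' * d1 by rewrite eq_nd' addrK.
transitivity (d ^+ 2 * d' * ((n1' * d) * d' - (n' * d) * d1')); first by ring.
rewrite E2 E1.
transitivity (d * d' ^+ 2 * (n1 * d * d' - (n' * d) * d1)); first by ring.
by rewrite E1; ring.
Qed.

Lemma fderivD f g : fderiv (f + g) = fderiv f + fderiv g.
Proof.
have [n [d [nd ->]]] := fracP f; have [n' [d' [nd' ->]]] := fracP g.
rewrite frac_add // !fderiv_frac ?mulf_neq0 // frac_add ?expf_neq0 //.
apply/eqP; rewrite eqr_div ?tofrac_neq0 ?mulf_neq0 ?expf_neq0 //.
rewrite -!tofracM; apply/eqP; congr (_%:F).
rewrite derivD !derivM; move: (n^`()) (d^`()) (n'^`()) (d'^`()) => a b c e; ring.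
Qed.

Lemma fderivM f g : fderiv (f * g) = fderiv f * g + f * fderiv g.
Proof.
have [n [d [nd ->]]] := fracP f; have [n' [d' [nd' ->]]] := fracP g.
rewrite frac_mul !fderiv_frac ?mulf_neq0 // !frac_mul frac_add ?mulf_neq0 ?expf_neq0 //.
apply/eqP; rewrite eqr_div ?tofrac_neq0 ?mulf_neq0 ?expf_neq0 //.
rewrite -!tofracM; apply/eqP; congr (_%:F).
rewrite !derivM; move: (n^`()) (d^`()) (n'^`()) (d'^`()) => a b c e; ring.
Qed.

Lemma fderiv_zq : fderiv zq = 1 - q ^- 2.
Proof.
have dq : fderiv q = 1.
  rewrite -[q]divr1 -tofrac1 fderiv_frac ?oner_eq0 // derivX derivC.
  by rewrite mulr1 mulr0 subr0 expr1n divrr // unitfE oner_eq0.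
have d1 : fderiv 1 = 0.
  by apply: (addIr (fderiv 1)); rewrite -{3}[1]mulr1 fderivM mulr1 mul1r add0r.
rewrite /zq fderivD dq; congr (_ + _); apply: (mulfI q_neq0).
have := fderivM q q^-1; rewrite divff ?q_neq0 // d1 dq mul1r => /esym/eqP.
rewrite addrC addr_eq0 => /eqP ->; rewrite mulrN; congr (- _).
by rewrite -exprVn expr2 mulrA divff ?q_neq0 // mul1r.
Qed.

(** ** The local ring at q = 0 *)

Lemma regular_poly (p : {poly rat}) : regular_at_0 p%:F.
Proof. by exists p, 1; rewrite hornerC oner_eq0 tofrac1 divr1. Qed.

Lemma regular0 : regular_at_0 0.
Proof. by rewrite -tofrac0; apply: regular_poly. Qed.

Lemma regularq : regular_at_0 q.
Proof. exact: regular_poly. Qed.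

Lemma regularn n : regular_at_0 n%:R.
Proof. by rewrite -tofrac1 -tofracMn; apply: regular_poly. Qed.

Lemma horner0_neq0 (d : {poly rat}) : d.[0] != 0 -> d != 0.
Proof. by apply: contraNneq => ->; rewrite horner0. Qed.

Lemma regularM f g : regular_at_0 f -> regular_at_0 g -> regular_at_0 (f * g).
Proof.
move=> [n [d [nd ->]]] [n' [d' [nd' ->]]]; exists (n * n'), (d * d').
by rewrite hornerM mulf_neq0 // frac_mul.
Qed.

Lemma regularD f g : regular_at_0 f -> regular_at_0 g -> regular_at_0 (f + g).
Proof.
move=> [n [d [nd ->]]] [n' [d' [nd' ->]]]; exists (n * d' + n' * d), (d * d').
by rewrite hornerM mulf_neq0 // frac_add ?horner0_neq0.
Qed.

Lemma regularN f : regular_at_0 f -> regular_at_0 (- f).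
Proof. by move=> [n [d [nd ->]]]; exists (- n), d; rewrite tofracN mulNr. Qed.

Lemma regularB f g : regular_at_0 f -> regular_at_0 g -> regular_at_0 (f - g).
Proof. by move=> rf rg; apply/regularD/regularN. Qed.

Lemma regularX f n : regular_at_0 f -> regular_at_0 (f ^+ n).
Proof.
move=> rf; elim: n => [|n IHn]; first exact: (regularn 1).
by rewrite exprS; apply: regularM.
Qed.

Lemma regular_sum (I : Type) (s : seq I) (P : pred I) (f : I -> Qq) :
  (forall i, regular_at_0 (f i)) -> regular_at_0 (\sum_(i <- s | P i) f i).
Proof.
by move=> rf; elim/big_rec: _ => [|i x _ rx]; [apply: regular0 | apply: regularD].
Qed.

Lemma regularV (p : {poly rat}) : p.[0] != 0 -> regular_at_0 (p%:F)^-1.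
Proof. by exists 1, p; rewrite tofrac1 mul1r. Qed.

(** [X^N] is coprime to a denominator that does not vanish at 0, so it would divide
    the numerator for every [N]. *)
Lemma qadic_separated (f : Qq) :
  (forall N, exists2 g, regular_at_0 g & f = q ^+ N * g) -> f = 0.
Proof.
have [n [d [nd ->]]] := fracP f => divf.
have [-> | nzn] := eqVneq n 0; first by rewrite tofrac0 mul0r.
have [_ [n' [d' [nd' ->]]]] := divf (size n).
rewrite mulrA -tofracXn -tofracM => /(frac_cross nd (horner0_neq0 nd')) eq_nd.
have : 'X^(size n) %| n * d' by rewrite eq_nd -mulrA dvdp_mulr.
rewrite Gauss_dvdpl => [/(dvdp_leq nzn)|]; first by rewrite size_polyXn ltnn.
by rewrite coprimep_sym coprimep_expr // -['X]subr0 -polyC0 coprimep_XsubC.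
Qed.

Lemma qadic_unique u f g : qadic_sum u f -> qadic_sum u g -> f = g.
Proof.
move=> uf ug; apply/eqP; rewrite -subr_eq0; apply/eqP/qadic_separated => N.
have [M1 fM] := uf N; have [M2 gM] := ug N.
have [f1 rf1 e1] := fM _ (leq_maxl M1 M2).
have [g1 rg1 e2] := gM _ (leq_maxr M1 M2).
exists (f1 - g1); first exact: regularB.
by rewrite mulrBr -e1 -e2 opprB addrA subrK.
Qed.
(** * The Cauchy-Binet formula *)

Lemma card_ord_below m (a : 'I_m) : #|[set k : 'I_m | (k < a)%N]| = a.
Proof.
have le_am := ltnW (ltn_ord a).
have -> : [set k : 'I_m | (k < a)%N] = [set widen_ord le_am k | k in 'I_a].
  apply/setP=> k; rewrite inE; apply/idP/imsetP=> [lt_ka | [j _ ->]] //=.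
  by exists (Ordinal lt_ka) => //; apply: val_inj.
rewrite card_imset ?card_ord // => i j /(congr1 val) /= eq_ij; exact: val_inj.
Qed.

Lemma increasingP m N (f : {ffun 'I_m -> 'I_N}) :
  reflect (forall s t : 'I_m, (s < t)%N -> (f s < f t)%N) (increasing f).
Proof.
apply: (iffP forallP) => [inc s t lt_st | inc s].
  by have /forallP/(_ t)/implyP := inc s; apply.
by apply/forallP=> t; apply/implyP; apply: inc.
Qed.

Lemma increasing_ltn m N (f : {ffun 'I_m -> 'I_N}) : increasing f ->
  forall s t, (f s < f t)%N = (s < t)%N.
Proof.
move=> /increasingP inc s t; case: (ltngtP s t) => [/inc // | lt_ts | eq_st].
  by apply/negbTE; rewrite -leqNgt ltnW // inc.
by rewrite (val_inj eq_st) ltnn.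
Qed.

(** The sorting permutation sends [i] to the number of [j] with [f j < f i]. *)
Lemma sorting_perm m N (f : {ffun 'I_m -> 'I_N}) : injective f ->
  exists s0 : 'S_m, forall s : 'S_m,
    increasing [ffun i => f ((s^-1)%g i)] = (s == s0).
Proof.
move=> inj_f; pose below i := [set j : 'I_m | (f j < f i)%N].
have lt_m i : (#|below i| < m)%N.
  rewrite -[X in (_ < X)%N]card_ord -cardsT proper_card // properEneq subsetT andbT.
  by apply/eqP=> /setP/(_ i); rewrite !inE ltnn.
pose rank i := Ordinal (lt_m i).
have rank_lt i j : (f i < f j)%N -> (rank i < rank j)%N.
  move=> lt_ij; apply/proper_card/properP; split.
    by apply/subsetP=> k; rewrite !inE => /ltn_trans; apply.
  by exists i; rewrite inE ?ltnn.
have inj_rank : injective rank.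
  move=> i j eq_ij; apply/inj_f/val_inj; move: (rank_lt i j) (rank_lt j i).
  by rewrite eq_ij ltnn; case: ltngtP => // _; [move=> /(_ isT) | move=> _ /(_ isT)].
exists (perm inj_rank) => s; apply/idP/eqP=> [inc | ->].
  apply/permP=> i; rewrite permE; apply: val_inj => /=.
  rewrite -[LHS]card_ord_below -(card_imset (below i) (@perm_inj _ s)).
  apply: eq_card => k; rewrite inE; apply/idP/imsetP=> [lt_k | [j]].
    exists ((s^-1)%g k); rewrite ?permKV // inE.
    by have := increasing_ltn inc k (s i); rewrite !ffunE permK lt_k.
  by rewrite inE => lt_j ->; rewrite -(increasing_ltn inc) !ffunE !permK.
apply/increasingP=> u v lt_uv; rewrite !ffunE.
pose s1 := perm inj_rank; rewrite -/s1.
rewrite -(permKV s1 u) -(permKV s1 v) !(permE inj_rank) in lt_uv.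
move: lt_uv; case: (ltngtP (f ((s1^-1)%g u)) (f ((s1^-1)%g v))) => //.
  by move=> /rank_lt /ltnW; rewrite leqNgt => /negPf->.
by move=> /val_inj/inj_f->; rewrite ltnn.
Qed.

Lemma det_mulmx_sum (R : comNzRingType) m N (A : 'M[R]_(m, N)) (B : 'M[R]_(N, m)) :
  \det (A *m B) =
  \sum_(f : {ffun 'I_m -> 'I_N})
     (\prod_i A i (f i)) * \det (\matrix_(i, j) B (f i) j).
Proof.
rewrite /determinant.
under eq_bigr => s _.
  under eq_bigr => i _ do rewrite mxE.
  rewrite bigA_distr_bigA /= mulr_sumr; over.
rewrite exchange_big; apply: eq_bigr => f _ /=; rewrite mulr_sumr.
apply: eq_bigr => s _; rewrite big_split /= mulrCA; congr (_ * (_ * _)).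
by apply: eq_bigr => i _; rewrite mxE.
Qed.

(** In the expansion over all maps [f] only the injective ones contribute, and each
    of these is in exactly one way an increasing map after a permutation; the sum
    over the permutations rebuilds the first minor. *)
Theorem cauchy_binet (R : comNzRingType) m N (A : 'M[R]_(m, N)) (B : 'M[R]_(N, m)) :
  \det (A *m B) =
  \sum_(f : {ffun 'I_m -> 'I_N} | increasing f)
     \det (\matrix_(i, t) A i (f t)) * \det (\matrix_(t, j) B (f t) j).
Proof.
pose F (f : {ffun 'I_m -> 'I_N}) :=
  (\prod_i A i (f i)) * \det (\matrix_(i, j) B (f i) j).
pose sort_by (s : 'S_m) (f : {ffun 'I_m -> 'I_N}) := [ffun i => f ((s^-1)%g i)].
have F_sum f : F f = \sum_(s : 'S_m | increasing (sort_by s f)) F f.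
  case: (boolP (injectiveb f)) => [/injectiveP/sorting_perm[s0 s0P] | not_inj].
    by rewrite (big_pred1 s0) => // s; apply: s0P.
  have /injectivePn[i [j ne_ij eq_f]] := not_inj.
  suff -> : F f = 0 by rewrite big1.
  rewrite /F (determinant_alternate ne_ij) ?mulr0 // => k.
  by rewrite !mxE eq_f.
rewrite det_mulmx_sum -/(F _); under eq_bigr => f _ do rewrite -/(F f) F_sum.
rewrite (exchange_big_dep xpredT) //=.
have reindex_sort (s : 'S_m) : \sum_(f | increasing (sort_by s f)) F f =
    \sum_(g : {ffun 'I_m -> 'I_N} | increasing g) F [ffun i => g (s i)].
  rewrite (reindex (fun g : {ffun 'I_m -> 'I_N} => [ffun i => g (s i)])) /=.
    apply: eq_bigl => g; congr increasing; apply/ffunP => i.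
    by rewrite !ffunE permKV.
  by exists (sort_by s) => g _; apply/ffunP => i; rewrite !ffunE ?permK ?permKV.
under eq_bigr => s _ do rewrite reindex_sort.
rewrite exchange_big; apply: eq_bigr => g _ /=; rewrite mulr_suml.
apply: eq_bigr => s _; rewrite /F.
have -> : \matrix_(i, j) B ([ffun i => g (s i)] i) j =
    perm_mx s *m \matrix_(i, j) B (g i) j.
  by rewrite -row_permE; apply/matrixP=> i j; rewrite !mxE ffunE.
rewrite det_mulmx det_perm mulrA -mulrA mulrCA mulrA; congr (_ * _ * _).
by apply: eq_bigr => i _; rewrite mxE ffunE.
Qed.
(** * Characteristic polynomials of weighted graphs *)

Lemma graph_mxE (R : comNzRingType) N (a : 'M[R]_N) z : weighted_graph a ->
  graph_mx a z = z%:M - a.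
Proof.
move=> [sym_a a0]; apply/matrixP=> i j; rewrite !mxE (eq_sym j).
have [->|ne_ij] := eqVneq i j; first by rewrite a0 !mulr1n subrK subr0.
rewrite !mulr0n !add0r; case: ltngtP => [||/val_inj eq_ij]; rewrite ?addr0 ?add0r //.
  by rewrite -{1}sym_a mxE.
by rewrite eq_ij eqxx in ne_ij.
Qed.

Lemma weighted_graph_sym (R : comNzRingType) N (a : 'M[R]_N) :
  weighted_graph a -> forall i j, a i j = a j i.
Proof. by case=> sym_a _ i j; rewrite -{1}sym_a mxE. Qed.

Lemma weighted_graph_del (R : comNzRingType) N (a : 'M[R]_N) i :
  weighted_graph a -> weighted_graph (del_vertex i a).
Proof.
move=> wg; split; last by move=> j; rewrite !mxE; case: wg.
by apply/matrixP=> j k; rewrite !mxE (weighted_graph_sym wg).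
Qed.

Lemma graph_mx_del (R : comNzRingType) N (a : 'M[R]_N) i z : weighted_graph a ->
  row' i (col' i (graph_mx a z)) = graph_mx (del_vertex i a) z.
Proof.
move=> wg; rewrite !graph_mxE //; last exact: weighted_graph_del.
by apply/matrixP=> j k; rewrite !mxE (inj_eq lift_inj).
Qed.

Lemma graph_cof_diag (R : comNzRingType) N (a : 'M[R]_N) i z : weighted_graph a ->
  graph_cof a i i z = graph_poly (del_vertex i a) z.
Proof.
move=> wg; rewrite /graph_cof /cofactor addnn -signr_odd odd_double expr0 mul1r.
by rewrite graph_mx_del.
Qed.

Lemma graph_mx_tr (R : comNzRingType) N (a : 'M[R]_N) z : weighted_graph a ->
  (graph_mx a z)^T = graph_mx a z.
Proof. by move=> wg; rewrite graph_mxE // linearB /= tr_scalar_mx (proj1 wg). Qed.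

Lemma graph_cofC (R : comNzRingType) N (a : 'M[R]_N) i j z : weighted_graph a ->
  graph_cof a i j z = graph_cof a j i z.
Proof. by move=> wg; rewrite /graph_cof -{1}(graph_mx_tr z wg) cofactor_tr. Qed.

Lemma graph_cof_adj (R : comNzRingType) N (a : 'M[R]_N) i j z : weighted_graph a ->
  graph_cof a i j z = (\adj (graph_mx a z)) i j.
Proof. by move=> wg; rewrite graph_cofC // mxE. Qed.

(** The rows of [(z - a) adj (z - a) = det (z - a)]. *)
Lemma graph_cof_row (R : comNzRingType) N (a : 'M[R]_N) i j z : weighted_graph a ->
  z * graph_cof a i j z - \sum_k a i k * graph_cof a k j z =
  (i == j)%:R * graph_poly a z.
Proof.
move=> wg; have /matrixP/(_ i j) := mul_mx_adj (graph_mx a z).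
rewrite [in RHS]mxE mulr_natl => <-; rewrite {1}graph_mxE // mulmxBl mul_scalar_mx.
rewrite !mxE -graph_cofC //; congr (_ - _); apply: eq_bigr => k _.
by rewrite (graph_cof_adj k).
Qed.

Lemma graph_poly_row (R : comNzRingType) N (a : 'M[R]_N) i z : weighted_graph a ->
  graph_poly a z =
  z * graph_poly (del_vertex i a) z - \sum_k a i k * graph_cof a k i z.
Proof. by move=> wg; rewrite -graph_cof_diag // graph_cof_row // eqxx mul1r. Qed.

(** For such a [v] the product [(z - a) v] is a multiple of a basis vector; apply the
    adjugate matrix to it. *)
Lemma graph_cof_unique (F : fieldType) N (a : 'M[F]_N) i z (v : 'I_N -> F) :
  weighted_graph a -> graph_poly a z != 0 ->
  (forall j, j != i -> z * v j - \sum_k a j k * v k = 0) ->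
  forall j, v j * graph_poly a z =
            graph_cof a j i z * (z * v i - \sum_k a i k * v k).
Proof.
move=> wg nz_det v0 j; pose V := \col_k v k.
have MV : graph_mx a z *m V = (z * v i - \sum_k a i k * v k) *: delta_mx i 0.
  rewrite graph_mxE // mulmxBl mul_scalar_mx; apply/colP=> k; rewrite !mxE eqxx andbT.
  have -> : \sum_j a k j * V j 0 = \sum_j a k j * v j.
    by apply: eq_bigr => l _; rewrite mxE.
  have [-> | ne_ki] := eqVneq k i; first by rewrite mulr1.
  by rewrite mulr0 v0.
have /matrixP/(_ j 0) := congr1 (mulmx (\adj (graph_mx a z))) MV.
rewrite mulmxA mul_adj_mx mul_scalar_mx -scalemxAr -colE !mxE => eq_j.
by rewrite mulrC eq_j mulrC graph_cof_adj // mxE.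
Qed.

(** Jacobi's identity for the minors of order two of the adjugate matrix. The
    combination [H_ii H_j - H_ij H_i] of two columns of cofactors vanishes at [i],
    so its restriction to the other vertices is a column of cofactors of the
    graph without [i]. *)
Lemma graph_jacobi (F : fieldType) N (a : 'M[F]_N) (i : 'I_N) (j : 'I_N.-1) z :
  weighted_graph a -> graph_poly a z != 0 -> graph_poly (del_vertex i a) z != 0 ->
  graph_poly (del_vertex i a) z * graph_poly (del_vertex (lift i j) a) z
    - graph_cof a (lift i j) i z ^+ 2 =
  graph_poly a z * graph_poly (del_vertex j (del_vertex i a)) z.
Proof.
move=> wg nz_det nz_del; set b := del_vertex i a; set D := graph_poly b z.
have wgb : weighted_graph b by apply: weighted_graph_del.
pose H k l := graph_cof a k l z.
pose v (k : 'I_N.-1) := H i i * H (lift i k) (lift i j) - H i (lift i j) * H (lift i k) i.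
have vE k : z * v k - \sum_l b k l * v l = (k == j)%:R * (H i i * graph_poly a z).
  pose w l := H i i * H l (lift i j) - H i (lift i j) * H l i.
  have w0 : w i = 0 by rewrite /w mulrC subrr.
  have sumE : \sum_l b k l * v l = \sum_l a (lift i k) l * w l.
    rewrite [RHS](bigD1_ord i) //= w0 mulr0 add0r.
    by apply: eq_bigr => l _; rewrite !mxE.
  have -> : z * v k - \sum_l b k l * v l =
     H i i * (z * H (lift i k) (lift i j) - \sum_l a (lift i k) l * H l (lift i j))
     - H i (lift i j) * (z * H (lift i k) i - \sum_l a (lift i k) l * H l i).
    rewrite sumE !mulrBr !mulr_sumr.
    rewrite (_ : \sum_l _ = \sum_l H i i * (a (lift i k) l * H l (lift i j)) -
        \sum_l H i (lift i j) * (a (lift i k) l * H l i)); last first.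
      by rewrite -sumrB; apply: eq_bigr => l _; rewrite /w; ring.
    by rewrite /v; ring.
  rewrite !graph_cof_row // (inj_eq lift_inj) [_ == i]eq_sym (negPf (neq_lift _ _)).
  by rewrite mul0r mulr0 subr0 mulrCA.
have v0 k : k != j -> z * v k - \sum_l b k l * v l = 0.
  by move=> /negPf ne_kj; rewrite vE ne_kj mul0r.
have := graph_cof_unique wgb nz_del v0 j.
have HD : H i i = D by apply: graph_cof_diag.
rewrite vE eqxx mul1r graph_cof_diag // HD -/D mulrCA => eq_v.
have {eq_v}: v j = graph_poly (del_vertex j b) z * graph_poly a z.
  by apply: (mulIf nz_del); rewrite eq_v mulrC.
rewrite /v HD mulrC [X in _ = X]mulrC => <-.
by rewrite -graph_cof_diag // [H i _]graph_cofC // expr2 mulrC.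
Qed.

(** ** Matrix factorization of the Bezoutian *)

(** With [M(x) = x - a], the product [adj M(x) (M(x) - M(y)) adj M(y)] is both
    [(x - y) adj M(x) adj M(y)] and [det M(x) adj M(y) - det M(y) adj M(x)]. *)
Lemma graph_bezout (F : fieldType) N (a : 'M[F]_N) i j (x y : F) :
  weighted_graph a -> x != y ->
  Bez (graph_poly a) (graph_cof a i j) x y =
  \sum_k graph_cof a i k x * graph_cof a j k y.
Proof.
move=> wg ne_xy; rewrite /Bez; apply: (canLR (mulfK _)); first by rewrite subr_eq0.
have eqM : graph_mx a x - graph_mx a y = (x - y)%:M.
  by rewrite !graph_mxE // opprB addrA subrK -raddfB.
have := congr1 (fun M => \adj (graph_mx a x) *m M *m \adj (graph_mx a y)) eqM.
rewrite mulmxBr mulmxBl mul_adj_mx -mulmxA mul_mx_adj mul_scalar_mx mul_mx_scalar.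
rewrite mul_mx_scalar -scalemxAl => /matrixP/(_ i j).
rewrite !mxE => eqij; rewrite [RHS]mulrC !(graph_cofC i j _ wg).
transitivity (\det (graph_mx a x) * cofactor (graph_mx a y) j i -
              \det (graph_mx a y) * cofactor (graph_mx a x) j i) => //.
rewrite eqij; congr (_ * _); apply: eq_bigr => k _.
by rewrite (graph_cof_adj i) // (graph_cofC j) // graph_cof_adj.
Qed.

Theorem matrix_bezout : matrix_bezout_identities.
Proof.
move=> F N a i j wg.
have bezE m r (x : 'I_m -> F) (y : 'I_r -> F) : (forall l s, x l != y s) ->
     \matrix_(l, s) Bez (graph_poly a) (graph_cof a i j) (x l) (y s) =
     (\matrix_(l < m, k < N) graph_cof a i k (x l)) *m
     (\matrix_(s < r, k < N) graph_cof a j k (y s))^T.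
  move=> ne_xy; apply/matrixP=> l s; rewrite !mxE graph_bezout //.
  by apply: eq_bigr => k _; rewrite !mxE.
split=> // m x y _ ne_xy; rewrite bezE // cauchy_binet; apply: eq_bigr => f _.
congr (\det _ * _); first by apply/matrixP=> l t; rewrite !mxE.
by rewrite -det_tr; congr (\det _); apply/matrixP=> l t; rewrite !mxE.
Qed.
(** * Coxeter polynomials *)

(** If [h] increases by one along every edge, read from its smaller to its larger
    end, conjugation by the diagonal matrix of the [q ^ h i] carries
    [q S + q^-1 S^t] to [(q + q^-1) - a]. Such an [h] exists for every numbering
    of a forest. *)
Lemma coxeter_potential (F : fieldType) N (a : 'M[F]_N) (x : F) (h : 'I_N -> nat) :
  x != 0 -> weighted_graph a ->
  (forall i j : 'I_N, (i < j)%N -> a i j != 0 -> h j = (h i).+1) ->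
  coxeter a x = graph_poly a (x + x^-1).
Proof.
move=> nzx wg hS; pose D := diag_mx (\row_i x ^+ h i).
have nzD : \det D != 0.
  by rewrite det_diag; apply/prodf_neq0 => i _; rewrite mxE expf_neq0.
apply: (mulfI nzD); rewrite [RHS]mulrC -!det_mulmx; congr (\det _).
rewrite mul_diag_mx mul_mx_diag graph_mxE //; apply/matrixP=> i j.
rewrite !mxE (eq_sym j).
have [-> | ne_ij] := eqVneq i j.
  by rewrite (proj2 wg) mulr1n !mulr1 subr0 mulrC.
rewrite mulr0n sub0r; case: (ltngtP i j) => [lt_ij | lt_ji | /val_inj eq_ij].
- have [-> | nza] := eqVneq (a i j) 0; first by rewrite oppr0 !mulr0 addr0 mulr0 mul0r.
  by rewrite (hS _ _ lt_ij nza) exprS mulr0 addr0; ring.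
- rewrite -(weighted_graph_sym wg i j).
  have [-> | nza] := eqVneq (a i j) 0; first by rewrite oppr0 !mulr0 addr0 mulr0 mul0r.
  rewrite (hS _ _ lt_ji) ?(weighted_graph_sym wg j) // exprS mulr0 add0r.
  by move: (x ^+ h j) (a i j) => y c; field.
- by rewrite eq_ij eqxx in ne_ij.
Qed.

Lemma graph_poly_renumber (R : comNzRingType) N (a : 'M[R]_N) (s : 'S_N) z :
  weighted_graph a -> graph_poly (renumber a s) z = graph_poly a z.
Proof.
move=> wg; have wgr : weighted_graph (renumber a s).
  split; last by move=> i; rewrite mxE (proj2 wg).
  by apply/matrixP=> i j; rewrite !mxE (weighted_graph_sym wg).
rewrite /graph_poly !graph_mxE //.
have -> : z%:M - renumber a s = row_perm s (col_perm s (z%:M - a)).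
  by apply/matrixP=> i j; rewrite !mxE (inj_eq perm_inj).
rewrite row_permE col_permE !det_mulmx !det_perm mulrCA -signr_addb.
by rewrite odd_permV addbb mulr1.
Qed.

(** ** Nonvanishing at z = q + 1/q *)

Section NaturalWeights.

Variables (N : nat) (a : 'M[Qq]_N) (b : 'I_N -> 'I_N -> nat).
Hypotheses (wg : weighted_graph a) (ab : forall i j, a i j = (b i j)%:R).

(** [q (zq - a)] has polynomial entries and is the identity matrix at [q = 0]. *)
Let M : 'M[{poly rat}]_N := \matrix_(i, j) (('X^2 + 1) *+ (i == j) - 'X *+ b i j).

Let M_mx : map_mx (@FracField.tofrac {poly rat}) M = q *: graph_mx a zq.
Proof.
rewrite graph_mxE //; apply/matrixP=> i j; rewrite !mxE ab.
rewrite tofracB !tofracMn mulrBr mulr_natr; congr (_ - _); rewrite mulrnAr.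
by congr (_ *+ _); rewrite mulrDr divff ?q_neq0 // tofracD tofracXn tofrac1 expr2.
Qed.

Let detM0 : (\det M).[0] = 1.
Proof.
rewrite -[LHS]/(horner_eval 0 _) -det_map_mx; apply: etrans (det1 _ N).
congr (\det _); apply/matrixP=> i j; rewrite !mxE /= /horner_eval.
rewrite hornerD hornerN !hornerMn hornerD hornerXn hornerX hornerC /=.
by rewrite mul0rn oppr0 addr0 expr0n add0r.
Qed.

Let detM : (\det M)%:F = q ^+ N * graph_poly a zq.
Proof. by rewrite -det_map_mx M_mx detZ. Qed.

Let detM_neq0 : (\det M)%:F != 0.
Proof.
rewrite tofrac_neq0; apply/eqP=> d0; have := detM0.
by rewrite d0 horner0 => /eqP; rewrite eq_sym oner_eq0.
Qed.

Lemma graph_poly_zq_neq0 : graph_poly a zq != 0.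
Proof. by have := detM_neq0; rewrite detM; apply: contraNneq => ->; rewrite mulr0. Qed.

(** [q (zq - a)] is invertible over the local ring at [q = 0], so a solution of a
    linear system is divisible by the power of [q] that divides its right side. *)
Lemma graph_solve_regular n (X : 'I_N -> Qq) :
  (forall i, exists2 g, regular_at_0 g &
     zq * X i - \sum_j a i j * X j = q ^+ n * g) ->
  forall i, exists2 g, regular_at_0 g & X i = q ^+ n * g.
Proof.
move=> resX i; pose A := map_mx (@FracField.tofrac {poly rat}) (\adj M).
have rA k : regular_at_0 (A i k) by rewrite mxE; apply: regular_poly.
have := resX; move/(@fin_all_exists2 _ _ _) => [G rG GE].
exists ((\det M)%:F^-1 * \sum_k A i k * (q * G k)).
  apply: regularM; first by apply: regularV; rewrite detM0 oner_eq0.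
  by apply: regular_sum => k; apply/regularM/regularM; [| apply: regularq |].
apply: (mulfI detM_neq0); rewrite mulrCA (mulVKf detM_neq0).
have /matrixP/(_ i 0) : A *m (q *: graph_mx a zq) *m (\col_k X k) =
    (\det M)%:F%:M *m (\col_k X k).
  by rewrite -M_mx -map_mxM mul_adj_mx map_scalar_mx.
rewrite mul_scalar_mx [RHS]mxE [X in _ = _ * X]mxE => <-.
rewrite -mulmxA mxE mulr_sumr; apply: eq_bigr => k _; rewrite mulrCA; congr (_ * _).
rewrite -scalemxAl mxE mulrCA -GE graph_mxE // mulmxBl mul_scalar_mx; congr (_ * _).
by rewrite !mxE; congr (_ - _); apply: eq_bigr => l _; rewrite mxE.
Qed.

End NaturalWeights.

(** ** Graphs given by a relation on the natural numbers *)

Definition rel_graph (R : comNzRingType) N (e : rel nat) : 'M[R]_N :=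
  \matrix_(i, j) (e i j)%:R.

Definition rel_poly N (e : rel nat) : Qq := graph_poly (rel_graph Qq N e) zq.

Lemma rel_graph_weighted (R : comNzRingType) N e :
  symmetric e -> irreflexive e -> weighted_graph (rel_graph R N e).
Proof.
move=> sym_e irr_e; split; first by apply/matrixP=> i j; rewrite !mxE sym_e.
by move=> i; rewrite mxE irr_e.
Qed.

Lemma rel_graph_del (R : comNzRingType) N (e : rel nat) (i : 'I_N) :
  del_vertex i (rel_graph R N e) =
  rel_graph R N.-1 (fun x y => e (bump i x) (bump i y)).
Proof. by apply/matrixP=> j k; rewrite !mxE. Qed.

Lemma eq_rel_graph (R : comNzRingType) N (e e' : rel nat) :
  (forall x y, (x < N)%N -> (y < N)%N -> e x y = e' x y) ->
  rel_graph R N e = rel_graph R N e'.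
Proof. by move=> eq_e; apply/matrixP=> i j; rewrite !mxE eq_e. Qed.

Lemma rel_poly_neq0 N e : symmetric e -> irreflexive e -> rel_poly N e != 0.
Proof.
move=> sym_e irr_e; apply: (graph_poly_zq_neq0 (b := fun i j => e i j)).
  exact: rel_graph_weighted.
by move=> i j; rewrite mxE.
Qed.

Lemma rel_poly_isolated N (e e' : rel nat) (l : 'I_N.+1) :
  symmetric e -> irreflexive e ->
  (forall x, (x < N)%N -> e l (bump l x) = false) ->
  (forall x y, (x < N)%N -> (y < N)%N -> e (bump l x) (bump l y) = e' x y) ->
  rel_poly N.+1 e = zq * rel_poly N e'.
Proof.
move=> sym_e irr_e iso ee'.
have wg := rel_graph_weighted Qq N.+1 sym_e irr_e.
rewrite /rel_poly (graph_poly_row l) //.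
rewrite rel_graph_del (eq_rel_graph _ ee') big1 ?subr0 // => k _; rewrite mxE.
have [j -> | ->] := unliftP l k; last by rewrite irr_e mul0r.
by rewrite iso // mul0r.
Qed.

(** In the expansion along the row of the leaf [l] a single off-diagonal cofactor
    occurs; as an entry of a column annihilated by the other rows, it is a
    principal minor of the graph without [l]. *)
Lemma rel_poly_pendant N (e e1 e2 : rel nat) (l : 'I_N.+2) (p : 'I_N.+1) :
  symmetric e -> irreflexive e ->
  (forall x, (x < N.+1)%N -> e l (bump l x) = (x == p)) ->
  (forall x y, (x < N.+1)%N -> (y < N.+1)%N -> e (bump l x) (bump l y) = e1 x y) ->
  (forall x y, (x < N)%N -> (y < N)%N -> e1 (bump p x) (bump p y) = e2 x y) ->
  rel_poly N.+2 e = zq * rel_poly N.+1 e1 - rel_poly N e2.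
Proof.
move=> sym_e irr_e pend ee1 ee2; set a := rel_graph Qq N.+2 e.
have wg : weighted_graph a by apply: rel_graph_weighted.
have b_e1 : del_vertex l a = rel_graph Qq N.+1 e1 by rewrite rel_graph_del (eq_rel_graph _ ee1).
set b := del_vertex l a in b_e1.
have wgb : weighted_graph b by apply: weighted_graph_del.
have nz_b : graph_poly b zq != 0.
  apply: (graph_poly_zq_neq0 (b := fun i j => e (lift l i) (lift l j))) => //.
  by move=> i j; rewrite !mxE.
have := graph_cof_unique (v := fun k => graph_cof a (lift l k) l zq) wgb nz_b (i := p).
have resE k : zq * graph_cof a (lift l k) l zq
     - \sum_j b k j * graph_cof a (lift l j) l zq = (k == p)%:R * graph_poly b zq.
  have := graph_cof_row (lift l k) l zq wg.
  rewrite [_ == l]eq_sym (negPf (neq_lift _ _)) mul0r (bigD1_ord l) //=.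
  rewrite (graph_cof_diag l zq wg) -/b [a _ l]mxE sym_e pend // => /eqP.
  rewrite opprD addrCA addrC subr_eq0 => /eqP.
  by rewrite -[(k == p)]val_eqE => <-; congr (_ - _); apply: eq_bigr => j _; rewrite !mxE.
move=> /(_ _ p); rewrite resE eqxx mul1r (graph_cof_diag p zq wgb) => vE.
have {vE} vp : graph_cof a (lift l p) l zq = rel_poly N e2.
  rewrite /rel_poly; have <- : del_vertex p b = rel_graph Qq N e2.
    by rewrite b_e1 rel_graph_del; apply: eq_rel_graph.
  by apply: (mulIf nz_b); apply: vE => k /negPf ne_kp; rewrite resE ne_kp mul0r.
rewrite {1}/rel_poly (graph_poly_row l) // -/a -/b b_e1; congr (_ - _).
rewrite (bigD1_ord l) //= (proj2 wg) mul0r add0r (bigD1 p) //= vp.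
rewrite !mxE pend // eqxx mul1r big1 ?addr0 // => k ne_kp.
by rewrite !mxE pend // val_eqE (negPf ne_kp) mul0r.
Qed.

(** ** The Dynkin diagrams A, D and E *)

Definition path_rel : rel nat := fun x y => (y == x.+1) || (x == y.+1).

Definition path_poly k : Qq := rel_poly k path_rel.

Lemma path_relC : symmetric path_rel. Proof. by move=> x y; rewrite /path_rel; lia. Qed.
Lemma path_rel_irr : irreflexive path_rel. Proof. by move=> x; rewrite /path_rel; lia. Qed.

Lemma edgeC es : symmetric (edge es).
Proof. by move=> x y; rewrite /edge orbC. Qed.

Lemma edge_chain k x y : edge (chain k) x y =
  ((y == x.+1) && (y < k)%N) || ((x == y.+1) && (x < k)%N).
Proof.
have memE u v : ((u, v) \in chain k) = (v == u.+1) && (v < k)%N.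
  apply/mapP/andP=> [[j] | [/eqP-> lt_vk]].
    by rewrite mem_iota => lt_j [-> ->]; split=> //; lia.
  by exists u => //; rewrite mem_iota; lia.
by rewrite /edge !memE.
Qed.

Lemma edge_cons u v es x y : edge ((u, v) :: es) x y =
  [|| (x == u) && (y == v), (y == u) && (x == v) | edge es x y].
Proof. by rewrite /edge !in_cons !xpair_eqE orbACA -orbA. Qed.

Lemma simple_rel_graph (R : comNzRingType) N es :
  simple_graph R N es = rel_graph R N (edge es).
Proof. by []. Qed.

Lemma coxeter_rel_graph N e (h : nat -> nat) : symmetric e -> irreflexive e ->
  (forall i j, (i < j < N)%N -> e i j -> h j = (h i).+1) ->
  coxeter (rel_graph Qq N e) q = rel_poly N e.
Proof.
move=> sym_e irr_e hS; apply: (coxeter_potential (h := fun i => h i)) q_neq0 _ _.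
  exact: rel_graph_weighted.
move=> i j lt_ij; rewrite mxE => nz_ij; apply: hS; first by rewrite lt_ij /=.
by move: nz_ij; case: (e i j); rewrite ?eqxx.
Qed.

Lemma path_poly0 : path_poly 0 = 1.
Proof. exact: det_mx00. Qed.

Lemma path_poly1 : path_poly 1 = zq.
Proof.
rewrite /path_poly (@rel_poly_isolated _ _ path_rel ord0) ?path_poly0 //.
- by rewrite -/(path_poly 0) path_poly0 mulr1.
- exact: path_relC.
- exact: path_rel_irr.
Qed.

Lemma path_polyS k : path_poly k.+2 = zq * path_poly k.+1 - path_poly k.
Proof.
apply: (@rel_poly_pendant _ _ _ _ ord_max ord_max).
- exact: path_relC.
- exact: path_rel_irr.
- by move=> x lt_x; rewrite /path_rel /bump /=; lia.
- by move=> x y lt_x lt_y; rewrite /path_rel /bump /=; lia.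
- by move=> x y lt_x lt_y; rewrite /path_rel /bump /=; lia.
Qed.

Lemma cA_path k : cA k = path_poly k.
Proof.
rewrite /cA /coxA simple_rel_graph.
rewrite (@eq_rel_graph _ _ _ path_rel) => [|x y lt_x lt_y]; last first.
  by rewrite edge_chain lt_x lt_y !andbT.
apply: (@coxeter_rel_graph _ _ id); [exact: path_relC | exact: path_rel_irr |].
by move=> i j lt_ij; rewrite /path_rel; lia.
Qed.

(** The chain on [k + 2] vertices with a further vertex attached to its vertex [p];
    [D] and [E] diagrams are of this form. *)
Definition fork_rel p k : rel nat := fun x y =>
  [|| path_rel x y && (x < k.+2)%N && (y < k.+2)%N,
      (x == p) && (y == k.+2) | (y == p) && (x == k.+2)].

Lemma fork_relC p k : symmetric (fork_rel p k).
Proof. by move=> x y; rewrite /fork_rel /path_rel; lia. Qed.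

Lemma fork_rel_irr p k : (p < k.+2)%N -> irreflexive (fork_rel p k).
Proof. by move=> lt_p x; rewrite /fork_rel /path_rel; lia. Qed.

Lemma coxeter_fork p k : (p < k.+2)%N ->
  coxeter (rel_graph Qq k.+3 (fork_rel p k)) q = rel_poly k.+3 (fork_rel p k).
Proof.
move=> lt_p; apply: (@coxeter_rel_graph _ _ (fun x => if x == k.+2 then p.+1 else x)).
- exact: fork_relC.
- exact: fork_rel_irr.
- by move=> i j lt_ij; rewrite /fork_rel /path_rel; do !case: eqP; lia.
Qed.
Lemma fork_poly p k : (p < k.+2)%N ->
  rel_poly k.+3 (fork_rel p k) = zq * path_poly k.+2 -
    rel_poly k.+1 (fun x y => path_rel (bump p x) (bump p y)).
Proof.
move=> lt_p; apply: (@rel_poly_pendant _ _ _ _ ord_max (Ordinal lt_p)) => /=.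
- exact: fork_relC.
- exact: fork_rel_irr.
- by move=> x lt_x; rewrite /fork_rel /path_rel /bump /=; lia.
- by move=> x y lt_x lt_y; rewrite /fork_rel /path_rel /bump /=; lia.
- by [].
Qed.

Lemma bump_relP (e : rel nat) p : symmetric e -> irreflexive e ->
  symmetric (fun x y => e (bump p x) (bump p y)) /\
  irreflexive (fun x y => e (bump p x) (bump p y)).
Proof. by move=> sym_e irr_e; split=> [x y | x] /=; rewrite ?irr_e // sym_e. Qed.

(** Without the vertex [k] the chain falls into a chain and an isolated vertex. *)
Lemma fork_polyD k :
  rel_poly k.+3 (fork_rel k k) = zq * path_poly k.+2 - zq * path_poly k.
Proof.
have [symb irrb] := bump_relP k path_relC path_rel_irr.
rewrite fork_poly; last by lia.
rewrite (@rel_poly_isolated _ _ path_rel ord_max) // => [x lt_x | x y lt_x lt_y];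
  rewrite /path_rel /bump /=; lia.
Qed.

(** Without the vertex 2 the chain falls into [A_2] and a chain on [k] vertices. *)
Lemma fork_polyE k :
  rel_poly k.+4 (fork_rel 2 k.+1) =
  zq * path_poly k.+3 - (zq * (zq * path_poly k) - path_poly k).
Proof.
have [symb irrb] := bump_relP 2 path_relC path_rel_irr.
rewrite fork_poly //; congr (_ - _).
pose e1 := fun x y => path_rel (bump 2 x.+1) (bump 2 y.+1).
have [sym1 irr1] : symmetric e1 /\ irreflexive e1.
  by split=> [x y | x]; rewrite /e1 ?path_rel_irr // path_relC.
rewrite (@rel_poly_pendant _ _ e1 path_rel ord0 ord0) //.
congr (_ * _ - _); rewrite (@rel_poly_isolated _ _ path_rel ord0) //.
by move=> x lt_x; rewrite /e1 /path_rel /bump /=; lia.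
Qed.

Lemma simple_fork k p es : es = (p, k.+2) :: chain k.+2 ->
  simple_graph Qq k.+3 es = rel_graph Qq k.+3 (fork_rel p k).
Proof.
move=> ->; rewrite simple_rel_graph; apply: eq_rel_graph => x y lt_x lt_y.
rewrite edge_cons edge_chain /fork_rel /path_rel; lia.
Qed.

Lemma cD2 : cD 2 = zq * zq.
Proof. by rewrite /cD /= -/(cA 1) cA_path path_poly1 expr2. Qed.

Lemma cD_path k : cD k.+3 = zq * path_poly k.+2 - zq * path_poly k.
Proof.
case: k => [|k].
  by rewrite [LHS](cA_path 3) path_polyS path_poly1 path_poly0 mulr1.
rewrite /cD /coxD (@simple_fork k.+1 k.+1); last first.
  by rewrite /edgesD /= subSS subSS subSS subn0.
by rewrite coxeter_fork ?fork_polyD //; lia.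
Qed.

Lemma cE_path k : cE k.+4 =
  zq * path_poly k.+3 - (zq * (zq * path_poly k) - path_poly k).
Proof. by rewrite /cE /coxE (@simple_fork k.+1 2) // coxeter_fork // fork_polyE. Qed.

(** ** The affine diagrams and their Euclidean parts *)

Definition affine_edge (T : affine_type) : rel nat := edge (affine_edges T).

Lemma mem_edgesD n u v : ((u, v) \in affine_edges (AffD n)) =
  [|| (u == 0) && (v == 2), (u == 1) && (v == 2), (u == n - 2) && (v == n - 1),
      (u == n - 2) && (v == n) | [&& v == u.+1, 1 < u & u < n - 2]]%N.
Proof.
rewrite /affine_edges mem_cat !inE !xpair_eqE -!orbA; do 4 congr (_ || _).
apply/mapP/and3P=> [[j] | [/eqP-> lt_1u lt_un]].
  by rewrite mem_iota => lt_j [-> ->]; split=> //; lia.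
by exists u => //; rewrite mem_iota; lia.
Qed.

Lemma affine_edge_irr T : admissible T -> irreflexive (affine_edge T).
Proof.
case: T => [n|n|||] adm x.
- by rewrite /affine_edge edge_cons edge_chain; move: adm => /=; lia.
- by rewrite /affine_edge /edge orbb mem_edgesD; move: adm => /=; lia.
- by do 8 (case: x => [|x] //).
- by do 9 (case: x => [|x] //).
- by do 10 (case: x => [|x] //).
Qed.

Lemma affine_mxE R T : affine_mx R T = rel_graph R (rk T).+1 (affine_edge T).
Proof. by []. Qed.

Lemma affine_weighted R T : admissible T -> weighted_graph (affine_mx R T).
Proof.
by move=> adm; apply: rel_graph_weighted; [exact: edgeC | exact: affine_edge_irr].
Qed.

Lemma affine_poly_neq0 T : admissible T -> graph_poly (affine_mx Qq T) zq != 0.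
Proof.
by move=> adm; apply: rel_poly_neq0; [exact: edgeC | exact: affine_edge_irr].
Qed.

(** [s] lists the new names of the vertices, so that for a concrete diagram both
    hypotheses on it are decided by computation. *)
Lemma rel_poly_rename N (e e' : rel nat) (s : seq nat) :
  symmetric e -> irreflexive e -> perm_eq s (iota 0 N) ->
  all (fun x => all (fun y => e' x y == e (nth 0%N s x) (nth 0%N s y)) (iota 0 N))
      (iota 0 N) ->
  rel_poly N e' = rel_poly N e.
Proof.
move=> sym_e irr_e perm_s /allP ee'.
have sz_s : size s = N by rewrite (perm_size perm_s) size_iota.
have lt_s (i : 'I_N) : (nth 0%N s i < N)%N.
  have : nth 0%N s i \in s by rewrite mem_nth ?sz_s.
  by rewrite (perm_mem perm_s) mem_iota.
pose f i := Ordinal (lt_s i).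
have inj_f : injective f.
  move=> i j /(congr1 val)/eqP /=; rewrite nth_uniq ?sz_s //; last first.
    by rewrite (perm_uniq perm_s) iota_uniq.
  by move=> /eqP/val_inj.
rewrite /rel_poly -[RHS](graph_poly_renumber (perm inj_f)); last exact: rel_graph_weighted.
suff -> : rel_graph Qq N e' = renumber (rel_graph Qq N e) (perm inj_f) by [].
apply/matrixP=> i j; rewrite [LHS]mxE [RHS]mxE [RHS]mxE !permE.
have mem_N (k : 'I_N) : (k : nat) \in iota 0 N by rewrite mem_iota ltn_ord.
by have /allP/(_ _ (mem_N j))/eqP-> := ee' _ (mem_N i).
Qed.

Lemma eq_rel_poly N (e e' : rel nat) :
  (forall x y, (x < N)%N -> (y < N)%N -> e x y = e' x y) ->
  rel_poly N e = rel_poly N e'.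
Proof. by move=> eq_e; rewrite /rel_poly (eq_rel_graph _ eq_e). Qed.

Lemma euclid_rel_poly T : graph_poly (euclid_mx Qq T) zq =
  rel_poly (rk T) (fun x y => affine_edge T x.+1 y.+1).
Proof. by rewrite /euclid_mx affine_mxE rel_graph_del. Qed.

(** Shifted by one, the numberings of the affine diagrams restrict to the standard
    ones for A, D and [E_7]; the vertices of [E_6] and [E_8] have to be renamed. *)
Lemma euclid_poly T : admissible T ->
  graph_poly (euclid_mx Qq T) zq = H_table T 0.
Proof.
rewrite euclid_rel_poly; case: T => [n|n|||] adm.
- rewrite [RHS]cA_path; apply: eq_rel_poly => x y lt_x lt_y.
  by rewrite /affine_edge edge_cons edge_chain /path_rel; rewrite /= in lt_x lt_y; lia.
- have [k def_n] : exists k, n = k.+3 by exists (n - 3)%N; rewrite /= in adm; lia.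
  move: adm; rewrite def_n => adm; rewrite [RHS]cD_path -fork_polyD.
  apply: eq_rel_poly => x y _ _; have lt0k : (0 < k)%N := adm.
  have memE u v : ((u.+1, v.+1) \in affine_edges (AffD k.+3)) =
      ((v == u.+1) && (u <= k)%N) || ((u == k) && (v == k.+2)).
    rewrite mem_edgesD !eqSS !subSS !subn0 !ltnS.
    have [-> | ne_uv] := eqVneq v u.+1.
      by rewrite /= eqSS; case: (ltngtP u k) => [||->]; case: u => [|u] //=; lia.
    have -> : (u == 0%N) && (v == 1%N) = false by lia.
    have -> : (u == k) && (v == k.+1) = false by lia.
    by rewrite /= orbF.
  by rewrite /affine_edge /edge !memE /fork_rel /path_rel; lia.
- rewrite [RHS](cE_path 2) -fork_polyE.
  apply: (rel_poly_rename (s := [:: 5; 2; 1; 0; 3; 4]%N)) => //.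
    exact: fork_relC.
  exact: fork_rel_irr.
- rewrite [RHS](cE_path 3) -fork_polyE.
  apply: (rel_poly_rename (s := iota 0 7)) => //; first exact: fork_relC.
  exact: fork_rel_irr.
- rewrite [RHS](cE_path 4) -fork_polyE.
  apply: (rel_poly_rename (s := [:: 6; 5; 4; 3; 2; 1; 0; 7]%N)) => //.
    exact: fork_relC.
  exact: fork_rel_irr.
Qed.

(** ** Neighbours in the affine diagrams *)

Definition nbrs (T : affine_type) (i : nat) : seq nat :=
  match T with
  | AffA n => if i == 0%N then [:: 1; n]%N
              else if i == n then [:: n.-1; 0]%N else [:: i.-1; i.+1]
  | AffD n => if (i <= 1)%N then [:: 2]
              else if (n.-1 <= i)%N then [:: n - 2]%N
              else (if i == 2 then [:: 0; 1]%N else [:: i.-1]) ++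
                   (if i == n - 2 then [:: n.-1; n] else [:: i.+1])%N
  | _ => [seq j <- iota 0 (rk T).+1 | affine_edge T i j]
  end.

Lemma nbrsD_edge n i j : (4 <= n)%N -> (i <= n)%N -> (j <= n)%N ->
  (j \in nbrs (AffD n) i) = affine_edge (AffD n) i j.
Proof.
move=> le4n le_i le_j; apply/idP/idP.
  have edge_ij : (i, j) \in affine_edges (AffD n) -> affine_edge (AffD n) i j.
    by rewrite /affine_edge /edge => ->.
  have edge_ji : (j, i) \in affine_edges (AffD n) -> affine_edge (AffD n) i j.
    by rewrite /affine_edge /edge orbC => ->.
  rewrite /nbrs; case: ifP => ?.
    by rewrite inE => /eqP ej; apply: edge_ij; rewrite mem_edgesD; lia.
  case: ifP => ?.
    by rewrite inE => /eqP ej; apply: edge_ji; rewrite mem_edgesD; lia.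
  rewrite mem_cat => /orP[]; case: ifP => ?; rewrite !inE => ej.
  - by apply: edge_ji; rewrite mem_edgesD; lia.
  - by apply: edge_ji; rewrite mem_edgesD; lia.
  - by apply: edge_ij; rewrite mem_edgesD; lia.
  - by apply: edge_ij; rewrite mem_edgesD; lia.
have nbrs_mem u v : (u, v) \in affine_edges (AffD n) ->
    (v \in nbrs (AffD n) u) && (u \in nbrs (AffD n) v).
  rewrite mem_edgesD /nbrs.
  case/or4P=> [/andP[/eqP-> /eqP->]|/andP[/eqP-> /eqP->]|/andP[/eqP-> /eqP->]|/orP[]].
  - by rewrite /= (_ : (n.-1 <= 2)%N = false) ?inE //; lia.
  - by rewrite /= (_ : (n.-1 <= 2)%N = false) ?inE //; lia.
  - by apply/andP; split; repeat (case: ifP => ?; try lia); rewrite !inE; lia.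
  - move=> /andP[/eqP-> /eqP->].
    by apply/andP; split; repeat (case: ifP => ?; try lia); rewrite !inE; lia.
  - move=> /and3P[/eqP-> ? ?].
    by apply/andP; split; repeat (case: ifP => ?; try lia); rewrite !inE; lia.
by case/orP=> /nbrs_mem /andP[].
Qed.

Lemma affine_edge_nbrs T i j : admissible T -> (i <= rk T)%N -> (j <= rk T)%N ->
  affine_edge T i j = (j \in nbrs T i).
Proof.
case: T => [n|n|||] adm le_i le_j.
- rewrite /= in adm le_i le_j; rewrite /affine_edge /nbrs edge_cons edge_chain.
  by case: ifP => ?; [| case: ifP => ?]; rewrite !inE; lia.
- by rewrite nbrsD_edge.
all: by rewrite /nbrs mem_filter mem_iota andb_idr //; move: le_j => /=; lia.
Qed.

Lemma nbrs_uniq T i : admissible T -> (i <= rk T)%N -> uniq (nbrs T i).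
Proof.
case: T => [n|n|||] adm le_i; rewrite /= in adm le_i; rewrite /nbrs.
- by case: ifP => ?; [| case: ifP => ?]; rewrite /= !inE; lia.
- case: ifP => ? //; case: ifP => ? //.
  by case: ifP => ?; case: ifP => ?; rewrite /= !inE; lia.
all: by rewrite filter_uniq // iota_uniq.
Qed.

Lemma nbrs_le T i k : admissible T -> (i <= rk T)%N -> k \in nbrs T i -> (k <= rk T)%N.
Proof.
case: T => [n|n|||] adm le_i; rewrite /= in adm le_i; rewrite /nbrs.
- by case: ifP => ?; [| case: ifP => ?]; rewrite !inE /=; lia.
- case: ifP => ?; first by rewrite !inE /=; lia.
  case: ifP => ?; first by rewrite !inE /=; lia.
  by rewrite mem_cat; case: ifP => ?; case: ifP => ?; rewrite !inE /=; lia.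
all: by rewrite mem_filter mem_iota => /andP[_]; rewrite /=; lia.
Qed.

Lemma sum_nbrs (R : comNzRingType) T (i : 'I_(rk T).+1) (v : nat -> R) : admissible T ->
  \sum_j affine_mx R T i j * v j = \sum_(k <- nbrs T i) v k.
Proof.
move=> adm; have le_i : (i <= rk T)%N by rewrite -ltnS.
transitivity (\sum_(0 <= j < (rk T).+1 | j \in nbrs T i) v j).
  rewrite big_mkord [RHS]big_mkcond; apply: eq_bigr => j _ /=.
  rewrite affine_mxE mxE affine_edge_nbrs ?(leq_ord j) //.
  by case: (_ \in _); rewrite ?mul1r ?mul0r.
rewrite -big_filter; apply: perm_big; apply: uniq_perm.
- by rewrite filter_uniq // iota_uniq.
- exact: nbrs_uniq.
- move=> k; rewrite mem_filter mem_index_iota /= andb_idr // => nbr_k.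
  by rewrite ltnS (nbrs_le adm le_i).
Qed.

(** ** Verification of the table *)

#[local] Arguments cD : simpl never.

Lemma cAS k : cA k.+2 = zq * cA k.+1 - cA k.
Proof. by rewrite !cA_path path_polyS. Qed.

Lemma cA0 : cA 0 = 1. Proof. by rewrite cA_path path_poly0. Qed.
Lemma cA1 : cA 1 = zq. Proof. by rewrite cA_path path_poly1. Qed.

Lemma cDS k : cD k.+4 = zq * cD k.+3 - cD k.+2.
Proof.
rewrite !cD_path; case: k => [|k].
  by rewrite cD2 !path_polyS path_poly1 path_poly0; ring.
by rewrite cD_path !path_polyS; ring.
Qed.

Lemma H_tableA_row n i : (2 <= n)%N -> (0 < i <= n)%N ->
  zq * H_table (AffA n) i - \sum_(k <- nbrs (AffA n) i) H_table (AffA n) k = 0.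
Proof.
move=> le2n /andP[lt0i le_in].
have HE k : (0 < k)%N -> H_table (AffA n) k = cA (k - 1) + cA (n - k).
  by move=> lt0k; rewrite /H_table; case: ifP => // /eqP k0; rewrite k0 in lt0k.
have H0 : H_table (AffA n) 0 = cA n by [].
rewrite /nbrs; case: ifP => [/eqP i0 | _]; first by rewrite i0 in lt0i.
case: ifP => [/eqP i_n | ne_in]; rewrite !big_cons big_nil.
  have [k def_n] : exists k, n = k.+2 by exists (n - 2)%N; lia.
  rewrite i_n H0 (HE n) ?(HE n.-1) ?def_n //= subnn !subSS !subn0 subSn // subnn.
  by rewrite cAS cA0 cA1; ring.
have [m def_n] : exists m, n = (i + m.+1)%N by exists (n - i).-1; lia.
have e1 : (n - i = m.+1)%N by lia.
have e2 : (n - i.+1 = m)%N by lia.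
rewrite (HE i lt0i) (HE i.+1 isT) e1 e2.
case: i lt0i le_in ne_in def_n e1 e2 => [|[|j]] // _ _ _ def_n _ _.
  by rewrite H0 def_n add1n cAS subnn cA0 cA1; ring.
have e3 : (n - j.+1 = m.+2)%N by lia.
by rewrite (HE j.+1 isT) e3 /= !subSS !subn0 !cAS; ring.
Qed.

Lemma H_tableD_row n i : (4 <= n)%N -> (0 < i <= n)%N ->
  zq * H_table (AffD n) i - \sum_(k <- nbrs (AffD n) i) H_table (AffD n) k = 0.
Proof.
move=> le4n /andP[lt0i le_in].
have HE k : (1 < k <= n - 2)%N -> H_table (AffD n) k = zq * cD (n - k).
  by rewrite /H_table => ?; do 3?[case: ifP => ?; try lia]; rewrite cA1.
have HE' k : (n - 2 < k)%N -> H_table (AffD n) k = zq ^+ 2.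
  by rewrite /H_table => ?; do 3?[case: ifP => ?; try lia]; rewrite cA1.
have H0 : H_table (AffD n) 0 = cD n by [].
have H1 : H_table (AffD n) 1 = cD (n - 2) by [].
rewrite /nbrs; case: ifP => [? | lt1i].
  have -> : i = 1%N by lia.
  by rewrite big_cons big_nil H1 HE ?addr0 ?subrr //; lia.
case: ifP => [le_ni | lt_in].
  have lt_i : (n - 2 < i)%N by lia.
  have e2 : (n - (n - 2) = 2)%N by lia.
  have mid : (1 < n - 2 <= n - 2)%N by lia.
  by rewrite big_cons big_nil (HE' i lt_i) (HE _ mid) e2 cD2; ring.
have mid : (1 < i <= n - 2)%N by lia.
have D3 : cD 3 = zq * cD 2 - zq - zq.
  by rewrite cD_path cD2 path_polyS path_poly1 path_poly0; ring.
rewrite (HE _ mid); have [i2 | ne_i2] := eqVneq i 2; have [i_n | ne_in] := eqVneq i (n - 2)%N.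
- have [lt1 lt2] : (n - 2 < n.-1)%N /\ (n - 2 < n)%N by lia.
  have [e2 e4] : (n - 2 = 2)%N /\ n = 4%N by lia.
  rewrite i2 !cat_cons cat0s !big_cons !big_nil H0 H1 (HE' _ lt1) (HE' _ lt2) e2 e4.
  by rewrite cDS D3 cD2; ring.
- have [k def_n] : exists k, n = k.+4.+1 by exists (n - 5)%N; lia.
  have mid3 : (1 < 3 <= n - 2)%N by lia.
  rewrite i2 !cat_cons cat0s !big_cons !big_nil H0 H1 (HE _ mid3) def_n !subSS subn0.
  by rewrite [cD k.+4.+1]cDS [cD k.+4]cDS; ring.
- have mid' : (1 < i.-1 <= n - 2)%N by lia.
  have [lt1 lt2] : (n - 2 < n.-1)%N /\ (n - 2 < n)%N by lia.
  have [e2 e3] : (n - i = 2)%N /\ (n - i.-1 = 3)%N by lia.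
  rewrite !cat_cons cat0s !big_cons !big_nil (HE _ mid') (HE' _ lt1) (HE' _ lt2) e2 e3 D3 cD2.
  by ring.
- have mid' : (1 < i.-1 <= n - 2)%N by lia.
  have mid'' : (1 < i.+1 <= n - 2)%N by lia.
  have [k [e2 e3 e4]] : exists k, [/\ n - i = k.+3, n - i.-1 = k.+4 & n - i.+1 = k.+2]%N.
    by exists (n - i - 3)%N; split; lia.
  rewrite !cat_cons cat0s !big_cons !big_nil (HE _ mid') (HE _ mid'') e2 e3 e4 cDS.
  by ring.
Qed.

Lemma H_table_row T i : admissible T -> (0 < i <= rk T)%N ->
  zq * H_table T i - \sum_(k <- nbrs T i) H_table T k = 0.
Proof.
case: T => [n|n|||] adm; [exact: H_tableA_row | exact: H_tableD_row | ..].
- by do 7?[case: i => [|i] //]; move=> _ /=; rewrite !big_cons big_nil /=;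
    rewrite ?(cE_path 2) ?cA_path ?path_polyS ?path_poly1 ?path_poly0; ring.
- by do 8?[case: i => [|i] //]; move=> _ /=; rewrite !big_cons big_nil /=;
    rewrite ?(cE_path 3) ?cD_path ?cA_path ?path_polyS ?path_poly1 ?path_poly0; ring.
- by do 9?[case: i => [|i] //]; move=> _ /=; rewrite !big_cons big_nil /=;
    rewrite ?(cE_path 4) ?(cE_path 3) ?(cE_path 2) ?cD_path ?cA_path ?path_polyS;
    rewrite ?path_poly1 ?path_poly0; ring.
Qed.

(** The table satisfies the equations of the column of cofactors at all vertices
    but the affine one, hence is proportional to it; the values at the affine
    vertex agree and do not vanish. *)
Lemma H_table_cof T (i : 'I_(rk T).+1) : admissible T ->
  graph_cof (affine_mx Qq T) i ord0 zq = H_table T i.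
Proof.
move=> adm; have wg := affine_weighted Qq adm; have nzH := affine_poly_neq0 adm.
set v := H_table T.
have v_row (j : 'I_(rk T).+1) : j != ord0 ->
    zq * v j - \sum_k affine_mx Qq T j k * v k = 0.
  move=> nz_j; rewrite sum_nbrs //; apply: H_table_row => //.
  by rewrite lt0n -ltnS ltn_ord andbT.
have v_cof := graph_cof_unique (v := fun j : 'I_(rk T).+1 => v j) wg nzH v_row.
have v0 : graph_cof (affine_mx Qq T) ord0 ord0 zq = v 0%N.
  by rewrite (graph_cof_diag ord0 zq wg) euclid_poly.
have nzv0 : v 0%N != 0.
  rewrite /v -(euclid_poly adm) euclid_rel_poly; apply: rel_poly_neq0 => [x y|x].
    exact: edgeC.
  exact: affine_edge_irr.
have := v_cof ord0; rewrite v0 => /(mulfI nzv0) eq_det.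
by apply: (mulIf nzH); rewrite {1}eq_det -v_cof.
Qed.
(** * Bezoutians and Wronskians of harmonic families *)

Section AlternatingForm.

(** Bezoutians (up to the factor [x - y]) and Wronskians are alternating biadditive
    forms [B]; all the summation formulas come from evaluating [B (zq * f) f]. *)
Variables (K : zmodType) (B : Qq -> Qq -> K).
Hypothesis BD : forall f g h, B (f + g) h = B f h + B g h.
Hypothesis BC : forall f g, B f g = - B g f.

(** By the recursion [B C_(k-1) C_k - B C_k C_(k+1) = B (zq C_k) C_k], and the sum
    telescopes. *)
Lemma form_three_term (C : nat -> Qq) a b : (0 < a <= b)%N ->
  (forall k, (a <= k < b)%N -> C k.-1 - zq * C k + C k.+1 = 0) ->
  B (C a.-1) (C a) = \sum_(a <= k < b) B (zq * C k) (C k) + B (C b.-1) (C b).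
Proof.
move=> /andP[lt0a le_ab]; elim: b le_ab => [|b IHb]; first by case: a lt0a.
rewrite leq_eqVlt => /predU1P[<- _ | le_ab rec]; first by rewrite big_geq ?add0r.
rewrite big_nat_recr //= IHb // => [|k /andP[le_ak lt_kb]]; last first.
  by apply: rec; rewrite le_ak ltnW.
rewrite -addrA; congr (_ + _).
have -> : zq * C b = C b.-1 + C b.+1.
  have recb := rec b; rewrite ltnSn andbT in recb.
  by apply/esym/subr0_eq; rewrite addrAC recb.
by rewrite BD (BC (C b.+1)) subrK.
Qed.

Hypothesis K2 : forall x : K, x = - x -> x = 0.

Lemma form0 f : B 0 f = 0.
Proof. by apply: (addIr (B 0 f)); rewrite -BD !add0r. Qed.

Lemma form_sum (I : finType) (P : pred I) (F : I -> Qq) f :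
  B (\sum_(i | P i) F i) f = \sum_(i | P i) B (F i) f.
Proof. by apply: (big_morph (fun g => B g f)) => [g h|]; rewrite ?BD ?form0. Qed.

(** Summation by parts: the contributions of the edges inside [S] cancel in
    pairs, and only the edge from [i] to [u] leaves [S]. *)
Lemma form_green (T : affine_type) (F : option 'I_(rk T).+1 -> Qq)
    (S : {set 'I_(rk T).+1}) i u :
  (forall k, zq * F (Some k) = \sum_(w | ext_adj T (Some k) w) F w) ->
  i \in S -> ext_adj T (Some i) u -> (forall k, k \in S -> u != Some k) ->
  (forall k w, k \in S -> ext_adj T (Some k) w ->
     (exists2 j, j \in S & w = Some j) \/ (k = i /\ w = u)) ->
  B (F u) (F (Some i)) = \sum_(k in S) B (zq * F (Some k)) (F (Some k)).
Proof.
move=> harm Si adj_iu notS_u bd; pose inS (w : option 'I_(rk T).+1) := oapp (mem S) false w.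
have inSu : inS u = false.
  by case: u adj_iu notS_u bd => //= j _ notS_j _; apply/negP=> /notS_j; rewrite eqxx.
under eq_bigr => k _ do rewrite harm form_sum (bigID inS) /=.
rewrite big_split /= [X in _ = X + _](_ : _ = 0) ?add0r; last first.
  pose X k j := if ext_adj T (Some k) (Some j) then B (F (Some j)) (F (Some k)) else 0.
  have sumE k : \sum_(w | ext_adj T (Some k) w && inS w) B (F w) (F (Some k)) =
      \sum_(j in S) X k j.
    rewrite [RHS]big_mkcond [LHS]big_mkcond /=.
    rewrite (bigD1 None) //= andbF add0r.
    rewrite (reindex_omap Some id) /=; last by case.
    apply: eq_big => [j | j _]; first by rewrite eqxx.
    by rewrite /X /=; case: (j \in S); rewrite ?andbT ?andbF.
  (* The double sum over [S] is antisymmetric in [k] and [j]. *)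
  apply: K2; under eq_bigr => k _ do rewrite sumE.
  rewrite -sumrN exchange_big; apply: eq_bigr => k _ /=; rewrite -sumrN.
  apply: eq_bigr => j _; rewrite /X /= /affine_adj edgeC.
  by case: ifP => _; rewrite ?oppr0 // BC.
have out_u : ext_adj T (Some i) u && ~~ inS u by rewrite adj_iu inSu.
rewrite (bigD1 i Si) (bigD1 u out_u) /=.
rewrite big1 => [|w /andP[/andP[adj_iw notS_w] ne_wu]]; last first.
  have [[j Sj def_w] | [_ eq_wu]] := bd i w Si adj_iw.
    by rewrite def_w /= Sj in notS_w.
  by rewrite eq_wu eqxx in ne_wu.
rewrite addr0 big1 ?addr0 // => k /andP[Sk ne_ki].
rewrite big1 // => w /andP[adj_kw notS_w].
have [[j Sj def_w] | [eq_ki _]] := bd k w Sk adj_kw.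
  by rewrite def_w /= Sj in notS_w.
by rewrite eq_ki eqxx in ne_ki.
Qed.

End AlternatingForm.

(** ** The two forms *)

Lemma WrD f g h : Wr (f + g) h = Wr f h + Wr g h.
Proof. by rewrite /Wr fderivD; ring. Qed.

Lemma WrC f g : Wr f g = - Wr g f.
Proof. by rewrite /Wr opprB mulrC [f * _]mulrC. Qed.

Lemma Wr_zq f : Wr (zq * f) f = (1 - q ^- 2) * f ^+ 2.
Proof. by rewrite /Wr fderivM fderiv_zq; ring. Qed.

Lemma Qq2 (f : Qq) : f = - f -> f = 0.
Proof.
move=> /eqP; rewrite -addr_eq0 -mulr2n -mulr_natr mulf_eq0 => /orP[/eqP // | ].
by rewrite -tofrac1 -tofracMn tofrac_eq0 -polyC1 -polyCMn polyC_eq0.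
Qed.

Section BezoutForm.

Variables (L : fieldType) (iota : {rmorphism rat -> L}) (x y : L).
Hypotheses (trx : transc iota x) (try : transc iota y) (ne_xy : x != y).

Definition bez_form f g := ev iota x f * ev iota y g - ev iota y f * ev iota x g.

Lemma bez_formE f g : Bezq f g iota x y = bez_form f g / (x - y).
Proof. by []. Qed.

Lemma bez_formD f g h : bez_form (f + g) h = bez_form f h + bez_form g h.
Proof.
have [e [eE _]] := ev_morph trx; have [e' [e'E _]] := ev_morph try.
by rewrite /bez_form -!eE -!e'E !rmorphD /=; ring.
Qed.

Lemma bez_formC f g : bez_form f g = - bez_form g f.
Proof. by rewrite /bez_form opprB; congr (_ - _); apply: mulrC. Qed.

Lemma bez_form_zq f : bez_form (zq * f) f =
  (x - y) * ((1 - (x * y)^-1) * (ev iota x f * ev iota y f)).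
Proof.
have [e [eE eq]] := ev_morph trx; have [e' [e'E eq']] := ev_morph try.
rewrite /bez_form -!eE -!e'E !rmorphM /= /zq !rmorphD /= !fmorphV eq eq'.
move: (e f) (e' f) => s t; field.
by rewrite (transc_neq0 trx) (transc_neq0 try).
Qed.

Lemma iota2 (s : L) : s = - s -> s = 0.
Proof.
move=> /eqP; rewrite -addr_eq0 -mulr2n -mulr_natr mulf_eq0 => /orP[/eqP // | ].
by rewrite -(rmorph_nat iota) fmorph_eq0.
Qed.

Lemma bez_sum (I : Type) (s : seq I) (P : pred I) (F : I -> Qq) :
  (\sum_(k <- s | P k) bez_form (zq * F k) (F k)) / (x - y) =
  (1 - (x * y)^-1) * (\sum_(k <- s | P k) ev iota x (F k) * ev iota y (F k)).
Proof.
under eq_bigr => k _ do rewrite bez_form_zq.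
by rewrite -mulr_sumr -mulr_sumr mulrC mulKf // subr_eq0.
Qed.

End BezoutForm.

(** Divided by [1 - (xy)^-1], the scalar identity gives the entries of a product of
    two matrices, whose minors Cauchy-Binet expands. *)
Lemma bez_formulaI N (b : kernel) (F : 'I_N -> Qq) (S : {set 'I_N}) :
  (forall (L : fieldType) (iota : {rmorphism rat -> L}) (x y : L),
     transc iota x -> transc iota y -> x != y ->
     b L iota x y =
     (1 - (x * y)^-1) * \sum_(k in S) ev iota x (F k) * ev iota y (F k)) ->
  bez_formula b F S.
Proof.
move=> bE L iota.
have bmx m r (x : 'I_m -> L) (y : 'I_r -> L) :
    (forall l, transc iota (x l)) -> (forall s, transc iota (y s)) ->
    (forall l s, x l != y s /\ x l * y s != 1) ->
    \matrix_(l, s) (b L iota (x l) (y s) / (1 - (x l * y s)^-1)) =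
    (\matrix_(l < m, k < #|S|) ev iota (x l) (F (enum_val k))) *m
    (\matrix_(s < r, k < #|S|) ev iota (y s) (F (enum_val k)))^T.
  move=> trx try ne_xy; apply/matrixP=> l s; rewrite !mxE.
  have [ne1 ne2] := ne_xy l s; rewrite bE // mulrAC mulfV ?mul1r; last first.
    by rewrite subr_eq0 eq_sym invr_eq1.
  rewrite big_enum_val.
  by apply: eq_bigr => k _; rewrite !mxE.
split=> //; first exact: bE.
move=> m x y _ trx try ne_xy; rewrite bmx // cauchy_binet; apply: eq_bigr => f _.
congr (\det _ * _); first by apply/matrixP=> l t; rewrite !mxE.
by rewrite -det_tr; congr (\det _); apply/matrixP=> l t; rewrite !mxE.
Qed.

(** ** Shortest paths to the root of a tree *)

Section RootedTree.

Variables (N : nat) (e : rel (option 'I_N)) (par : 'I_N -> option 'I_N).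
Variable lev : option 'I_N -> nat.
Hypothesis e_par : forall i w, e (Some i) w =
  (w == par i) || (if w is Some j then par j == Some i else false).
Hypothesis lev_par : forall i, lev (Some i) = (lev (par i)).+1.
Hypothesis lev0 : lev None = 0%N.
Hypothesis lev_lt : forall v, (lev v < #|{: option 'I_N}|)%N.

Let root_path v p := path e v p && (last v p == None).

Lemma root_path_size v p : root_path v p -> (lev v <= size p)%N.
Proof.
elim: p v => [|w p IHp] v; rewrite /root_path /=; first by move/eqP->; rewrite lev0.
move=> /andP[/andP[e_vw path_p] last_p]; case: v e_vw => [i|]; last by rewrite lev0.
have {}IHp := IHp w; rewrite /root_path path_p last_p in IHp.
rewrite e_par => /orP[/eqP def_w | ]; first by rewrite lev_par -def_w ltnS IHp.
case: w path_p last_p IHp => // j _ _ /(_ isT) le_j /eqP par_j.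
by move: le_j; rewrite [lev (Some j)]lev_par par_j => /ltnW/leqW.
Qed.

Lemma root_path_exists v : exists2 p, root_path v p & size p = lev v.
Proof.
elim: {v}(lev v) {-2}v (erefl (lev v)) => [|n IHn] [i|] def_n.
- by rewrite lev_par in def_n.
- by exists [::] => //; rewrite /root_path /=.
- have [|p path_p size_p] := IHn (par i); first by move: def_n; rewrite lev_par => -[].
  by exists (par i :: p); rewrite /root_path /= ?e_par ?eqxx ?size_p.
- by rewrite lev0 in def_n.
Qed.

Lemma gdist_lev v : gdist e v None = lev v.
Proof.
rewrite /gdist; set a := fun d => _; set n := #|_|.
have ltP d : a d -> (lev v <= d)%N.
  by case/existsP=> p /root_path_size; rewrite size_tuple.
have a_lev : a (lev v).
  have [p path_p size_p] := root_path_exists v.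
  by apply/existsP; exists (tcast size_p (in_tuple p)); rewrite val_tcast.
have has_a : has a (iota 0 n).
  by apply/hasP; exists (lev v) => //; rewrite mem_iota lev_lt.
have lt_f : (find a (iota 0 n) < n)%N by rewrite has_find size_iota in has_a.
apply/eqP; rewrite eqn_leq; apply/andP; split; last first.
  by apply: ltP; have := nth_find 0%N has_a; rewrite nth_iota.
rewrite leqNgt; apply/negP=> lt_lev; have := before_find 0%N lt_lev.
by rewrite nth_iota ?add0n ?a_lev //; apply: ltn_trans lt_lev lt_f.
Qed.

(** A step changes the level by one, so a path that is no longer than the level of
    its origin has to descend at every step; it is the chain of parents. *)
Lemma shortest_path_par i p : root_path (Some i) p -> size p = lev (Some i) ->
  exists2 p', p = par i :: p' & root_path (par i) p' /\ size p' = lev (par i).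
Proof.
case: p => [|w p]; rewrite /root_path /=; first by move=> /eqP.
move=> /andP[/andP[e_iw path_p] last_p]; rewrite lev_par => -[size_p].
have le_w : (lev w <= size p)%N by rewrite root_path_size // /root_path path_p.
move: e_iw; rewrite e_par => /orP[/eqP def_w | ].
  by exists p; rewrite -def_w ?path_p ?last_p // size_p def_w.
case: w path_p last_p le_w => // j _ _ le_j /eqP par_j.
by move: le_j; rewrite size_p lev_par par_j lev_par => /ltnW; rewrite ltnn.
Qed.

Variable Q : 'I_N -> {set 'I_N}.
Hypothesis QP : forall i k, reflect
  (forall p, root_path (Some k) p -> size p = lev (Some k) -> Some i \in Some k :: p)
  (k \in Q i).

Lemma subtree_refl i : i \in Q i.
Proof. by apply/QP=> p _ _; rewrite mem_head. Qed.

Lemma subtree_up i k k' : par k = Some k' -> k' \in Q i -> k \in Q i.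
Proof.
move=> par_k /QP Qk'; apply/QP=> p path_p size_p.
have [p' -> []] := shortest_path_par path_p size_p; rewrite par_k => path_p' size_p'.
by rewrite in_cons Qk' ?orbT.
Qed.

Lemma subtree_down i k : k \in Q i -> k != i ->
  exists2 k', par k = Some k' & k' \in Q i.
Proof.
move=> /QP Qk ne_ki; have ne_some : (Some i == Some k) = false.
  by apply/negbTE; rewrite eq_sym; apply: contra ne_ki => /eqP[->].
have up p : root_path (par k) p -> size p = lev (par k) -> Some i \in par k :: p.
  move=> path_p size_p; have := Qk (par k :: p); rewrite in_cons ne_some /=; apply.
    by move: path_p; rewrite /root_path /= e_par eqxx.
  by rewrite /= lev_par size_p.
case def_k: (par k) up => [k'|] up; first by exists k' => //; apply/QP.
by have := up [::]; rewrite /root_path /= lev0 inE => /(_ isT erefl).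
Qed.

Lemma subtree_lev i k : k \in Q i -> (lev (Some i) <= lev (Some k))%N.
Proof.
elim: {k}(lev (Some k)) {-2}k (erefl (lev (Some k))) => [|n IHn] k def_n Qk.
  by rewrite lev_par in def_n.
have [-> | ne_ki] := eqVneq k i; first by [].
have [k' par_k Qk'] := subtree_down Qk ne_ki.
have lev_k : lev (Some k) = (lev (Some k')).+1 by rewrite [LHS]lev_par par_k.
by rewrite lev_k leqW // IHn //; move: def_n; rewrite lev_k => -[].
Qed.

(** The only edge leaving the subtree of [i] joins [i] to its parent. *)
Lemma subtree_boundary i k w : k \in Q i -> e (Some k) w ->
  (exists2 j, j \in Q i & w = Some j) \/ (k = i /\ w = par i).
Proof.
move=> Qk; rewrite e_par => /orP[/eqP-> | ].
  have [-> | ne_ki] := eqVneq k i; first by right.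
  by have [k' par_k Qk'] := subtree_down Qk ne_ki; left; exists k'.
by case: w => // j /eqP par_j; left; exists j => //; apply: subtree_up par_j Qk.
Qed.

Lemma par_notin_subtree i k : k \in Q i -> par i != Some k.
Proof.
move=> /subtree_lev; apply: contraTneq => par_i.
by rewrite lev_par par_i ltnn.
Qed.

Lemma next_par i u : e (Some i) u -> (lev u < lev (Some i))%N -> u = par i.
Proof.
rewrite e_par => /orP[/eqP // | ]; case: u => // j /eqP par_j.
by rewrite [lev (Some j)]lev_par par_j => /ltnW; rewrite ltnn.
Qed.

End RootedTree.

(** ** The affine diagrams D and E as trees rooted at the extra vertex *)

(** For the trees D and E: the neighbour of [i > 0] on the way to the affine
    vertex. *)
Definition parent (T : affine_type) (i : nat) : nat :=
  match T with
  | AffA _ => i.-1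
  | AffD n => if i == 1%N then 2 else if i == 2 then 0 else if i == n then n - 2 else i.-1
  | AffE6 => nth 0 [:: 0; 0; 1; 2; 3; 2; 5] i
  | AffE7 => nth 0 [:: 0; 0; 1; 2; 3; 4; 5; 3] i
  | AffE8 => nth 0 [:: 0; 0; 1; 2; 3; 4; 5; 6; 5] i
  end%N.

(** For the trees D and E: the distance from [i] to the extra vertex. *)
Definition level (T : affine_type) (i : nat) : nat :=
  match T with
  | AffA _ => i.+1
  | AffD n => if i == 0%N then 1 else if i == 1%N then 3 else if i == n then n.-1 else i
  | AffE6 => nth 0 [:: 1; 2; 3; 4; 5; 4; 5] i
  | AffE7 => nth 0 [:: 1; 2; 3; 4; 5; 6; 7; 5] i
  | AffE8 => nth 0 [:: 1; 2; 3; 4; 5; 6; 7; 8; 7] i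
  end%N.

Lemma all_iotaP (P : pred nat) n : all P (iota 0 n.+1) -> forall i, (i <= n)%N -> P i.
Proof. by move=> /allP allP i le_in; apply: allP; rewrite mem_iota ltnS. Qed.

(** For a diagram without parameters the description of the edges by parents is
    checked by computation. *)
Lemma tree_edge_check T :
  all (fun i => all (fun j => affine_edge T i j ==
    ((0 < i)%N && (parent T i == j)) || ((0 < j)%N && (parent T j == i)))
      (iota 0 (rk T).+1)) (iota 0 (rk T).+1) ->
  forall i j, (i <= rk T)%N -> (j <= rk T)%N -> affine_edge T i j =
    ((0 < i)%N && (parent T i == j)) || ((0 < j)%N && (parent T j == i)).
Proof. by move=> /all_iotaP allT i j /allT/all_iotaP all_i /all_i/eqP. Qed.

Lemma tree_edge T i j : ~~ is_typeA T -> admissible T ->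
  (i <= rk T)%N -> (j <= rk T)%N ->
  affine_edge T i j =
  ((0 < i)%N && (parent T i == j)) || ((0 < j)%N && (parent T j == i)).
Proof.
case: T => [n|n|||] // _ adm le_i le_j; last 3 first.
- exact: (tree_edge_check (T := AffE6)).
- exact: (tree_edge_check (T := AffE7)).
- exact: (tree_edge_check (T := AffE8)).
rewrite /= in adm le_i le_j.
have mem_parent u v : (u, v) \in affine_edges (AffD n) ->
    ((0 < u)%N && (parent (AffD n) u == v)) || ((0 < v)%N && (parent (AffD n) v == u)).
  rewrite mem_edgesD /parent.
  case/or4P=> [/andP[/eqP-> /eqP->]|/andP[/eqP-> /eqP->]|/andP[/eqP-> /eqP->]|/orP[]] //.
  - by apply/orP; right; repeat (case: ifP => ?; try lia); lia.
  - move=> /andP[/eqP-> /eqP->].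
    by apply/orP; right; repeat (case: ifP => ?; try lia); lia.
  - move=> /and3P[/eqP-> ? ?].
    by apply/orP; right; repeat (case: ifP => ?; try lia); lia.
have parent_edge u : (0 < u <= n)%N -> affine_edge (AffD n) u (parent (AffD n) u).
  move=> lt0u; rewrite /parent; case: ifP => [u1|?].
    by apply/orP; left; rewrite mem_edgesD; lia.
  case: ifP => [u2|?]; first by apply/orP; right; rewrite mem_edgesD; lia.
  by case: ifP => [un|?]; apply/orP; right; rewrite mem_edgesD; lia.
apply/idP/idP.
  by case/orP=> /mem_parent //; rewrite orbC.
case/orP=> /andP[lt0 /eqP par].
  by rewrite -par parent_edge // lt0.
by rewrite /affine_edge edgeC -par -/(affine_edge _ _ _) parent_edge // lt0.
Qed.

Lemma parent_le T i : admissible T -> (0 < i <= rk T)%N -> (parent T i <= rk T)%N.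
Proof.
case: T => [n|n|||] adm /andP[lt0i le_i]; rewrite /= in adm le_i; last 3 first.
- exact: (all_iotaP (P := fun i => (parent AffE6 i <= 6)%N) (n := 6) isT) le_i.
- exact: (all_iotaP (P := fun i => (parent AffE7 i <= 7)%N) (n := 7) isT) le_i.
- exact: (all_iotaP (P := fun i => (parent AffE8 i <= 8)%N) (n := 8) isT) le_i.
- by rewrite /=; lia.
- by rewrite /parent; repeat case: ifP => ? /=; rewrite /=; lia.
Qed.

Lemma level_parent T i : admissible T -> (0 < i <= rk T)%N ->
  level T i = (level T (parent T i)).+1.
Proof.
case: T => [n|n|||] adm /andP[lt0i le_i]; rewrite /= in adm le_i; last 3 first.
- by have /implyP/(_ lt0i)/eqP := all_iotaP (P := fun i => (0 < i)%N ==>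
    (level AffE6 i == (level AffE6 (parent AffE6 i)).+1)) (n := 6) isT le_i.
- by have /implyP/(_ lt0i)/eqP := all_iotaP (P := fun i => (0 < i)%N ==>
    (level AffE7 i == (level AffE7 (parent AffE7 i)).+1)) (n := 7) isT le_i.
- by have /implyP/(_ lt0i)/eqP := all_iotaP (P := fun i => (0 < i)%N ==>
    (level AffE8 i == (level AffE8 (parent AffE8 i)).+1)) (n := 8) isT le_i.
- by rewrite /=; lia.
- rewrite /parent; case: ifP => [/eqP->|c1].
    by rewrite /level /=; repeat (case: ifP => ? /=; try lia).
  case: ifP => [/eqP->|c2]; first by rewrite /=; case: ifP => //; lia.
  case: ifP => [/eqP->|c3].
    by rewrite /level eqxx; do ?[case: ifP => ?]; lia.
  by rewrite /level; do ?[case: ifP => ?]; lia.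
Qed.

Lemma level_le T i : admissible T -> (i <= rk T)%N -> (level T i <= (rk T).+1)%N.
Proof.
case: T => [n|n|||] adm le_i; rewrite /= in adm le_i; last 3 first.
- exact: (all_iotaP (P := fun i => (level AffE6 i <= 7)%N) (n := 6) isT) le_i.
- exact: (all_iotaP (P := fun i => (level AffE7 i <= 8)%N) (n := 7) isT) le_i.
- exact: (all_iotaP (P := fun i => (level AffE8 i <= 9)%N) (n := 8) isT) le_i.
- by rewrite /=; lia.
- by rewrite /level; repeat (case: ifP => ? /=); rewrite /=; lia.
Qed.

Section AffineTree.

Variable T : affine_type.
Hypotheses (adm : admissible T) (tree : ~~ is_typeA T).
Local Notation I := 'I_(rk T).+1.

Let par (i : I) : option I := if i == ord0 then None else Some (inord (parent T i)).
Let lev (u : option I) : nat := oapp (fun i : I => level T i) 0%N u.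

Let pos_le (i : I) : i != ord0 -> (0 < i <= rk T)%N.
Proof.
move=> nz_i; rewrite lt0n [(_ <= rk T)%N]leq_ord andbT.
by apply: contra nz_i => /eqP i0; apply/eqP/val_inj.
Qed.

Let e_par i w : ext_adj T (Some i) w =
  (w == par i) || (if w is Some j then par j == Some i else false).
Proof.
have par_eq (k l : I) : (par k == Some l) = (0 < k)%N && (parent T k == l).
  rewrite /par; have [-> | nz_k] := eqVneq k ord0; first by [].
  have /andP[-> _] := pos_le nz_k.
  have lt_par : (parent T k < (rk T).+1)%N by rewrite ltnS parent_le ?pos_le.
  apply/eqP/eqP => [[<-] | par_k]; first by rewrite inordK.
  by congr Some; apply: val_inj; rewrite /= inordK.
case: w => [j|] /=; last first.
  by rewrite orbF /par; case: (i == ord0).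
rewrite [Some j == _]eq_sym !par_eq -tree_edge ?leq_ord //.
Qed.

Let lev_par i : lev (Some i) = (lev (par i)).+1.
Proof.
rewrite /par; have [-> | nz_i] := eqVneq i ord0.
  by rewrite /lev /=; case: T tree => // n _; rewrite /level; case: n.
by rewrite /lev /= level_parent ?pos_le // inordK // ltnS parent_le ?pos_le.
Qed.

Let lev_lt u : (lev u < #|{: option I}|)%N.
Proof.
rewrite card_option card_ord; case: u => [i|] //=.
by rewrite ltnS level_le // -ltnS.
Qed.

Let dist_lev u : dist_ext u = lev u.
Proof. exact: (gdist_lev e_par lev_par (erefl _) lev_lt). Qed.

(** The hypotheses of [form_green] for the set of vertices whose shortest paths to
    the extra vertex pass through [i]. *)
Lemma descendants_boundary i u : next_to_root i u ->
  [/\ i \in descendants i, ext_adj T (Some i) u,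
      forall k, k \in descendants i -> u != Some k
    & forall k w, k \in descendants i -> ext_adj T (Some k) w ->
        (exists2 j, j \in descendants i & w = Some j) \/ (k = i /\ w = u)].
Proof.
have QP i' k : reflect
    (forall p, path (ext_adj T) (Some k) p && (last (Some k) p == None) ->
       size p = lev (Some k) -> Some i' \in Some k :: p)
    (k \in descendants i').
  rewrite inE; apply: (iffP forallP) => [allp p path_p size_p | allp p].
    rewrite -dist_lev in size_p.
    by have /implyP := allp (tcast size_p (in_tuple p)); rewrite val_tcast; apply.
  by apply/implyP=> path_p; apply: allp => //; rewrite size_tuple dist_lev.
move=> /andP[adj_iu]; rewrite !dist_lev => lt_lev.
have -> : u = par i by apply: (next_par e_par lev_par) lt_lev.
split.
- exact: (subtree_refl QP).
- by rewrite e_par eqxx.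
- by move=> k; apply: (par_notin_subtree e_par lev_par (erefl _) QP).
- by move=> k w; apply: (subtree_boundary e_par lev_par (erefl _) QP).
Qed.

End AffineTree.

(** ** Harmonic families *)

(** The rows of [(zq - a) F = f e_0]; with [f] as the value at the extra vertex,
    [zq * F i] is the sum of the values at the neighbours of [i]. *)
Definition harmonic (T : affine_type) (f : Qq) (F : 'I_(rk T).+1 -> Qq) : Prop :=
  forall i, zq * F i - \sum_j affine_mx Qq T i j * F j = (i == ord0)%:R * f.

Lemma harmonic_ext T f F : harmonic f F -> forall i,
  zq * extend f F (Some i) = \sum_(w | ext_adj T (Some i) w) extend f F w.
Proof.
move=> harm i; rewrite big_mkcond (bigD1 None) //= (reindex_omap Some id) /=; last by case.
have -> : (if i == ord0 then f else 0) = (i == ord0)%:R * f.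
  by case: eqP; rewrite ?mul1r ?mul0r.
rewrite -harm -[LHS](subrK (\sum_j affine_mx Qq T i j * F j)); congr (_ + _).
apply: eq_big => [j | j _]; first by rewrite eqxx.
rewrite affine_mxE mxE /affine_adj -/(affine_edge _ _ _).
by case: ifP => _; rewrite ?mul1r ?mul0r.
Qed.

Lemma harmonic_scale T f (F : 'I_(rk T).+1 -> Qq) c :
  harmonic f F -> harmonic (f * c) (fun i => F i * c).
Proof.
move=> harm i; rewrite !mulrA -harm mulrBl mulr_suml; congr (_ - _).
by apply: eq_bigr => j _; rewrite mulrA.
Qed.

(** The neighbours of [k] on the cycle are [k - 1] and [k + 1], and the extra vertex
    is joined to the affine one only. *)
Lemma harmonicA_rec n f (F : 'I_n.+1 -> Qq) : (2 <= n)%N -> harmonic (T := AffA n) f F ->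
  let C k := F (inord (k %% n.+1)) in
  forall k, (0 < k <= n)%N -> C k.-1 - zq * C k + C k.+1 = 0.
Proof.
move=> le2n harm C k /andP[lt0k le_kn]; pose i : 'I_n.+1 := inord k.
have val_i : i = k :> nat by rewrite inordK.
have nz_i : (i == ord0) = false by apply/eqP=> /(congr1 val); rewrite /= val_i; lia.
have := harm i; rewrite nz_i mul0r.
have C_lt l : (l <= n)%N -> C l = F (inord l) by move=> le_ln; rewrite /C modn_small.
have -> : \sum_j affine_mx Qq (AffA n) i j * F j = C k.-1 + C k.+1.
  have adm : admissible (AffA n) by [].
  have := @sum_nbrs Qq (AffA n) i (fun l => F (inord l)) adm.
  under eq_bigr => j _ do rewrite inord_val.
  move=> ->; rewrite val_i /nbrs; case: ifP => [/eqP k0 | _]; first by lia.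
  case: ifP => [/eqP k_n | ne_kn]; rewrite !big_cons big_nil addr0.
    by rewrite (C_lt k.-1) ?k_n ?leq_pred // /C modnn.
  have lt_kn : (k < n)%N by lia.
  by rewrite (C_lt k.+1 lt_kn) (C_lt k.-1) //; lia.
rewrite -(C_lt _ le_kn) => /subr0_eq->; ring.
Qed.

(** The set [S] of [form_green] is a subtree, or the whole diagram, which only the
    edge from the affine to the extra vertex leaves; on an arc of the cycle the
    three-term recursion takes its place. *)
Theorem harmonic_bezout T f (F : 'I_(rk T).+1 -> Qq) : admissible T ->
  harmonic f F -> bezout_wronsky f F.
Proof.
move=> adm harm; have harm_ext := harmonic_ext harm.
have green i u (S : {set 'I_(rk T).+1}) : i \in S -> ext_adj T (Some i) u ->
    (forall k, k \in S -> u != Some k) ->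
    (forall k w, k \in S -> ext_adj T (Some k) w ->
       (exists2 j, j \in S & w = Some j) \/ (k = i /\ w = u)) ->
    bez_formula (Bezq (extend f F u) (F i)) F S /\
    wr_formula (Wr (extend f F u) (F i)) F S.
  move=> Si adj_iu notS_u bd; split.
    apply: bez_formulaI => L iota x y trx try ne_xy; rewrite bez_formE -bez_sum //.
    congr (_ / _); have BD := bez_formD trx try.
    exact: (form_green BD (@bez_formC _ iota x y) (@iota2 _ iota) harm_ext Si adj_iu).
  rewrite /wr_formula mulr_sumr.
  rewrite (form_green WrD WrC Qq2 harm_ext Si adj_iu notS_u bd).
  by apply: eq_bigr => k _; apply: Wr_zq.
split.
- move=> tree i u next_iu.
  by have [Qi adj_iu notQ_u bd] := descendants_boundary adm tree next_iu; apply: green.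
- apply: (green ord0 None); rewrite ?inE // => k [j|] _ /=; first by left; exists j; rewrite ?inE.
  by move=> /eqP; right.
case: T f F adm harm {harm_ext green} => [n|n|||] // f F adm harm _ i j le1i le_ij le_jn.
move=> C S; have {}le_jn : (j <= n)%N := le_jn.
have recC k : (i <= k < j.+1)%N -> C k.-1 - zq * C k + C k.+1 = 0.
  by move=> /andP[le_ik lt_kj]; apply: (harmonicA_rec adm harm); lia.
have lt_ij : (0 < i <= j.+1)%N by lia.
have sumS (V : zmodType) (G : 'I_n.+1 -> V) :
    \sum_(i <= k < j.+1) G (inord (k %% n.+1)) = \sum_(k in S) G k.
  rewrite (big_nat_widen _ _ n.+1) // (big_nat_widenl _ 0%N) // big_mkord.
  apply: eq_big => k; first by rewrite inE andbC.
  by move=> _; rewrite modn_small // inord_val.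
split.
  apply: bez_formulaI => L iota x y trx try ne_xy.
  rewrite -(sumS _ (fun k => ev iota x (F k) * ev iota y (F k))) -bez_sum //.
  rewrite /addk !bez_formE (bez_formC _ _ _ (C j.+1)) -mulrDl; congr (_ / _).
  have := form_three_term (bez_formD trx try) (@bez_formC _ iota x y) lt_ij recC.
  by move=> ->; rewrite addrK.
rewrite /wr_formula (WrC (C j.+1)) (form_three_term WrD WrC lt_ij recC) addrK mulr_sumr.
by rewrite -sumS; apply: eq_bigr => k _; apply: Wr_zq.
Qed.

(** ** Branches *)

Lemma det_mx2 (R : fieldType) (a b c d : R) : \det (mx2 a b c d) = a * d - b * c.
Proof.
rewrite (expand_det_row _ 0) !big_ord_recl big_ord0 addr0 /cofactor !det_mx11 !mxE /=.
by rewrite !expr0 expr1 mul1r mulN1r mulrN.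
Qed.

Lemma mul_mx2 (R : fieldType) (z a b c d : R) :
  mx2 0 1 (-1) z *m mx2 a b c d = mx2 c d (z * c - a) (z * d - b).
Proof.
apply/matrixP=> i j; rewrite !mxE !big_ord_recl big_ord0 !mxE /=.
by case: (i == 0); case: (j == 0); ring.
Qed.

Lemma ratio_step (R : fieldType) (a b c : R) : b != 0 -> c != 0 ->
  a / b = (a * c - b * b) * (b * c)^-1 + b / c.
Proof. by move=> nzb nzc; field; rewrite nzb nzc. Qed.

Lemma cfrac_step (R : fieldType) (z a b : R) : b != 0 ->
  z - (z * b - a) / b = a / b.
Proof. by move=> nzb; field. Qed.

Section Branch.

Variables (k : nat) (C : nat -> Qq).
Hypothesis recC : forall i, (0 < i < k)%N -> C i.-1 - zq * C i + C i.+1 = 0.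
Hypothesis nzC : forall i, (i <= k)%N -> C i != 0.

Let recS i : (0 < i < k)%N -> C i.+1 = zq * C i - C i.-1.
Proof. by move=> /recC/eqP; rewrite addrC addr_eq0 opprB => /eqP. Qed.

Lemma branch_mx i : (0 < i < k)%N ->
  mx2 (C i.-1) (C i) (C i) (C i.+1) =
  mx2 0 1 (-1) zq ^+ i.-1 *m mx2 (C 0) (C 1) (C 1) (C 2).
Proof.
case: i => // i /=; elim: i => [_ | i IHi lt_ik]; first by rewrite expr0 mul1mx.
have lt_i : (i.+1 < k)%N := ltnW lt_ik.
rewrite exprS -mulmxE -mulmxA -IHi // mul_mx2 -(recS (i := i.+1)) //.
by rewrite -(recS (i := i.+2)).
Qed.

(** The matrix of the recursion has determinant 1. *)
Lemma branch_det i : (0 < i < k)%N ->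
  C i.-1 * C i.+1 - C i * C i = \det (mx2 (C 0) (C 1) (C 1) (C 2)).
Proof.
move=> ik; rewrite -det_mx2 branch_mx // det_mulmx.
suff -> : \det (mx2 0 1 (-1) zq ^+ i.-1) = 1 by rewrite mul1r.
elim: i.-1 => [|j IHj]; first by rewrite expr0 det1.
by rewrite exprS -mulmxE det_mulmx IHj det_mx2; ring.
Qed.

(** [C_(i-1) / C_i - C_i / C_(i+1)] is the determinant, which does not depend on
    [i], divided by [C_i C_(i+1)]. *)
Lemma branch_ratio i : (0 < i <= k)%N ->
  C i.-1 / C i = \det (mx2 (C 0) (C 1) (C 1) (C 2)) *
    (\sum_(i.+1 <= j < k.+1) (C j.-1 * C j)^-1) + C k.-1 / C k.
Proof.
move=> /andP[lt0i le_ik]; have [n def_k] : exists n, k = (i + n)%N by exists (k - i)%N; lia.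
elim: n i lt0i le_ik def_k => [|n IHn] i lt0i le_ik def_k.
  by rewrite big_geq ?mulr0 ?add0r; [have -> : k = i by lia | lia].
rewrite big_ltn; last by lia.
rewrite mulrDr -addrA -(IHn i.+1) //; try lia.
rewrite -(branch_det (i := i)); last by lia.
have nz1 : C i != 0 by apply: nzC; lia.
have nz2 : C i.+1 != 0 by apply: nzC; lia.
by rewrite [LHS](ratio_step (C i.-1) nz1 nz2).
Qed.

Lemma branch_cfrac i : (0 < i <= k)%N ->
  C i / C i.-1 = iter (k - i) (fun t => (zq - t)^-1) (C k / C k.-1).
Proof.
move=> /andP[lt0i le_ik]; have [n def_k] : exists n, k = (i + n)%N by exists (k - i)%N; lia.
elim: n i lt0i le_ik def_k => [|n IHn] i lt0i le_ik def_k.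
  by have -> : k = i; [lia | rewrite subnn].
have -> : (k - i = (k - i.+1).+1)%N by lia.
rewrite iterS -(IHn i.+1) //=; try lia.
have nz1 : C i != 0 by apply: nzC; lia.
have -> : zq - C i.+1 / C i = C i.-1 / C i.
  rewrite recS; last by lia.
  exact: cfrac_step.
by rewrite invf_div.
Qed.

Theorem branch_identitiesP : branch_identities k C.
Proof.
move=> i /andP[lt0i le_ik]; have ik : (0 < i < k)%N by lia.
have le_i : (0 < i <= k)%N by lia.
have rec_i j : (i <= j < k)%N -> C j.-1 - zq * C j + C j.+1 = 0.
  by move=> ?; apply: recC; lia.
split; first by split; [exact: recC | exact: branch_mx | exact: branch_ratio | exact: branch_cfrac].
split=> [L iota x y trx try ne_xy | ].
  rewrite !bez_formE -bez_sum // -mulrDl; congr (_ / _).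
  exact: (form_three_term (bez_formD trx try) (@bez_formC _ iota x y) le_i rec_i).
rewrite (form_three_term WrD WrC le_i rec_i) mulr_sumr; congr (_ + _).
by apply: eq_bigr => j _; apply: Wr_zq.
Qed.

End Branch.

Lemma ext_adjC T u v : ext_adj T u v = ext_adj T v u.
Proof. by case: u v => [i|] [j|] //=; rewrite /affine_adj edgeC. Qed.

Lemma branch_rec T f (F : 'I_(rk T).+1 -> Qq) k v :
  harmonic f F -> is_branch k v -> forall i, (0 < i < k)%N ->
  extend f F (v i.-1) - zq * extend f F (v i) + extend f F (v i.+1) = 0.
Proof.
move=> /harmonic_ext harm [_ adj inj val2] i /andP[lt0i lt_ik].
have := val2 i; rewrite lt0i lt_ik => /(_ isT) card2.
have adj1 : ext_adj T (v i) (v i.-1).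
  by rewrite ext_adjC -{2}(prednK lt0i) adj //; lia.
have adj2 := adj i lt_ik.
have ne_v : v i.-1 != v i.+1.
  by apply/eqP=> /inj eq_i; have := eq_i _ _; lia.
have nbrs2 : [set w | ext_adj T (v i) w] = [set v i.-1; v i.+1].
  apply/esym/eqP; rewrite eqEcard cards2 ne_v cardsE card2 andbT.
  by apply/subsetP=> w; rewrite !inE => /orP[] /eqP->.
case def_v: (v i) nbrs2 card2 => [l|] nbrs2 card2; last first.
  suff : (#|[pred w | ext_adj T None w]| <= 1)%N by rewrite card2.
  rewrite -(card1 (Some (ord0 : 'I_(rk T).+1))); apply/subset_leq_card/subsetP=> w.
  by rewrite !inE; case: w => [l|] //= /eqP->.
rewrite harm (eq_bigl (fun w => w \in [set v i.-1; v i.+1])) => [|w]; last first.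
  by rewrite -nbrs2 inE.
rewrite big_setU1 /=; last by rewrite inE.
by rewrite big_set1; ring.
Qed.
(** * The Poincare series and the walk series *)

Section Series.

Variable T : affine_type.
Hypothesis adm : admissible T.
Local Notation I := 'I_(rk T).+1.
Local Notation a := (affine_mx Qq T).

Let wg : weighted_graph a := affine_weighted Qq adm.
Let nzH : graph_poly a zq != 0 := affine_poly_neq0 adm.

Let nat_a i j : a i j = (affine_edge T i j : nat)%:R.
Proof. by rewrite affine_mxE mxE. Qed.

Definition affine_solution (i : I) : Qq := @Hz T (Some i) / (q * @Hz T None).

Lemma H_harmonic : harmonic (@Hz T None) (fun i : I => @Hz T (Some i)).
Proof. by move=> i; rewrite /Hz /= graph_cof_row. Qed.

Lemma affine_solution_harmonic : harmonic q^-1 affine_solution.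
Proof.
move=> i; have := harmonic_scale (q * @Hz T None)^-1 H_harmonic i.
move=> ->; congr (_ * _); rewrite invfM mulrCA.
by rewrite (mulfV (nzH : @Hz T None != 0)) mulr1.
Qed.

(** The difference of [F] and a partial sum solves the linear system whose right
    side is the residual, so it is at least as divisible by [q] as the residual. *)
Lemma residual_qadic f (F : I -> Qq) (u : nat -> I -> Qq) :
  harmonic f F ->
  (forall n, exists M0, forall M, (M0 <= M)%N -> forall i,
     exists2 g, regular_at_0 g &
       (i == ord0)%:R * f - (zq * (\sum_(k < M) u k i)
         - \sum_j a i j * (\sum_(k < M) u k j)) = q ^+ n * g) ->
  forall i, qadic_sum (u^~ i) (F i).
Proof.
move=> harm res i n; have [M0 resM] := res n; exists M0 => M le_M.
apply: (graph_solve_regular wg nat_a (X := fun i => F i - \sum_(k < M) u k i)) => j.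
have [g rg eg] := resM M le_M j; exists g => //=; rewrite -eg -harm /=.
have -> : \sum_k a j k * (F k - \sum_(l < M) u l k) =
    \sum_k a j k * F k - \sum_k a j k * (\sum_(l < M) u l k).
  by rewrite -sumrB; apply: eq_bigr => k _; rewrite mulrBr.
by ring.
Qed.

Section Multiplicities.

Variable mult : nat -> I -> nat.
Hypothesis mult_0 : forall i, mult 0 i = (i == ord0).
Hypothesis mult_1 : forall i, (\sum_j affine_adj T j i * mult 0 j)%N = mult 1 i.
Hypothesis mult_S : forall m i,
  (\sum_j affine_adj T j i * mult m.+1 j = mult m.+2 i + mult m i)%N.

Let c m i : Qq := (mult m i)%:R.

Let sum_adj m i : \sum_j a i j * c m j = (\sum_j affine_adj T j i * mult m j)%N%:R.
Proof.
rewrite natr_sum; apply: eq_bigr => j _.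
by rewrite nat_a natrM /affine_adj edgeC.
Qed.

(** By the recursion for the multiplicities all powers of [q] cancel except the
    lowest and the two highest ones. *)
Lemma poincare_residual m i :
  zq * (\sum_(k < m.+1) c k i * q ^+ k) - \sum_j a i j * (\sum_(k < m.+1) c k j * q ^+ k) =
  (i == ord0)%:R * q^-1 - c m.+1 i * q ^+ m + c m i * q ^+ m.+1.
Proof.
elim: m => [|m IHm].
  rewrite big_ord1 expr0 mulr1; under eq_bigr => j _ do rewrite big_ord1 expr0 mulr1.
  have c0 : c 0 i = (i == ord0)%:R by rewrite /c mult_0.
  by rewrite sum_adj mult_1 -/(c 1 i) c0 /zq expr1; ring.
have -> : \sum_j a i j * (\sum_(k < m.+2) c k j * q ^+ k) =
    \sum_j a i j * (\sum_(k < m.+1) c k j * q ^+ k)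
      + (\sum_j a i j * c m.+1 j) * q ^+ m.+1.
  rewrite mulr_suml -big_split /=; apply: eq_bigr => j _.
  by rewrite big_ord_recr mulrDr mulrA.
rewrite big_ord_recr /= sum_adj mult_S natrD -!/(c _ _).
transitivity ((zq * (\sum_(k < m.+1) c k i * q ^+ k) -
    \sum_j a i j * (\sum_(k < m.+1) c k j * q ^+ k)) +
    (zq * c m.+1 i - (c m.+2 i + c m i)) * q ^+ m.+1); first by ring.
rewrite IHm /zq !exprS; have := mulVf q_neq0.
move: (q^-1) (q ^+ m) (c m.+1 i) (c m.+2 i) (c m i) => v t x y w vq.
transitivity ((i == ord0)%:R * v - x * t + w * (q * t) +
    (q * x * (q * t) + (v * q) * x * t - (y + w) * (q * t))); first by ring.
by rewrite vq; ring.
Qed.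

Lemma affine_solution_poincare : is_poincare mult affine_solution.
Proof.
apply: (residual_qadic affine_solution_harmonic) => n.
exists n.+1 => -[// | m] le_nm i.
exists (q ^+ (m - n) * (c m.+1 i - c m i * q)).
  apply: regularM; first exact/regularX/regularq.
  by apply: regularB; [apply: regularn | apply/regularM/regularq/regularn].
rewrite poincare_residual mulrA -exprD subnKC // exprS; ring.
Qed.

Lemma poincare_unique P : is_poincare mult P -> P =1 affine_solution.
Proof. by move=> PP i; apply: qadic_unique (PP i) (affine_solution_poincare i). Qed.

End Multiplicities.

Local Notation W := (@walks_to_0 T).

Lemma walks_to_0_0 i : W 0 i = (i == ord0)%:R.
Proof.
rewrite /walks_to_0; have [i0 | ne_i0] := eqVneq i ord0.
  by rewrite (big_pred1 [tuple]) // => p; rewrite tuple0 /= i0 !eqxx.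
by rewrite big_pred0 // => p; rewrite tuple0 /= (negPf ne_i0).
Qed.

Lemma walks_to_0_S k i : W k.+1 i = \sum_j a i j * W k j.
Proof.
rewrite /walks_to_0.
rewrite (reindex (fun jp : I * k.-tuple I => [tuple of jp.1 :: jp.2])) /=; last first.
  exists (fun p : k.+1.-tuple I => (thead p, [tuple of behead p])) => [[j p] _ | p _].
    by congr (_, _); apply: val_inj.
  by rewrite [RHS]tuple_eta; apply: val_inj.
transitivity (\sum_j \sum_(p : k.-tuple I |
    affine_adj T i j && path (affine_adj T) j p && (last j p == ord0))
    a i j * walk_weight a j p).
  by rewrite pair_big_dep.
apply: eq_bigr => j _; rewrite mulr_sumr.
case adj_ij: (affine_adj T i j) => /=; first by apply: eq_bigl.
have -> : a i j = 0.
  by move: adj_ij; rewrite /affine_adj affine_mxE mxE /affine_edge => ->.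
by rewrite big_pred0 // big1 // => p _; rewrite mul0r.
Qed.

Lemma walks_regular k i : regular_at_0 (W k i).
Proof.
elim: k i => [|k IHk] i; first by rewrite walks_to_0_0; apply: regularn.
rewrite walks_to_0_S; apply: regular_sum => j; apply: regularM => //.
by rewrite nat_a; apply: regularn.
Qed.

Lemma zq_neq0 : zq != 0.
Proof. by rewrite -cA1 cA_path; apply: rel_poly_neq0; [exact: path_relC | exact: path_rel_irr]. Qed.

Lemma zqV : exists2 g, regular_at_0 g & zq^-1 = q * g.
Proof.
exists ((@FracField.tofrac {poly rat} ('X^2 + 1))^-1).
  by apply: regularV; rewrite hornerD hornerXn hornerC expr0n add0r oner_eq0.
rewrite tofracD tofracXn tofrac1 -/q.
have -> : q ^+ 2 + 1 = q * zq.
  by rewrite /zq mulrDr mulfV ?q_neq0.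
by rewrite invfM mulrA mulfV ?q_neq0 // mul1r.
Qed.

(** The partial sums of the Neumann series: the sum telescopes because one more step
    of a walk is one more factor [a]. *)
Lemma walk_residual K i :
  zq * (\sum_(k < K) W k i * zq ^- k.+1)
    - \sum_j a i j * (\sum_(k < K) W k j * zq ^- k.+1) =
  (i == ord0)%:R - W K i * zq ^- K.
Proof.
elim: K => [|K IHK].
  rewrite big_ord0 mulr0 expr0 invr1 mulr1 walks_to_0_0 subrr.
  by rewrite big1 ?subr0 // => j _; rewrite big_ord0 mulr0.
have -> : \sum_j a i j * (\sum_(k < K.+1) W k j * zq ^- k.+1) =
    \sum_j a i j * (\sum_(k < K) W k j * zq ^- k.+1)
      + W K.+1 i * zq ^- K.+1.
  rewrite walks_to_0_S mulr_suml -big_split /=; apply: eq_bigr => j _.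
  by rewrite big_ord_recr mulrDr mulrA.
rewrite big_ord_recr /=.
transitivity ((zq * (\sum_(k < K) W k i * zq ^- k.+1)
    - \sum_j a i j * (\sum_(k < K) W k j * zq ^- k.+1))
    + (W K i * (zq * zq ^- K.+1) - W K.+1 i * zq ^- K.+1)).
  by ring.
by rewrite IHK exprS invfM mulVKf ?zq_neq0 //; ring.
Qed.

Lemma walk_series i :
  qadic_sum (fun k => W k i * zq ^- k.+1) (q * affine_solution i).
Proof.
have [g rg zqVE] := zqV.
have harm : harmonic 1 (fun i => q * affine_solution i).
  move=> j; have := harmonic_scale q affine_solution_harmonic j.
  rewrite (mulVf q_neq0) => <-; rewrite [q * _]mulrC; congr (_ - _).
  by apply: eq_bigr => k _; rewrite [q * _]mulrC.
apply: (residual_qadic (u := fun k i => W k i * zq ^- k.+1) harm) => n; exists n => M le_nM j.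
exists (q ^+ (M - n) * (W M j * g ^+ M)).
  apply: regularM; first exact/regularX/regularq.
  by apply: regularM; [apply: walks_regular | apply: regularX].
rewrite walk_residual mulr1 opprB addrC subrK mulrA -exprD subnKC //.
by rewrite -exprVn zqVE exprMn; ring.
Qed.

End Series.

(** * The affine diagrams without one vertex, and the cycle *)

(** A function as required by [coxeter_potential], for the trees D and E: it is the
    number of the vertex, except on the arms attached out of order. *)
Definition potential (T : affine_type) (i : nat) : nat :=
  match T with
  | AffA n => i
  | AffD n => if i == 0 then 1 else if i == n then n.-1 else i
  | AffE6 => nth 0 [:: 0; 1; 2; 3; 4; 3; 4] i
  | AffE7 => nth 0 [:: 0; 1; 2; 3; 4; 5; 6; 4] i
  | AffE8 => nth 0 [:: 0; 1; 2; 3; 4; 5; 6; 7; 6] i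
  end%N.

Lemma potential_check T :
  all (fun i => all (fun j => (i < j)%N && affine_edge T i j ==>
    (potential T j == (potential T i).+1)) (iota 0 (rk T).+1)) (iota 0 (rk T).+1) ->
  forall i j, (i < j <= rk T)%N -> affine_edge T i j -> potential T j = (potential T i).+1.
Proof.
move=> /all_iotaP allT i j /andP[lt_ij le_j] e_ij.
have /all_iotaP/(_ _ le_j) := allT i (ltnW (leq_trans lt_ij le_j)).
by rewrite lt_ij e_ij => /eqP.
Qed.

Lemma potential_edge T i j : admissible T -> ~~ is_typeA T ->
  (i < j <= rk T)%N -> affine_edge T i j -> potential T j = (potential T i).+1.
Proof.
case: T => [n|n|||] // adm _; last 3 first.
- exact: (potential_check (T := AffE6)).
- exact: (potential_check (T := AffE7)).
- exact: (potential_check (T := AffE8)).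
rewrite /= in adm; move=> /andP[lt_ij le_j].
have {}le_j : (j <= n)%N := le_j.
rewrite /affine_edge /edge !mem_edgesD /potential.
case/orP => [|/or4P[/andP[/eqP ei /eqP ej]|/andP[/eqP ei /eqP ej]|/andP[/eqP ei /eqP ej]|
  /orP[/andP[/eqP ei /eqP ej]|/and3P[/eqP ei ? ?]]]]; try lia.
case/or4P=> [/andP[/eqP ei /eqP ej]|/andP[/eqP ei /eqP ej]|/andP[/eqP ei /eqP ej]|
  /orP[/andP[/eqP ei /eqP ej]|/and3P[/eqP ei ? ?]]].
- by rewrite ei ej /=; case: ifP => ?; lia.
- by rewrite ei ej /=; do ?[case: ifP => ?]; lia.
- by do ?[case: ifP => ?]; lia.
- by do ?[case: ifP => ?]; lia.
- by do ?[case: ifP => ?]; lia.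
Qed.

Lemma lift_ltn n (d : 'I_n) (k l : 'I_n.-1) : (k < l)%N -> (lift d k < lift d l)%N.
Proof. by rewrite /= /bump; case: (leqP d k); case: (leqP d l) => /=; lia. Qed.

(** On either side of the deleted vertex [d] the potential is the number of the
    vertex up to a constant; the constants [n] and 1 make it rise by one along the
    edge from 0 to [n] too. *)
Lemma cycle_potential n d i j : (2 <= n)%N -> (0 < d <= n)%N -> i != d -> j != d ->
  (i < j <= n)%N -> affine_edge (AffA n) i j ->
  (if j < d then j + n else j.+1)%N = (if i < d then i + n else i.+1).+1%N.
Proof.
move=> le2n le_dn ne_id ne_jd /andP[lt_ij le_jn].
rewrite /affine_edge edge_cons edge_chain.
case/or3P=> [/andP[/eqP ei /eqP ej]|/andP[/eqP ei /eqP ej]|].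
- by lia.
- by rewrite ei ej; do ?[case: ifP => ?]; lia.
- case/orP=> [/andP[/eqP ej _]|/andP[/eqP ej _]]; last by lia.
  by rewrite ej in ne_jd *; do ?[case: ifP => ?]; lia.
Qed.

(** Without a vertex [d] other than the affine one, every affine diagram is a
    forest. *)
Lemma affine_cut_potential T d : admissible T -> (0 < d <= rk T)%N ->
  exists h : nat -> nat, forall i j, i != d -> j != d -> (i < j <= rk T)%N ->
    affine_edge T i j -> h j = (h i).+1.
Proof.
move=> adm d_T; case typeA: (is_typeA T).
  case: T adm d_T typeA => // n adm d_n _.
  exists (fun i => if (i < d)%N then (i + n)%N else i.+1) => i j.
  exact: cycle_potential.
exists (potential T) => i j _ _; apply: potential_edge => //; exact: negbT.
Qed.

Lemma coxeter_affine T : admissible T -> ~~ is_typeA T ->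
  coxeter (affine_mx Qq T) q = graph_poly (affine_mx Qq T) zq.
Proof.
move=> adm tree; apply: (coxeter_rel_graph (h := potential T)).
- exact: edgeC.
- exact: affine_edge_irr.
- by move=> i j /andP[lt_ij lt_j]; apply: potential_edge => //; rewrite lt_ij -ltnS.
Qed.

Lemma coxeter_del_affine T (i : 'I_(rk T)) : admissible T ->
  coxeter (del_vertex (lift ord0 i) (affine_mx Qq T)) q =
  graph_poly (del_vertex (lift ord0 i) (affine_mx Qq T)) zq.
Proof.
move=> adm; set d := lift ord0 i.
have d_T : (0 < d <= rk T)%N by rewrite lift0 ltn_ord.
have [h hP] := affine_cut_potential adm d_T.
apply: (coxeter_potential (h := fun k => h (lift d k)) q_neq0).
  exact/weighted_graph_del/affine_weighted.
move=> k l lt_kl; rewrite !mxE => nz_kl; apply: hP.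
- by rewrite eq_sym; apply: neq_lift.
- by rewrite eq_sym; apply: neq_lift.
- by rewrite (leq_ord (lift d l)) andbT !lift_ltn.
- by move: nz_kl; rewrite /affine_edge; case: edge; rewrite ?eqxx.
Qed.

Lemma euclid_weighted T : admissible T -> weighted_graph (euclid_mx Qq T).
Proof.
move=> adm.
exact: (@weighted_graph_del _ (rk T).+1 _ ord0 (affine_weighted Qq adm)).
Qed.

Lemma coxeter_del_euclid T (i : 'I_(rk T)) : admissible T ->
  coxeter (del_vertex i (euclid_mx Qq T)) q =
  graph_poly (del_vertex i (euclid_mx Qq T)) zq.
Proof.
move=> adm; have d_T : (0 < lift ord0 i <= rk T)%N by rewrite lift0 ltn_ord.
have [h hP] := affine_cut_potential adm d_T.
apply: (coxeter_potential (h := fun k => h (lift ord0 (lift i k))) q_neq0).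
  exact/weighted_graph_del/euclid_weighted.
move=> k l lt_kl; rewrite !mxE => nz_kl; apply: hP.
- by rewrite !lift0 eqSS eq_sym; apply: neq_lift.
- by rewrite !lift0 eqSS eq_sym; apply: neq_lift.
- by rewrite (leq_ord (lift ord0 (lift i l))) andbT !lift_ltn.
- by move: nz_kl; rewrite /affine_edge; case: edge; rewrite ?eqxx.
Qed.

(** When the parts are listed one after the other, the index of the part is a
    potential. *)
Lemma coxeter_bipartite N (a : 'M[Qq]_N) (s : 'S_N) : weighted_graph a ->
  bipartite_numbering a s -> coxeter (renumber a s) q = graph_poly a zq.
Proof.
move=> wg [c bip]; rewrite -(graph_poly_renumber s zq wg).
apply: (coxeter_potential (h := fun t => nat_of_bool (c <= t)%N) q_neq0).
  split; last by move=> i; rewrite mxE (proj2 wg).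
  by apply/matrixP=> i j; rewrite !mxE (weighted_graph_sym wg).
by move=> t u lt_tu; rewrite mxE => /bip; lia.
Qed.

(** ** Closed forms *)

Lemma cA_closed k : cA k * (q - q^-1) = q ^+ k.+1 - q ^- k.+1.
Proof.
have rec (x : nat -> Qq) (y : nat -> Qq) : x 0 = y 0 -> x 1 = y 1 ->
    (forall k, x k.+2 = zq * x k.+1 - x k) -> (forall k, y k.+2 = zq * y k.+1 - y k) ->
    x =1 y.
  move=> xy0 xy1 xS yS j; suff [] : x j = y j /\ x j.+1 = y j.+1 by [].
  by elim: j => [// | j [IH1 IH2]]; rewrite xS yS IH1 IH2.
apply: (rec (fun k => cA k * (q - q^-1)) (fun k => q ^+ k.+1 - q ^- k.+1)) => [||j|j] /=.
- by rewrite cA0 mul1r expr1.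
- by rewrite cA1 -exprVn /zq; ring.
- by rewrite cAS; ring.
- rewrite -!exprVn /zq; have := mulVf q_neq0.
  move: q^-1 => v vq; rewrite !exprS.
  transitivity (q * (q * (q * q ^+ j)) - v * (v * (v * v ^+ j)) +
    (v * q - 1) * (q * q ^+ j - v * v ^+ j)); first by rewrite vq; ring.
  by ring.
Qed.

Lemma qVq_neq0 : q - q^-1 != 0.
Proof.
rewrite subr_eq0; apply/eqP=> /(congr1 ( *%R q)); rewrite mulfV ?q_neq0 //.
rewrite -tofracM -tofrac1 => /eqP; rewrite tofrac_eq => /eqP/(congr1 (fun p => p.[0])).
by rewrite hornerM hornerX hornerC mul0r => /eqP; rewrite eq_sym oner_eq0.
Qed.

(** The determinant is expanded along the row of the affine vertex, where the
    cofactors are known from the table. *)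
Lemma cycle_closed n : (2 <= n)%N ->
  graph_poly (affine_mx Qq (AffA n)) zq = q ^+ n.+1 + q ^- n.+1 - 2.
Proof.
move=> le2n; have adm : admissible (AffA n) by [].
have wg := affine_weighted Qq adm.
rewrite (graph_poly_row ord0 _ wg) -[del_vertex _ _]/(euclid_mx Qq (AffA n)).
rewrite euclid_poly //; under eq_bigr => k _ do rewrite H_table_cof //.
rewrite (@sum_nbrs Qq (AffA n) ord0 (H_table (AffA n)) adm) /nbrs /= !big_cons big_nil.
have [m def_n] : exists m, n = m.+2 by exists (n - 2)%N; lia.
rewrite def_n /H_table /= !subSS !subn0 subnn cA0.
apply: (mulIf qVq_neq0).
have := cA_closed m.+2; have := cA_closed m.+1; rewrite -!exprVn.
move: (cA m.+2) (cA m.+1) => x y ey ex.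
transitivity (zq * (x * (q - q^-1)) - 2 * (y * (q - q^-1)) - 2 * (q - q^-1)); first by ring.
rewrite ex ey /zq; have := mulVf q_neq0.
move: q^-1 => v vq; rewrite !exprS.
set s := q ^+ m; set t := v ^+ m.
transitivity ((q - v) * (q * (q * (q * s)) + v * (v * (v * t)) - 2) +
  (v * q - 1) * (2 * q * q * s - 2 * v * v * t)); first by ring.
by rewrite vq; ring.
Qed.
(** The terms [i] and [2m + 1 - i] of the binomial expansion are paired. *)
Lemma zq_power m : zq ^+ (2 * m).+1 =
  \sum_(0 <= i < m.+1) 'C((2 * m).+1, i)%:R *
     (q ^+ ((2 * m).+1 - 2 * i) + q ^- ((2 * m).+1 - 2 * i)).
Proof.
set n := (2 * m).+1; pose f i := (q ^+ (n - i) * q^-1 ^+ i) *+ 'C(n, i).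
have cancel i j : q ^+ (i + j) * q^-1 ^+ i = q ^+ j.
  by rewrite exprD mulrAC -exprMn mulfV ?q_neq0 // expr1n mul1r.
have cancelV i j : q ^+ i * q^-1 ^+ (i + j) = q ^- j.
  by rewrite exprD mulrA -exprMn mulfV ?q_neq0 // expr1n mul1r exprVn.
rewrite /zq exprDn -(big_mkord xpredT f) (big_cat_nat (n := m.+1)) //=; last by rewrite /n; lia.
rewrite [X in _ + X]big_nat_rev [X in _ + X](big_addn 0 _ m.+1) /=.
rewrite (_ : (n.+1 - m.+1 = m.+1)%N); last by rewrite /n; lia.
rewrite -big_split /=; apply: eq_big_nat => i /andP[_ le_im].
rewrite (_ : (m.+1 + n.+1 - (i + m.+1).+1 = n - i)%N); last by rewrite /n; lia.
rewrite /f bin_sub; last by rewrite /n; lia.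
have [j [e1 e2]] : exists j, (n - i = i + j)%N /\ (n - 2 * i = j)%N.
  by exists (n - 2 * i)%N; rewrite /n; lia.
rewrite e2 (_ : (n - (n - i) = i)%N); last by rewrite /n; lia.
by rewrite e1 cancel cancelV -mulrnDl mulr_natl.
Qed.

Lemma cycle_poly_even m : (0 < m)%N ->
  cycle_poly (2 * m) zq = q ^+ (2 * m).+1 + q ^- (2 * m).+1 - 2.
Proof.
move=> lt0m; rewrite /cycle_poly; case: eqP => [m0|_]; first by lia.
by apply: cycle_closed; lia.
Qed.

Lemma cycle_poly_binomial m : (0 < m)%N ->
  cycle_poly (2 * m) zq = zq ^+ (2 * m).+1
    - (\sum_(1 <= i < m.+1) 'C((2 * m).+1, i)%:R *
         (cycle_poly (2 * m - 2 * i) zq + 2 *+ (i < m)%N)) - 2.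
Proof.
move=> lt0m; rewrite cycle_poly_even // zq_power big_ltn // bin0 mul1r muln0 subn0.
congr (_ - _); rewrite [X in _ - X](eq_big_nat _ _ (F2 := fun i =>
  'C((2 * m).+1, i)%:R * (q ^+ ((2 * m).+1 - 2 * i) + q ^- ((2 * m).+1 - 2 * i)))).
  by rewrite addrK.
move=> i /andP[lt0i le_im]; congr (_ * _); have [lt_im | le_mi] := ltnP i m.
  have -> : (2 * m - 2 * i = 2 * (m - i))%N by lia.
  rewrite cycle_poly_even ?subn_gt0 // subrK.
  by have -> : ((2 * m).+1 - 2 * i = (2 * (m - i)).+1)%N by lia.
have -> : i = m by lia.
by rewrite subnn subSnn addr0 expr1 /cycle_poly eqxx.
Qed.

(** ** Nonvanishing of the cofactors *)

(** [q ^ k A_k] is the polynomial [1 + q^2 + ... + q^(2k)], positive at [q = 1];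
    the sums of two such polynomials which occur in type A therefore do not vanish. *)
Lemma cA_poly k : exists2 p : {poly rat},
  q ^+ k * cA k = @FracField.tofrac {poly rat} p & p.[1] = k.+1%:R.
Proof.
suff [] : (exists2 p : {poly rat},
    q ^+ k * cA k = @FracField.tofrac {poly rat} p & p.[1] = k.+1%:R) /\
    (exists2 p : {poly rat},
    q ^+ k.+1 * cA k.+1 = @FracField.tofrac {poly rat} p & p.[1] = k.+2%:R) by [].
elim: k => [|k [[p ep p1] [p' ep' p'1]]].
  split; first by exists 1; rewrite ?hornerC // cA0 mulr1 expr0 tofrac1.
  exists ('X^2 + 1); last by rewrite hornerD hornerXn hornerC expr1n.
  by rewrite cA1 expr1 /zq mulrDr mulfV ?q_neq0 // tofracD tofracXn tofrac1.
split; first by exists p'.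
exists (('X^2 + 1) * p' - 'X^2 * p).
  rewrite tofracB !tofracM tofracD tofracXn tofrac1 -ep -ep' -/q cAS /zq !exprS expr0.
  have := mulfV q_neq0; move: q^-1 (cA k) (cA k.+1) => v x y qv.
  transitivity ((q * q + q * v) * (q * q ^+ k * y) - q * q * (q ^+ k * x)); first by ring.
  by rewrite qv; ring.
rewrite hornerD hornerN !hornerM hornerD hornerXn hornerC expr1n p1 p'1.
have natS j : (k + j)%:R = k%:R + j%:R :> rat by rewrite natrD.
by rewrite hornerX -[k.+3]addn3 -[k.+2]addn2 -[k.+1]addn1 !natS; ring.
Qed.

Lemma cA_neq0 k : cA k != 0.
Proof. by rewrite cA_path; apply: rel_poly_neq0; [exact: path_relC | exact: path_rel_irr]. Qed.

Lemma cA_sum_neq0 i j : cA i + cA j != 0.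
Proof.
have [p ep p1] := cA_poly i; have [p' ep' p'1] := cA_poly j.
apply/eqP=> sum0; have : @FracField.tofrac {poly rat} ('X^j * p + 'X^i * p') = 0.
  rewrite tofracD !tofracM !tofracXn -ep -ep' -/q.
  transitivity (q ^+ i * q ^+ j * (cA i + cA j)); first by ring.
  by rewrite sum0 mulr0.
move=> /eqP; rewrite tofrac_eq0 => /eqP/(congr1 (fun p => p.[1])).
rewrite hornerD !hornerM !hornerXn !expr1n !mul1r p1 p'1 horner0 -natrD => /eqP.
by rewrite Num.Theory.pnatr_eq0.
Qed.

Lemma cD_neq0 k : (2 <= k)%N -> cD k != 0.
Proof.
case: k => [|[|[|k]]] // _; first by rewrite cD2 mulf_neq0 ?zq_neq0.
rewrite cD_path -fork_polyD; apply: rel_poly_neq0; first exact: fork_relC.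
by apply: fork_rel_irr; lia.
Qed.

Lemma cE_neq0 k : cE k.+4 != 0.
Proof.
rewrite cE_path -fork_polyE; apply: rel_poly_neq0; first exact: fork_relC.
exact: fork_rel_irr.
Qed.

Lemma H_table_neq0 T i : admissible T -> (i <= rk T)%N -> H_table T i != 0.
Proof.
have A k := cA_neq0 k; have A2 k : cA k ^+ 2 != 0 := expf_neq0 2 (A k).
have AA k l : cA k * cA l != 0 := mulf_neq0 (A k) (A l).
have all_c (x : Qq) s : x != 0 -> all (fun y => y != 0) s -> all (fun y => y != 0) (x :: s).
  by move=> nz_x all_s; apply/andP.
have nth_neq0 (s : seq Qq) j : all (fun y => y != 0) s -> (j < size s)%N -> s`_j != 0.
  by move=> /all_nthP; apply.
case: T => [n|n|||] adm le_i; have {}le_i := le_i; rewrite /H_table.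
- by case: ifP => _; [apply: cA_neq0 | apply: cA_sum_neq0].
- have {}adm : (4 <= n)%N := adm.
  case: ifP => _; first by apply: cD_neq0; lia.
  case: ifP => _; first by apply: cD_neq0; lia.
  case: ifP => le_in; first by rewrite mulf_neq0 ?cA_neq0 // cD_neq0 //; lia.
  by rewrite expf_neq0 // cA_neq0.
- apply: nth_neq0; last exact: le_i.
  apply: (all_c _ _ (cE_neq0 2)).
  apply: (all_c _ _ (A 5)).
  apply: (all_c _ _ (A2 2)).
  apply: (all_c _ _ (AA 1 2)).
  apply: (all_c _ _ (A 2)).
  apply: (all_c _ _ (AA 1 2)).
  apply: (all_c _ _ (A 2)).
  by [].
- apply: nth_neq0; last exact: le_i.
  apply: (all_c _ _ (cE_neq0 3)).
  apply: (all_c _ _ (cD_neq0 (k := 6) isT)).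
  apply: (all_c _ _ (A 5)).
  apply: (all_c _ _ (AA 1 3)).
  apply: (all_c _ _ (AA 1 2)).
  apply: (all_c _ _ (A2 1)).
  apply: (all_c _ _ (A 1)).
  apply: (all_c _ _ (A 3)).
  by [].
- apply: nth_neq0; last exact: le_i.
  apply: (all_c _ _ (cE_neq0 4)).
  apply: (all_c _ _ (cE_neq0 3)).
  apply: (all_c _ _ (cE_neq0 2)).
  apply: (all_c _ _ (cD_neq0 (k := 5) isT)).
  apply: (all_c _ _ (A 4)).
  apply: (all_c _ _ (AA 1 2)).
  apply: (all_c _ _ (A2 1)).
  apply: (all_c _ _ (A 1)).
  apply: (all_c _ _ (A 2)).
  by [].
Qed.

Lemma H_neq0 T u : admissible T -> @Hz T u != 0.
Proof.
move=> adm; case: u => [i|]; last exact: affine_poly_neq0.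
by rewrite [@Hz T _]H_table_cof // H_table_neq0 // leq_ord.
Qed.

Lemma kostant_den_neq0 T : admissible T -> kostant_den T != 0.
Proof.
move=> adm; have nz k : (0 < k)%N -> 1 - q ^+ k != 0.
  move=> lt0k; rewrite -tofracXn -tofrac1 -tofracB tofrac_eq0; apply/eqP.
  move=> /(congr1 (fun p => p.[0])); rewrite hornerD hornerN hornerC hornerXn horner0.
  by rewrite expr0n eqn0Ngt lt0k subr0 => /eqP; rewrite oner_eq0.
by rewrite /kostant_den mulf_neq0 // nz //; case: T adm => //= n; lia.
Qed.
(** * Klein groups and affine Dynkin diagrams *)

Lemma cycle_square (R : fieldType) (x : R) n : x != 0 ->
  x * (x ^+ n.+1 + x ^- n.+1 - 2) = x ^- n * (x ^+ n.+1 - 1) ^+ 2.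
Proof.
move=> nzx; rewrite exprS; have := expf_neq0 n nzx; move: (x ^+ n) => t nzt.
by field; rewrite nzx nzt.
Qed.

(** Jacobi's identity, for [d = H_00], [c = H_i0], [h = H_(-1)0] and the
    characteristic polynomials [s] and [t] without the vertex [i], in terms of the
    Poincare series. *)
Lemma jacobi_quotient (R : fieldType) (x h c d s t : R) : x != 0 -> h != 0 ->
  d * t - c ^+ 2 = h * s ->
  (c / (x * h)) ^+ 2 = (x * h)^-1 * (d / (x * h) * t - s * x^-1).
Proof.
move=> nzx nzh jac; have -> : s = (d * t - c ^+ 2) / h by rewrite jac mulrC mulKf.
by field; rewrite nzx nzh.
Qed.

Theorem mainTheorem2 (R : realType) (T : affine_type)
    (gT : finGroupType) (B : {group gT}) (rho : mx_representation R[i] B 2)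
    (r : 'I_(rk T).+1 -> representation R[i] B)
    (mult : nat -> 'I_(rk T).+1 -> nat) :
  admissible T ->
  klein_group rho ->
  mckay rho r ->
  (forall m, decomposes r (sym_repr rho m) (mult m)) ->
  (exists P, is_poincare mult P) /\
  forall P : 'I_(rk T).+1 -> Qq, is_poincare mult P ->
  let H := @Hz T in
  ((forall u, [/\ Pext P u != 0, Zext P u != 0 & H u != 0]) /\
   (forall u v, Pext P u / Pext P v = Zext P u / Zext P v /\
                Zext P u / Zext P v = H u / H v) /\
   (forall i, P i = H (Some i) / (q * H None)) /\
   (forall i, H (Some i) = H_table T i) /\
   (forall n, T = AffA n -> odd n ->
      forall s : 'S_n.+1, bipartite_numbering (affine_mx Qq (AffA n)) s ->
      @Hz (AffA n) None = coxeter (renumber (affine_mx Qq (AffA n)) s) q) /\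
   (~~ is_typeA T -> H None = coxeter (affine_mx Qq T) q) /\
   (forall m, T = AffA (2 * m) ->
      @Hz (AffA (2 * m)) None = cycle_poly (2 * m) zq /\
      q * cycle_poly (2 * m) zq =
        q * (zq ^+ (2 * m).+1
             - (\sum_(1 <= i < m.+1) 'C((2 * m).+1, i)%:R *
                  (cycle_poly (2 * m - 2 * i) zq + 2 *+ (i < m)%N))
             - 2) /\
      q * cycle_poly (2 * m) zq =
        q ^- (2 * m) * (q ^+ (2 * m).+1 - 1) ^+ 2) /\
   (~~ is_typeA T -> forall k v, is_branch k v ->
      branch_identities k (fun i => H (v i)))) /\
  (forall i : 'I_(rk T),
     P (lift ord0 i) ^+ 2 =
     (q * H None)^-1 *
     \det (mx2 (P ord0) (coxeter (del_vertex i (euclid_mx Qq T)) q)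
               q^-1 (coxeter (del_vertex (lift ord0 i) (affine_mx Qq T)) q))) /\
  (bezout_wronsky q^-1 P /\
   bezout_wronsky (Zext P None) (fun i => Zext P (Some i)) /\
   matrix_bezout_identities) /\
  (forall i, qadic_sum (fun k => walks_to_0 k i * zq ^- k.+1) (q * P i)).
Proof.
move=> adm [_ SU2] McKay mult_dec.
have mult_0 := mult0 McKay mult_dec; have mult_1 := mult1 McKay mult_dec.
have mult_S := mult_rec SU2 McKay mult_dec.
have nzH u : @Hz T u != 0 := H_neq0 u adm.
have nzD : kostant_den T != 0 := kostant_den_neq0 adm.
split; first by exists (@affine_solution T); apply: affine_solution_poincare.
move=> P PP H.
have PE : P =1 @affine_solution T := poincare_unique adm mult_0 mult_1 mult_S PP.
have PH u : Pext P u = H u / (q * H None).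
  case: u => [i|]; first exact: PE.
  by rewrite [Pext P None]/(q^-1) invfM mulrCA (mulfV (nzH None)) mulr1.
have nzqH : q * H None != 0 := mulf_neq0 q_neq0 (nzH None).
have nzP u : Pext P u != 0 by rewrite PH; exact: mulf_neq0 (nzH u) (invr_neq0 nzqH).
have harmP : harmonic q^-1 P.
  move=> i; rewrite PE -(affine_solution_harmonic adm i); congr (_ - _).
  by apply: eq_bigr => j _; rewrite PE.
have wg := affine_weighted Qq adm.
split; [split; [|split; [|split; [|split; [|split; [|split; [|split]]]]]]
      | split; [|split; [split; [|split]|]]].
- by move=> u; split; [exact: nzP | exact: mulf_neq0 (nzP u) nzD | exact: nzH].
- move=> u v; rewrite /Zext -mulf_div (divff nzD) mulr1; split=> //.
  by rewrite !PH -mulf_div (divff (invr_neq0 nzqH)) mulr1.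
- exact: PE.
- by move=> i; apply: H_table_cof.
- move=> n eT odd_n s bip; rewrite coxeter_bipartite //.
  by apply: affine_weighted; rewrite -eT.
- by move=> tree; rewrite coxeter_affine.
- move=> m eT; have lt0m : (0 < m)%N by move: adm; rewrite eT /=; lia.
  split; first by rewrite /cycle_poly; case: eqP => //; lia.
  split; first by rewrite {1}cycle_poly_binomial.
  by rewrite cycle_poly_even // (cycle_square _ q_neq0).
- move=> tree k v br; apply: branch_identitiesP => [i ik | i _]; last exact: nzH.
  exact: (branch_rec (H_harmonic adm) br).
- move=> i; rewrite coxeter_del_euclid // coxeter_del_affine // det_mx2.
  have nzE : graph_poly (del_vertex ord0 (affine_mx Qq T)) zq != 0.
    by rewrite -(graph_cof_diag ord0 zq wg); apply: nzH (Some ord0).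
  have := @graph_jacobi _ (rk T).+1 _ ord0 i _ wg (nzH None) nzE.
  rewrite -{1}(graph_cof_diag ord0 zq wg) -/(euclid_mx Qq T) => jac.
  rewrite !PE; exact: (jacobi_quotient q_neq0 (nzH None) jac).
- exact: harmonic_bezout.
- exact: harmonic_bezout adm (harmonic_scale _ harmP).
- exact: matrix_bezout.
- move=> i; rewrite PE; exact: walk_series.
Qed.
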